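(* Let $F$ be a field and let $(A,\sigma)$ be an $F$-algebra with involution such that $1\in\operatorname{Symd}(\sigma)$ and $\operatorname{cap}(A,\sigma)=4$, and let $n=\log_2\dim_FA-3$. Let $L$ be a biquadratic neat $F$-subalgebra of $(A,\sigma)$ and let $G=\{\operatorname{id}_L,\gamma_1,\gamma_2,\gamma_3\}$ be the Galois group of $L/F$. For $1\le i\le3$, set $$W_i=\{x\in\operatorname{Symd}(\sigma)\mid yx=x\gamma_i(y)\text{ for all }y\in L\}.$$ There exist a quadratic $n$-fold Pfister form $\pi$ over $F$ and, for $1\le i\le3$, an $F$-linear form $s_i\colon L^{\gamma_i}\to F$ with $\ker(s_i)=F$ such that $q_i\colon W_i\to F$, $x\mapsto s_i(x^2)$, is a (well-defined) quadratic form over $F$ similar to $\pi$. The Pfister form $\pi$ is uniquely determined (up to isometry) by $L$. Furthermore, $$\operatorname{Symd}(\sigma)=L\oplus W_1\oplus W_2\oplus W_3.$$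
   Context: An $F$-algebra with involution is a pair $(A,\sigma)$ of a finite-dimensional $F$-algebra $A$ and an $F$-linear anti-automorphism $\sigma$ of $A$ with $\sigma^2=\operatorname{id}_A$ such that $F=\operatorname{Z}(A)\cap\operatorname{Sym}(\sigma)$ and $A$ has no nontrivial two-sided ideals $I$ with $\sigma(I)=I$. Here $\operatorname{Sym}(\sigma)=\{x\in A\mid\sigma(x)=x\}$ and $\operatorname{Symd}(\sigma)=\{x+\sigma(x)\mid x\in A\}$. Either $\operatorname{Z}(A)=F$, and then $\sigma$ is orthogonal (resp. symplectic) if over a splitting field it is adjoint to a nondegenerate diagonalisable symmetric (resp. alternating) bilinear form; or $\operatorname{Z}(A)$ is a quadratic étale $F$-algebra on which $\sigma$ is the nontrivial automorphism, and then $\sigma$ is unitary. If $\operatorname{Z}(A)\simeq F\times F$, then $(A,\sigma)\simeq(A_0\times A_0^{\mathrm{op}},\mathrm{sw})$ with $A_0$ central simple over $F$ and $\mathrm{sw}$ the switch, and $\deg A:=\deg A_0$; otherwise $\deg A$ is the degree over $\operatorname{Z}(A)$. The capacity is $\operatorname{cap}(A,\sigma)=\deg A$ if $\sigma$ is orthogonal or unitary, and $\frac12\deg A$ if $\sigma$ is symplectic. If $\operatorname{cap}(A,\sigma)=4$, then $n=\log_2\dim_FA-3$ equals $1,2,3$ for $\sigma$ orthogonal, unitary, symplectic respectively. An $F$-subalgebra $L$ of $A$ is neat in $(A,\sigma)$ if $L$ is étale over $F$, $L\subseteq\operatorname{Sym}(\sigma)$, $A$ is free as a left $L$-module, and for all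 primitive idempotents $e$ of $L$ the algebras with involution $(eAe,\sigma|_{eAe})$ have the same degree and the same type (which is the type of $\sigma$). A biquadratic $F$-algebra is a commutative $F$-algebra of dimension $4$ isomorphic to a tensor product of two quadratic $F$-algebras. For an étale biquadratic $F$-algebra $L$ and an $F$-automorphism $\gamma$ of $L$, $L^\gamma=\{x\in L\mid\gamma(x)=x\}$; there are precisely three $F$-automorphisms $\gamma$ of order two such that $L^\gamma$ is a quadratic étale $F$-algebra, and together with $\operatorname{id}_L$ they form a group, called the Galois group of $L$ over $F$. Two quadratic forms $q,q'$ over $F$ are similar if $q\simeq aq'$ for some $a\in F^\times$. A quadratic $1$-fold Pfister form over $F$ is the norm form of a quadratic étale $F$-algebra; a quadratic $n$-fold Pfister form is a form isometric to $\langle1,-a_1\rangle\otimes\cdots\otimes\langle1,-a_{n-1}\rangle\otimes\pi_1$ with $a_i\in F^\times$, $\langle 1,-a_i\rangle$ diagonal bilinear forms, and $\pi_1$ a quadratic $1$-fold Pfister form. *)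

(* Defs.v *)
From HB Require Import structures.
From mathcomp Require Import all_boot all_algebra all_field.

Set Implicit Arguments.
Unset Strict Implicit.
Unset Printing Implicit Defensive.

Import GRing.Theory.
Local Open Scope ring_scope.

Section Algebras.

Variable F : fieldType.

Definition two_sided_ideal (A : falgType F) (I : {vspace A}) : Prop :=
  ({:A} * I <= I)%VS /\ (I * {:A} <= I)%VS.

Definition central_simple (A : falgType F) : Prop :=
  'Z({:A})%VS = 1%VS /\
  forall I : {vspace A}, two_sided_ideal I -> I = 0%VS \/ I = fullv.

(* [B] is isomorphic, through the joint map of the [phi i], to a finite product
   of finite separable field extensions of [F]. *)
Definition etale (B : falgType F) : Prop :=
  exists (r : nat) (K : 'I_r -> fieldExtType F) (phi : forall i, 'AHom(B, K i)),
    (forall i, separable 1%VS {:K i}) /\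
    (forall y : (forall i, K i), exists! b : B, forall i, phi i b = y i).

Definition quadratic_etale (B : falgType F) : Prop :=
  etale B /\ \dim {:B} = 2%N.

(* The linear map [Q1 (x) Q2 -> B], [a (x) b |-> i1 a * i2 b], is an
   isomorphism of algebras: it sends the basis of the [x (x) y] to a basis. *)
Definition is_tensor_product (Q1 Q2 B : falgType F)
    (i1 : 'AHom(Q1, B)) (i2 : 'AHom(Q2, B)) : Prop :=
  (forall a b, i1 a * i2 b = i2 b * i1 a) /\
  basis_of {:B} [seq i1 x * i2 y | x <- vbasis {:Q1}, y <- vbasis {:Q2}].

Definition biquadratic (B : falgType F) : Prop :=
  [/\ forall a b : B, a * b = b * a,
      \dim {:B} = 4%N
    & exists (Q1 Q2 : falgType F) (i1 : 'AHom(Q1, B)) (i2 : 'AHom(Q2, B)),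
        [/\ \dim {:Q1} = 2%N, \dim {:Q2} = 2%N & is_tensor_product i1 i2]].

(* Elements of ['AEnd(B)] of order two are automorphisms. *)
Definition galois_involution (B : falgType F) (g : 'AEnd(B)) : Prop :=
  [/\ forall x, g (g x) = x, exists x, g x <> x
    & quadratic_etale (subvs_of (fixedSpace_aspace g))].

(* The Galois group of [B] is the identity and the three [gamma i]. *)
Definition galois_enumeration (B : falgType F) (gamma : 'I_3 -> 'AEnd(B)) : Prop :=
  [/\ injective gamma, forall i, galois_involution (gamma i)
    & forall g, galois_involution g -> exists i, g = gamma i].

End Algebras.

Section Involutions.

Variable F : fieldType.

Definition symd (A : falgType F) (sigma : 'End(A)) : {vspace A} :=
  limg (\1%VF + sigma).

Lemma symdP (A : falgType F) (sigma : 'End(A)) (x : A) :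
  reflect (exists y, x = y + sigma y) (x \in symd sigma).
Proof.
apply: (iffP memv_imgP) => [[y _ ->]|[y ->]].
  by exists y; rewrite add_lfunE id_lfunE.
by exists y; rewrite ?memvf // add_lfunE id_lfunE.
Qed.

(* [Sym(sigma)] is [fixedSpace sigma], and [F] inside [A] is [1%VS]. *)
Definition algebra_with_involution (A : falgType F) (sigma : 'End(A)) : Prop :=
  [/\ forall x y, sigma (x * y) = sigma y * sigma x,
      forall x, sigma (sigma x) = x,
      ('Z({:A}) :&: fixedSpace sigma)%VS = 1%VS
    & forall I : {vspace A}, two_sided_ideal I -> (sigma @: I)%VS = I ->
        I = 0%VS \/ I = fullv].

(* [A (x) K -> M_m(K)] induced by the [F]-algebra morphism [phi] is an
   isomorphism. *)
Definition is_splitting (A : falgType F) (K : fieldType) (iota : {rmorphism F -> K})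
    (m : nat) (phi : A -> 'M[K]_m) : Prop :=
  [/\ forall x y, phi (x + y) = phi x + phi y,
      forall a x, phi (a *: x) = iota a *: phi x,
      phi 1 = 1%:M,
      forall x y, phi (x * y) = phi x *m phi y
    & basis_of {:'M[K]_m} [seq phi x | x <- vbasis {:A}]].

(* Bilinear forms on ['cV[K]_m] are given by their Gram matrix:
   b(u, v) = u^T B v.  The adjunction b(f u, v) = b(u, sigma(f) v) then reads
   as below. *)
Definition adjoint_over (A : falgType F) (sigma : 'End(A)) (K : fieldType)
    (m : nat) (phi : A -> 'M[K]_m) (B : 'M[K]_m) : Prop :=
  forall x, (phi x)^T *m B = B *m phi (sigma x).

Definition diagonalisable_form (K : fieldType) (m : nat) (B : 'M[K]_m) : Prop :=
  exists2 P : 'M[K]_m, P \in unitmx & is_diag_mx (P^T *m B *m P).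

Definition alternating_form (K : fieldType) (m : nat) (B : 'M[K]_m) : Prop :=
  forall u : 'cV[K]_m, u^T *m B *m u = 0.

Definition adjoint_to_some (P : forall (K : fieldType) (m : nat), 'M[K]_m -> Prop)
    (A : falgType F) (sigma : 'End(A)) : Prop :=
  exists (K : fieldType) (iota : {rmorphism F -> K}) (m : nat)
         (phi : A -> 'M[K]_m) (B : 'M[K]_m),
    [/\ is_splitting iota phi, B \in unitmx, P K m B & adjoint_over sigma phi B].

Inductive involution_type := Orthogonal | Symplectic | Unitary.

Definition has_type (A : falgType F) (sigma : 'End(A)) (t : involution_type) : Prop :=
  match t with
  | Orthogonal =>
      'Z({:A})%VS = 1%VS /\
      adjoint_to_some (fun K m B => B^T = B /\ diagonalisable_form B) sigma
  | Symplectic =>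
      'Z({:A})%VS = 1%VS /\
      adjoint_to_some (fun K m B => alternating_form B) sigma
  | Unitary =>
      quadratic_etale (subvs_of 'Z({:A})%AS) /\
      exists2 z, z \in 'Z({:A})%VS & sigma z <> z
  end.

(* [(A, sigma)] is isomorphic to [(A0 * A0^op, switch)]. *)
Definition is_switch (A : falgType F) (sigma : 'End(A)) (A0 : falgType F) : Prop :=
  exists phi : {linear A -> (A0 * A0)%type},
    [/\ bijective phi, phi 1 = (1, 1),
        forall x y, phi (x * y) =
          ((phi x).1 * (phi y).1, (phi y).2 * (phi x).2)
      & forall x, phi (sigma x) = ((phi x).2, (phi x).1)].

Definition split_center (A : falgType F) : Prop :=
  exists f g : 'AHom(subvs_of 'Z({:A})%AS, F^o),
    bijective (fun z => (f z, g z)).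

(* If the centre is a field [Z], then [\dim A = d ^ 2 * \dim Z] says that
   [A] has dimension [d ^ 2] over [Z]. *)
Definition has_degree (A : falgType F) (sigma : 'End(A)) (d : nat) : Prop :=
  (split_center A /\
     exists A0 : falgType F,
       [/\ central_simple A0, is_switch sigma A0 & \dim {:A0} = (d ^ 2)%N])
  \/ (~ split_center A /\ \dim {:A} = (d ^ 2 * \dim 'Z({:A}))%N).

Definition has_capacity (A : falgType F) (sigma : 'End(A)) (c : nat) : Prop :=
  ((has_type sigma Orthogonal \/ has_type sigma Unitary) /\ has_degree sigma c)
  \/ (has_type sigma Symplectic /\ has_degree sigma (2 * c)%N).

End Involutions.

Section Neat.

Variables (F : fieldType) (A : falgType F).

Definition nz_idempotent (e : A) : bool := (e != 0) && (e * e == e).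

Definition corner (e : A) : {vspace A} := limg (amull e \o amulr e)%VF.

Lemma cornerP (e x : A) : reflect (exists a, x = e * a * e) (x \in corner e).
Proof.
apply: (iffP memv_imgP) => [[a _ ->]|[a ->]].
  by exists a; rewrite comp_lfunE !lfunE /= mulrA.
by exists a; rewrite ?memvf // comp_lfunE !lfunE /= mulrA.
Qed.

Lemma corner_is_aspace (e : A) : nz_idempotent e -> is_aspace (corner e).
Proof.
case/andP=> nz_e /eqP ee; rewrite /is_aspace; apply/andP; split.
  apply/has_algidP; exists e; split=> //.
    by apply/cornerP; exists 1; rewrite mulr1 ee.
  by move=> _ /cornerP[a ->]; rewrite !mulrA ee -!mulrA ee.
apply/prodvP=> _ _ /cornerP[a ->] /cornerP[b ->].
by apply/cornerP; exists (a * e * e * b); rewrite !mulrA.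
Qed.

Definition corner_aspace (e : A) (He : nz_idempotent e) : {aspace A} :=
  ASpace (corner_is_aspace He).

(* Meaningful when [sigma] maps [E] to itself. *)
Definition restrict_involution (sigma : 'End(A)) (E : {vspace A}) :
    'End(subvs_of E) :=
  linfun (vsproj E \o sigma \o vsval).

Definition primitive_idempotent (L : {vspace A}) (e : A) : Prop :=
  [/\ e \in L, nz_idempotent e
    & forall f g, f \in L -> g \in L -> nz_idempotent f -> nz_idempotent g ->
        f * g = 0 -> g * f = 0 -> e <> f + g].

Definition free_left_module (L : {vspace A}) : Prop :=
  exists (r : nat) (b : 'I_r -> A), forall a : A,
    exists! l : {ffun 'I_r -> subvs_of L}, a = \sum_j vsval (l j) * b j.

Definition neat (sigma : 'End(A)) (L : {aspace A}) : Prop :=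
  [/\ 1 \in L, etale (subvs_of L), (L <= fixedSpace sigma)%VS,
      free_left_module L
    & exists (d : nat) (t : involution_type), has_type sigma t /\
        forall (e : A) (He : nz_idempotent e), primitive_idempotent L e ->
          let sigma_e := restrict_involution sigma (corner_aspace He) in
          has_degree (A := subvs_of (corner_aspace He)) sigma_e d /\
          has_type (A := subvs_of (corner_aspace He)) sigma_e t].

Definition twisted_symd (sigma : 'End(A)) (L : {aspace A})
    (gamma : 'AEnd(subvs_of L)) : {vspace A} :=
  (symd sigma :&:
     \bigcap_(y <- vbasis {:subvs_of L})
        lker (amull (vsval y) - amulr (vsval (gamma y))))%VS.

Lemma twisted_symdP (sigma : 'End(A)) (L : {aspace A})
    (gamma : 'AEnd(subvs_of L)) (x : A) :
  x \in twisted_symd sigma gamma <->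
  x \in symd sigma /\
  forall y : subvs_of L, vsval y * x = x * vsval (gamma y).
Proof.
have kerE y : (x \in lker (amull (vsval y) - amulr (vsval (gamma y)))) =
              (vsval y * x == x * vsval (gamma y)).
  by rewrite memv_ker add_lfunE opp_lfunE !lfunE /= subr_eq0.
have bigE (s : seq (subvs_of L)) :
    (x \in (\bigcap_(y <- s)
        lker (amull (vsval y) - amulr (vsval (gamma y))))%VS) =
    all (fun y => vsval y * x == x * vsval (gamma y)) s.
  by elim: s => [|y s IHs]; rewrite ?big_nil ?memvf // big_cons memv_cap kerE IHs.
rewrite memv_cap bigE; split=> [/andP[-> /allP xW]|[-> xW]].
  split=> // y; rewrite (coord_vbasis (memvf y)) !linear_sum mulr_suml mulr_sumr.
  apply: eq_bigr => i _; rewrite !linearZ /= -scalerAl -scalerAr.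
  by congr (_ *: _); apply/eqP/xW; rewrite mem_nth ?size_tuple.
by apply/allP=> y _; apply/eqP.
Qed.

End Neat.

Section QuadraticForms.

Variable F : fieldType.

Definition polar (V : vectType F) (q : V -> F) (x y : V) : F :=
  q (x + y) - q x - q y.

Definition quadratic_form (V : vectType F) (q : V -> F) : Prop :=
  (forall a x, q (a *: x) = a ^+ 2 * q x) /\
  (forall a x y z, polar q (a *: x + y) z = a * polar q x z + polar q y z).

Definition isometric (V V' : vectType F) (q : V -> F) (q' : V' -> F) : Prop :=
  exists f : {linear V -> V'}, bijective f /\ forall x, q' (f x) = q x.

Definition similar (V V' : vectType F) (q : V -> F) (q' : V' -> F) : Prop :=
  exists2 a : F, a != 0 & isometric q (fun x => a * q' x).

Record quad_space := QuadSpace { qs_space : vectType F; qs_form : qs_space -> F }.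

Definition algebra_norm (K : falgType F) (x : K) : F :=
  \det (passmx.mxof (vbasis {:K}) (vbasis {:K}) (amull x)).

(* [<1, -a> (x) Q], identified with the orthogonal sum of [Q] and [-a Q]. *)
Definition pfister_step (a : F) (Q : quad_space) : quad_space :=
  QuadSpace (qs_space := (qs_space Q * qs_space Q)%type)
    (fun u => qs_form u.1 - a * qs_form u.2).

Definition quadratic_pfister (n : nat) (V : vectType F) (q : V -> F) : Prop :=
  exists (a : seq F) (K : falgType F),
    [/\ (size a).+1 = n, all (fun c => c != 0) a, quadratic_etale K
      & isometric q
          (qs_form (q := foldr pfister_step (QuadSpace (@algebra_norm K)) a))].

End QuadraticForms.

Section SquareForms.

Variables (F : fieldType) (A : falgType F) (sigma : 'End(A)) (L : {aspace A}).

(* The form [x |-> s (x ^+ 2)] on [W_gamma], for [s] defined on [L^gamma].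
   The projections only transport [x ^+ 2] to the type of [L^gamma]; that it
   lies there is [square_form_well_defined]. *)
Definition square_form (gamma : 'AEnd(subvs_of L))
    (s : 'Hom(subvs_of (fixedSpace_aspace gamma), F^o))
    (x : subvs_of (twisted_symd sigma gamma)) : F :=
  s (vsproj (fixedSpace_aspace gamma) (vsproj L (vsval x ^+ 2))).

Definition square_form_well_defined (gamma : 'AEnd(subvs_of L)) : Prop :=
  forall x, x \in twisted_symd sigma gamma ->
    x ^+ 2 \in L /\ vsproj L (x ^+ 2) \in fixedSpace gamma.

Definition pfister_invariant (n : nat) (gamma : 'I_3 -> 'AEnd(subvs_of L))
    (V : vectType F) (pi : V -> F) : Prop :=
  quadratic_pfister n pi /\
  forall i : 'I_3, exists s : 'Hom(subvs_of (fixedSpace_aspace (gamma i)), F^o),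
    [/\ lker s = 1%VS, square_form_well_defined (gamma i),
        quadratic_form (square_form s) & similar (square_form s) pi].

End SquareForms.

(* Main.v *)
From HB Require Import structures.
From mathcomp Require Import all_boot all_algebra all_field.
From mathcomp Require Import ring ssrAC zify.
From Stdlib Require Import Classical_Prop.
Require Import Defs.

(** Grading [A] by the Galois group.  Let [a_1, a_2, a_3] be generators of the three
    quadratic algebras [K_i = L^(gamma_i)].  For every automorphism [g] in the Galois
    group put [A_g = {x | y x = x g(y) for y in L}].  Multiplying on both sides by the
    generators produces projectors, so [A] is the direct sum of the four [A_g]
    ([twisted_decomp], [twisted_unique]); the involution fixes [L] and so preserves every
    [A_g], and [Symd] splits accordingly into its intersections with the [A_g].  Three of
    these are the [W_i]; the one for the identity is the part of [Symd] centralising [L],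
    and the decomposition of [Symd] amounts to saying that it is [L].

    Composition.  Once the centralising part is [L], the square of an element of [W_i]
    lies in [K_i], and for [x] in [W_i], [y] in [W_j] the element [x y + y x] lies in
    [W_k].  Its square is [g_i(y^2) x^2 + g_j(x^2) y^2] plus a scalar.  If [s_i] is the
    linear form on [K_i] with kernel [F], scalars are invisible and
    [s_k((x y + y x)^2) = e s_i(x^2) s_j(y^2)] with a constant [e <> 0]
    ([W_composition]).  So the three forms compose.  If they are nondegenerate, they have
    a common dimension [d], and [dim Symd = 4 + 3 d].  By the theorem of Hurwitz in its
    two-space form ([composition_pfister]) all three are similar to one [n]-fold Pfister
    form when [d = 2^n] and [n] is 1, 2 or 3.  Pfister forms are round, so similar ones
    are isometric ([pfister_similar]); this gives uniqueness of [pi], because two linear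
    forms on [K_i] with kernel [F] differ by a scalar.

    Hurwitz.  A composition turns the space into a module over a quadratic algebra
    [F + F a] inside the acting space, or over the algebra generated by [a] and an
    orthogonal [u].  The form is determined on a submodule of rank one; a module of rank
    two is generated by any anisotropic vector and an anisotropic vector of the
    complement ([module_rank2]).  Dimensions 2, 4 and 8 are reached in this way.

    What remains depends on the type of the involution: the centralising part of [Symd]
    is [L], the dimension of [Symd] is 10, 16 or 28, and an element [x] of [W_i] such
    that [b x] is skew for all [b] in [A_(gamma_i)] vanishes.  The last point is
    nondegeneracy ([W_form_nondegenerate]).  Its proof rests on the fact that a nonzero
    two-sided ideal of [A] meets the centre, so that the maps [b |-> l_1 b x_1 + ... + l_k b x_k] with
    centrally independent [l_i] are nonzero ([sandwich_independent]); in characteristic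
    different from 2 and for central [A] the trace form is used in its place.

    First kind.  After splitting, [Symd] becomes the space of the matrices
    [M + M^T] or [M - M^T] up to a unit factor, and its dimension is counted
    ([symd_dim]).  Over a field containing the eigenvalues of two generators of [L],
    their joint eigenspaces have dimension 1 (degree 4) or 2 (degree 8) because [A] is
    free over [L]; alternating matrices of order two are proportional, so a symmetrised
    element commuting with [L] is a scalar on each of them and lies in the span of [L]
    ([split_symd_centralizer]).

    Second kind.  Let [R] be the algebra generated by [L] and the centre, of dimension 8.
    The symmetric elements of [R] are those of [L], so it suffices that [R] is its own
    centraliser.  An idempotent [f] of [R] with [f R] a field cuts out a vector space
    [f A] over this field.  Left multiplications by the centraliser and right
    multiplications by [Symd] act on it independently ([corner_bound]), and freeness over
    [L] bounds the dimension of [f A], or of its conjugate by the involution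
    ([field_idempotent_half]). *)

Set Implicit Arguments.
Unset Strict Implicit.
Unset Printing Implicit Defensive.
Import GRing.Theory.
Local Open Scope ring_scope.

(** * Isometries and quadratic forms *)

Section LinearMaps.

Variables (F : fieldType) (V V' : vectType F).

Lemma inj_lfun_bij (f : 'Hom(V, V')) :
  injective f -> (\dim {:V'} <= \dim {:V})%N -> bijective f.
Proof.
move=> /lker0P f0 dimV.
have limf : limg f = fullv.
  by apply/eqP; rewrite eqEdim subvf limg_dim_eq ?(eqP f0) ?capv0.
exists (f^-1%VF); first exact: lker0_lfunK.
by move=> y; apply: limg_lfunVK; rewrite limf memvf.
Qed.

Lemma bij_lfun_dim (f : {linear V -> V'}) :
  bijective f -> \dim {:V} = \dim {:V'}.
Proof.
case=> g fK gK.
have f0 : lker (linfun f) == 0%VS.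
  by apply/lker0P => x y; rewrite !lfunE; apply: (can_inj fK).
rewrite -(@limg_dim_eq _ _ _ (linfun f) fullv) ?(eqP f0) ?capv0 //.
congr (\dim _); apply/vspaceP=> y; rewrite memvf.
by apply/memv_imgP; exists (g y); rewrite ?memvf // lfunE /= gK.
Qed.

End LinearMaps.

Lemma dim_prod (F : fieldType) (V W : vectType F) :
  \dim {:(V * W)%type} = (\dim {:V} + \dim {:W})%N.
Proof. by rewrite !dimvf. Qed.

Section Isometries.

Variable F : fieldType.
Implicit Types V W X : vectType F.

Lemma isometricI V W (q : V -> F) (q' : W -> F) (f : 'Hom(V, W)) :
  (forall x, q' (f x) = q x) -> injective f ->
  (\dim {:W} <= \dim {:V})%N -> isometric q q'.
Proof. by move=> qf fI dimV; exists f; split=> //; apply: inj_lfun_bij. Qed.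

Lemma isometric_ext V (q q' : V -> F) : q =1 q' -> isometric q q'.
Proof.
move=> qq'; exists (@idfun V); split; first by exists id.
by move=> x /=; rewrite qq'.
Qed.

Lemma isometric_sym V W (q : V -> F) (q' : W -> F) :
  isometric q q' -> isometric q' q.
Proof.
case=> f [f_bij qf]; pose g := linfun f.
have gE : g =1 f by move=> x; rewrite lfunE.
have f0 : lker g == 0%VS.
  by apply/lker0P => x y; rewrite !gE; apply: (bij_inj f_bij).
have limf : limg g = fullv.
  apply/eqP; rewrite eqEdim subvf limg_dim_eq ?(eqP f0) ?capv0 //.
  by rewrite (bij_lfun_dim f_bij) leqnn.
have gVK y : g (g^-1%VF y) = y by apply: limg_lfunVK; rewrite limf memvf.
exists (g^-1%VF); split; last by move=> x; rewrite -qf -gE gVK.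
exact: Bijective gVK (lker0_lfunK f0).
Qed.

Lemma isometric_trans V W X (q : V -> F) (q' : W -> F) (q'' : X -> F) :
  isometric q q' -> isometric q' q'' -> isometric q q''.
Proof.
case=> f [f_bij qf] [g [g_bij qg]]; exists (g \o f)%FUN; split.
  exact: bij_comp.
by move=> x /=; rewrite qg qf.
Qed.

Lemma isometric_scale V W (q : V -> F) (q' : W -> F) (c : F) :
  isometric q q' -> isometric (fun x => c * q x) (fun x => c * q' x).
Proof. by case=> f [f_bij qf]; exists f; split=> // x; rewrite qf. Qed.

Lemma isometric_sum V W (V' W' : vectType F) (q : V -> F) (q' : W -> F) (r : V' -> F)
    (r' : W' -> F) :
  isometric q q' -> isometric r r' ->
  isometric (fun u : V * V' => q u.1 + r u.2) (fun u : W * W' => q' u.1 + r' u.2).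
Proof.
move=> [f [f_bij qf]] [g [g_bij rg]].
pose h (u : V * V') := (f u.1, g u.2).
have h_lin : linear h by move=> a u v; rewrite /h !linearP.
pose hL : {linear (V * V')%type -> (W * W')%type} :=
  HB.pack h (GRing.isLinear.Build F _ _ _ h h_lin).
exists hL; split; last by move=> x /=; rewrite qf rg.
case: f_bij g_bij => f' fK f'K [g' gK g'K].
exists (fun u => (f' u.1, g' u.2)) => -[x y] /=; rewrite /h /=.
  by rewrite fK gK.
by rewrite f'K g'K.
Qed.

Lemma similar_sym V W (q : V -> F) (q' : W -> F) : similar q q' -> similar q' q.
Proof.
case=> a a0 iso; exists a^-1; first by rewrite invr_eq0.
apply: isometric_trans (isometric_scale a^-1 (isometric_sym iso)).
by apply: isometric_ext => x; rewrite mulKf.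
Qed.

Lemma similar_trans V W X (q : V -> F) (q' : W -> F) (q'' : X -> F) :
  similar q q' -> similar q' q'' -> similar q q''.
Proof.
case=> a a0 iso [b b0 iso']; exists (a * b); first by rewrite mulf_neq0.
apply: isometric_trans iso _.
apply: isometric_trans (isometric_scale a iso') _.
by apply: isometric_ext => x; rewrite mulrA.
Qed.

Lemma isometric_similar V W (q : V -> F) (q' : W -> F) :
  isometric q q' -> similar q q'.
Proof.
move=> iso; exists 1; rewrite ?oner_eq0 //; apply: isometric_trans iso _.
by apply: isometric_ext => x; rewrite mul1r.
Qed.

End Isometries.

Section Polar.

Variables (F : fieldType) (V : vectType F) (q : V -> F).
Hypothesis qq : quadratic_form q.

Lemma quadZ a x : q (a *: x) = a ^+ 2 * q x.
Proof. by case: qq. Qed.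

Lemma quad0 : q 0 = 0.
Proof. by rewrite -(scale0r (0 : V)) quadZ expr0n mul0r. Qed.

Lemma polarC x y : polar q x y = polar q y x.
Proof. by rewrite /polar [x + y]addrC addrAC. Qed.

Lemma polarP a x y z : polar q (a *: x + y) z = a * polar q x z + polar q y z.
Proof. by case: qq => _; apply. Qed.

Lemma polarD x y z : polar q (x + y) z = polar q x z + polar q y z.
Proof. by rewrite -[x in LHS]scale1r polarP mul1r. Qed.

Lemma polar0 z : polar q 0 z = 0.
Proof. by rewrite /polar add0r quad0 subr0 subrr. Qed.

Lemma polarZ a x z : polar q (a *: x) z = a * polar q x z.
Proof. by rewrite -[_ *: _]addr0 polarP polar0 addr0. Qed.

Lemma polarDr x y z : polar q x (y + z) = polar q x y + polar q x z.
Proof. by rewrite polarC polarD !(polarC x). Qed.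

Lemma polarZr a x z : polar q x (a *: z) = a * polar q x z.
Proof. by rewrite polarC polarZ polarC. Qed.

Lemma quadD x y : q (x + y) = q x + q y + polar q x y.
Proof. by rewrite /polar; ring. Qed.

Definition polar_lfun (x : V) : 'Hom(V, F^o) := linfun (polar q x : V -> F^o).

Lemma polar_lfunE x y : polar_lfun x y = polar q x y.
Proof.
have p_lin : linear (polar q x : V -> F^o).
  by move=> a u v; rewrite polarDr polarZr.
pose p : {linear V -> F^o} := HB.pack (polar q x : V -> F^o)
  (GRing.isLinear.Build F V F^o *:%R (polar q x : V -> F^o) p_lin).
exact: (lfunE p).
Qed.

Lemma quadZ_similar c : quadratic_form (fun x => c * q x).
Proof.
split=> [a x|a x y z]; first by rewrite quadZ; ring.
have E u v : polar (fun x => c * q x) u v = c * polar q u v.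
  by rewrite /polar; ring.
by rewrite !E polarP; ring.
Qed.

End Polar.

Lemma quadratic_form_isometric (F : fieldType) (V W : vectType F) (q : V -> F)
    (q' : W -> F) :
  isometric q q' -> quadratic_form q' -> quadratic_form q.
Proof.
case=> f [_ qf] q'q; have E u v : polar q u v = polar q' (f u) (f v).
  by rewrite /polar -!qf linearD.
split=> [a x|a x y z]; first by rewrite -!qf linearZ (quadZ q'q).
by rewrite !E linearP (polarP q'q).
Qed.

Definition nondegenerate (F : fieldType) (V : vectType F) (q : V -> F) : Prop :=
  forall x, (forall y, polar q x y = 0) -> x = 0.

(** * Pfister forms are round *)

Section Round.

Variable F : fieldType.
Implicit Types Q : quad_space F.

Definition round Q : Prop :=
  forall x : qs_space Q, qs_form x != 0 ->
    isometric (qs_form (q := Q)) (fun y : qs_space Q => qs_form x * qs_form y).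

Definition represents1 Q : Prop := exists x : qs_space Q, qs_form x = 1.

Lemma quadratic_form_sum (V W : vectType F) (q : V -> F) (r : W -> F) :
  quadratic_form q -> quadratic_form r ->
  quadratic_form (fun u : V * W => q u.1 + r u.2).
Proof.
move=> qq qr; split=> [a [x y]|a [x x'] [y y'] [z z']] /=.
  by rewrite (quadZ qq) (quadZ qr) mulrDr.
have E (u v : V * W) : polar (fun u : V * W => q u.1 + r u.2) u v
    = polar q u.1 v.1 + polar r u.2 v.2 by rewrite /polar /=; ring.
by rewrite !E /= (polarP qq) (polarP qr); ring.
Qed.

Lemma pfister_step_quadratic a Q :
  quadratic_form (qs_form (q := Q)) ->
  quadratic_form (qs_form (q := pfister_step a Q)).
Proof.
move=> qQ; have := quadratic_form_sum qQ (quadZ_similar qQ (- a)).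
by apply: quadratic_form_isometric; apply: isometric_ext => u; rewrite /= mulNr.
Qed.

Lemma pfister_step_represents1 a Q :
  quadratic_form (qs_form (q := Q)) ->
  represents1 Q -> represents1 (pfister_step a Q).
Proof.
by move=> qQ [x x1]; exists (x, 0); rewrite /= x1 (quad0 qQ) mulr0 subr0.
Qed.

Lemma swap_isometric (V W : vectType F) (q : V -> F) (r : W -> F) :
  isometric (fun u : V * W => q u.1 + r u.2) (fun u : W * V => r u.1 + q u.2).
Proof.
pose h (u : V * W) := (u.2, u.1).
have h_lin : linear h by move=> a u v.
pose hL : {linear (V * W)%type -> (W * V)%type} :=
  HB.pack h (GRing.isLinear.Build F _ _ _ h h_lin).
exists hL; split; last by move=> u; rewrite /= addrC.
by exists (fun u => (u.2, u.1)); case.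
Qed.

Lemma isometric_square (V : vectType F) (q : V -> F) (b : F) :
  quadratic_form q -> b != 0 -> isometric (fun x => b ^+ 2 * q x) q.
Proof.
move=> qq b0; exists ( *:%R b : {linear V -> V}); split; last first.
  by move=> x /=; rewrite (quadZ qq).
by exists ( *:%R b^-1) => x /=; rewrite scalerA (mulVf, mulfV) ?scale1r.
Qed.

(** In the basis [(1, 1), (b, -a)] the form [<a, b> (x) q] becomes [<a + b, a b (a + b)> (x) q]. *)
Lemma binary_base_change (V : vectType F) (q : V -> F) (a b : F) :
  quadratic_form q -> a + b != 0 ->
  isometric (fun u : V * V => (a + b) * q u.1 + a * b * (a + b) * q u.2)
            (fun u : V * V => a * q u.1 + b * q u.2).
Proof.
move=> qq ab0; pose h (u : V * V) := (u.1 + b *: u.2, u.1 - a *: u.2).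
have h_lin : linear h.
  move=> k [u u'] [v v']; rewrite /h /=; congr (_, _).
  rewrite -[RHS]/(k *: (u + b *: u') + (v + b *: v')).
  by rewrite !scalerDr !scalerA (mulrC k) addrACA.
  rewrite -[RHS]/(k *: (u - a *: u') + (v - a *: v')).
  by rewrite !scalerDr scalerN !scalerA (mulrC k) opprD addrACA.
pose hL : {linear (V * V)%type -> (V * V)%type} :=
  HB.pack h (GRing.isLinear.Build F _ _ _ h h_lin).
apply: (@isometricI _ _ _ _ _ (linfun hL)) => // [[u v]|].
  rewrite lfunE /= /h /= -scaleNr !quadD !(quadZ qq) !(polarZr qq).
  by ring.
move=> u v; rewrite !lfunE /= => -[] e1 e2.
have sub (x y : V) : x + b *: y - (x - a *: y) = (a + b) *: y.
  by rewrite opprB addrC addrA subrK -scalerDl.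
have e : u.2 = v.2.
  by apply: (scalerI ab0); rewrite -(sub u.1) -(sub v.1) e1 e2.
move: e1; rewrite e => /addIr; case: u v e {e2} => u1 u2 [v1 v2] /= -> ->.
by [].
Qed.

(** If [<1, -a> Q] has value [c = u - a v] with [u], [v] values of [Q], then
    [<1, -a> Q = u Q + (- a v) Q], and the binary identity
    [<u, - a v> = c <1, - a u v>] turns this into [c <1, -a> Q]. *)
Lemma pfister_step_round a Q : a != 0 ->
  quadratic_form (qs_form (q := Q)) -> round Q -> round (pfister_step a Q).
Proof.
case: Q => V q a0 qQ rQ [x y] /=; set c := q x - a * q y => c0.
have {}rQ z : q z != 0 -> isometric q (fun y => q z * q y) by move/rQ.
pose D (d e : F) := fun u : V * V => d * q u.1 + e * q u.2.
have scaleD (d e b b' : F) : isometric q (fun y => b * q y) ->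
    isometric q (fun y => b' * q y) -> isometric (D d e) (D (b * d) (b' * e)).
  move=> iso iso'; apply: isometric_trans
    (isometric_sum (isometric_scale d iso) (isometric_scale e iso')) _.
  by apply: isometric_ext => u; rewrite /D /=; ring.
have squareD (d e b : F) : b != 0 -> isometric (D d (b ^+ 2 * e)) (D d e).
  move=> b0; have iso := isometric_scale e (isometric_square qQ b0).
  have idV := isometric_ext (fun u : V => erefl (d * q u)).
  refine (isometric_trans _ (isometric_sum idV iso)).
  by apply: isometric_ext => u; rewrite /D /=; ring.
suff iso : isometric (D 1 (- a)) (D c (c * - a)).
  apply: isometric_trans (isometric_trans _ iso) _.
    by apply: isometric_ext => u; rewrite /D /=; ring.
  by apply: isometric_ext => u; rewrite /D /=; ring.
have [qx0|qx0] := eqVneq (q x) 0.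
  have cE : c = - a * q y by rewrite /c qx0; ring.
  have qy0 : q y != 0 by move: c0; rewrite cE mulf_eq0 negb_or => /andP[].
  apply: isometric_trans (scaleD _ _ _ _ (rQ y qy0) (rQ y qy0)) _.
  have swapD d e : isometric (D d e) (D e d).
    exact: (swap_isometric (fun x => d * q x) (fun x => e * q x)).
  apply: isometric_trans (swapD _ _) _.
  refine (isometric_trans _ (squareD c (c * - a) _ (invr_neq0 a0))).
  by apply: isometric_ext => u; rewrite /D /= cE; field.
have [qy0|qy0] := eqVneq (q y) 0.
  have cE : c = q x by rewrite /c qy0; ring.
  apply: isometric_trans (scaleD _ _ _ _ (rQ x qx0) (rQ x qx0)) _.
  by apply: isometric_ext => u; rewrite /D /= cE; ring.
apply: isometric_trans (scaleD _ _ _ _ (rQ x qx0) (rQ y qy0)) _.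
have c0' : q x + q y * - a != 0 by rewrite mulrN [_ * a]mulrC.
refine (isometric_trans
  (isometric_trans _ (isometric_sym (binary_base_change qQ c0'))) _).
  by apply: isometric_ext => u; rewrite /D /=; ring.
have idV := isometric_ext (fun u : V => erefl (c * q u)).
have qxy := isometric_trans (rQ x qx0) (isometric_scale (q x) (rQ y qy0)).
have iso := isometric_sym (isometric_scale (c * - a) qxy).
refine (isometric_trans (isometric_trans _ (isometric_sum idV iso)) _).
  by apply: isometric_ext => u; rewrite /c /=; ring.
by apply: isometric_ext => u; rewrite /D /c /=; ring.
Qed.

End Round.

Lemma det_mx22 (R : comNzRingType) (M : 'M[R]_2) :
  \det M = M 0 0 * M 1 1 - M 0 1 * M 1 0.
Proof.
rewrite (expand_det_row _ 0) !big_ord_recl big_ord0 /cofactor !det_mx11 !mxE.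
have e : lift 0 0 = 1 :> 'I_2 by apply: val_inj.
have e' : lift 1 0 = 0 :> 'I_2 by apply: val_inj.
by rewrite /= !e !e' /= expr0 expr1; ring.
Qed.

(** * Quadratic algebras and their norms *)

Section QuadraticAlgebra.

Variable F : fieldType.
Variables tau nu : F.

Definition quad_poly : {poly F} := 'X^2 + (nu%:P - tau *: 'X).

Lemma size_quad_poly : size quad_poly = 3%N.
Proof.
rewrite size_polyDl ?size_polyXn // ltnS.
apply: leq_trans (size_polyD _ _) _; rewrite geq_max size_polyN.
rewrite (leq_trans (size_polyC_leq1 _)) //.
by rewrite (leq_trans (size_scale_leq _ _)) ?size_polyX.
Qed.

Lemma root_quad_poly (K : comNzRingType) (h : {rmorphism F -> K}) (z : K) :
  root (map_poly h quad_poly) z = (z ^+ 2 == h tau * z - h nu).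
Proof.
rewrite /root /quad_poly rmorphD rmorphB /= map_polyXn map_polyC map_polyZ.
rewrite map_polyX hornerD hornerXn hornerD hornerC hornerN hornerZ hornerX.
by rewrite -[RHS]subr_eq0; congr (_ == _); ring.
Qed.

Lemma separable_quad_poly : tau ^+ 2 - 4%:R * nu != 0 ->
  separable_poly quad_poly.
Proof.
move=> disc; rewrite unlock; apply/Bezout_coprimepP.
exists ((- 4%:R)%:P, quad_poly^`()) => /=.
have -> : (- 4%:R)%:P * quad_poly + quad_poly^`() * quad_poly^`()
    = (tau ^+ 2 - 4%:R * nu)%:P.
  rewrite /quad_poly !derivE -!mul_polyC !polyCD !polyCN polyC_exp !polyCM.
  by rewrite !polyC_natr /= expr1; ring.
by rewrite -size_poly_eq1 size_polyC disc.
Qed.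

Section Generator.

Variables (B : falgType F) (g : B).
Hypotheses (dimB : \dim {:B} = 2%N) (gF : g \notin 1%VS).
Hypothesis gg : g ^+ 2 = tau *: g - nu%:A.

Lemma quad_basis : basis_of {:B} [tuple 1; g].
Proof.
rewrite basisEfree subvf /= dimB /= andbT free_cons seq1_free span_seq1.
apply/andP; split; last by apply: contraNneq gF => ->; rewrite mem0v.
apply/negP=> /vlineP[k e1]; have k0 : k != 0.
  by apply: contra_eq_neq e1 => ->; rewrite scale0r oner_eq0.
by case/negP: gF; apply/vlineP; exists k^-1; rewrite e1 scalerA mulVf ?scale1r.
Qed.

Definition qc0 (x : B) : F := coord [tuple 1; g] 0 x.
Definition qc1 (x : B) : F := coord [tuple 1; g] 1 x.

Lemma quad_coord x : x = (qc0 x)%:A + qc1 x *: g.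
Proof.
rewrite {1}(coord_basis quad_basis (memvf x)) !big_ord_recl big_ord0 addr0.
by congr (_ + coord _ _ _ *: _); apply: val_inj.
Qed.

Lemma quad_free a b a' b' :
  a%:A + b *: g = a'%:A + b' *: g -> a = a' /\ b = b'.
Proof.
have E c d : qc0 (c%:A + d *: g) = c /\ qc1 (c%:A + d *: g) = d.
  have fr := basis_free quad_basis.
  have := coord_sum_free (fun i : 'I_2 => if i == 0 then c else d) _ fr.
  rewrite !big_ord_recl big_ord0 addr0 /= => H.
  by split; [exact: (H 0) | exact: (H 1)].
by move=> e; move: (E a b); rewrite e; case: (E a' b') => -> -> [-> ->].
Qed.

Lemma quad_mul a b a' b' : (a%:A + b *: g) * (a'%:A + b' *: g) =
  (a * a' - nu * (b * b'))%:A + (a * b' + b * a' + tau * (b * b')) *: g.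
Proof.
rewrite mulrDl !mulrDr -!scalerAl -!scalerAr !mul1r mulr1 -expr2 gg !scalerA.
rewrite !scalerBr !scalerBl !scalerDl !scalerA [_ * nu]mulrC [_ * tau]mulrC.
by rewrite [LHS](AC (2*(1*2)) ((1*5)*(2*3*4))).
Qed.

(** The norm of [B] as a binary form: the trace and determinant of
    multiplication by [a + b g] can be read off on the basis [(1, g)]. *)
Lemma algebra_normE a b :
  algebra_norm (a%:A + b *: g) = a ^+ 2 + tau * (a * b) + nu * b ^+ 2.
Proof.
have size_e : size [:: 1; g] == \dim {:B} by rewrite dimB.
pose e := Tuple size_e; pose f := amull (a%:A + b *: g).
have e_basis : basis_of {:B} e by exact: quad_basis.
have v_basis := vbasisP {:B}.
have -> : algebra_norm (a%:A + b *: g) = \det (passmx.mxof e e f).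
  rewrite /algebra_norm -/f -{1}(comp_lfun1l f) -{1}(comp_lfun1r f).
  rewrite !(passmx.mxof_comp _ _ e_basis) !det_mulmx mulrAC -det_mulmx.
  rewrite -(passmx.mxof_comp _ _ e_basis) comp_lfun1l passmx.mxof1.
    by rewrite det1 mul1r.
  exact: basis_free v_basis.
have det2 n (M : 'M[F]_n) (en : 2 = n) : \det M =
    M (cast_ord en 0) (cast_ord en 0) * M (cast_ord en 1) (cast_ord en 1)
    - M (cast_ord en 0) (cast_ord en 1) * M (cast_ord en 1) (cast_ord en 0).
  by case: n / en M => M; rewrite !cast_ord_id det_mx22.
rewrite (det2 _ _ (esym dimB)).
have coord_e (i : 'I_(\dim {:B})) (j : 'I_2) c d : val i = val j ->
    coord e i (c%:A + d *: g) = tnth [tuple c; d] j.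
  move=> ij; have -> : c%:A + d *: g =
      \sum_k tnth [tuple c; d] (cast_ord dimB k) *: e`_k.
    rewrite (reindex (cast_ord (esym dimB))) /=; last first.
      by exists (cast_ord dimB) => k _; rewrite ?cast_ordK ?cast_ordKV.
    by rewrite !big_ord_recl big_ord0 addr0 /= !cast_ordKV.
  rewrite coord_sum_free ?(basis_free e_basis) //; congr tnth.
  exact: val_inj.
have fe i0 j c d (k : 'I_2) : f e`_(val (i0 : 'I_(\dim {:B}))) = c%:A + d *: g ->
    val j = val k -> passmx.mxof e e f i0 j = tnth [tuple c; d] k.
  move=> fi jk; rewrite /passmx.mxof !mxE /= passmx.vecof_delta fi.
  exact: coord_e.
have f1 : f e`_0 = a%:A + b *: g by rewrite /= lfunE /= mulr1.
have fg : f e`_1 = (- (nu * b))%:A + (a + tau * b) *: g.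
  have -> : f g = (a%:A + b *: g) * (0%:A + 1 *: g).
    by rewrite lfunE /= scale0r add0r scale1r.
  by rewrite quad_mul !mulr0 !mulr1 add0r addr0.
set i0 := cast_ord _ 0; set i1 := cast_ord _ 1.
rewrite (fe i0 i0 _ _ 0 f1 erefl) (fe i0 i1 _ _ 1 f1 erefl).
rewrite (fe i1 i0 _ _ 0 fg erefl) (fe i1 i1 _ _ 1 fg erefl) /tnth /=.
by ring.
Qed.

(** [g] and [z] satisfy the same quadratic equation and [1, g] is a basis. *)
Lemma quad_hom (K : falgType F) (z : K) : z ^+ 2 = tau *: z - nu%:A ->
  exists f : 'AHom(B, K), forall a b, f (a%:A + b *: g) = a%:A + b *: z.
Proof.
move=> zz; pose h x : K := (qc0 x)%:A + qc1 x *: z.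
have hE a b : h (a%:A + b *: g) = a%:A + b *: z.
  have := quad_coord (a%:A + b *: g); rewrite /h.
  by move/quad_free => [<- <-].
have h_lin : linear h.
  move=> k x y; rewrite [x in LHS]quad_coord [y in LHS]quad_coord.
  rewrite scalerDr !scalerA addrACA -!scalerDl hE /h.
  by rewrite scalerDr !scalerA addrACA -!scalerDl.
have zM a b a' b' : (a%:A + b *: z) * (a'%:A + b' *: z) =
    (a * a' - nu * (b * b'))%:A + (a * b' + b * a' + tau * (b * b')) *: z.
  rewrite mulrDl !mulrDr -!scalerAl -!scalerAr !mul1r mulr1 -expr2 zz !scalerA.
  rewrite !scalerBr !scalerBl !scalerDl !scalerA [_ * nu]mulrC [_ * tau]mulrC.
  by rewrite [LHS](AC (2*(1*2)) ((1*5)*(2*3*4))).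
pose hL : {linear B -> K} := HB.pack h (GRing.isLinear.Build F _ _ _ h h_lin).
have hA : ahom_in {:B} (linfun hL).
  apply/ahom_inP; split=> [x y _ _|]; rewrite !lfunE /=.
    rewrite [x in LHS]quad_coord [y in LHS]quad_coord quad_mul hE.
    by rewrite /h zM.
  by have := hE 1 0; rewrite !scale0r !addr0 !scale1r.
by exists (AHom hA) => a b; rewrite lfunE /= hE.
Qed.

(** Either the quadratic polynomial has two distinct roots and [B = F x F], or it
    is irreducible and separable and [B] is its root field. *)
Lemma quadratic_etale_disc : tau ^+ 2 - 4%:R * nu != 0 -> quadratic_etale B.
Proof.
move=> disc; split=> //.
case: (classic (exists r : F, r ^+ 2 = tau * r - nu)) => [[r rr]|noroot].
  pose r' := tau - r; have r'r' : r' ^+ 2 = tau * r' - nu.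
    by rewrite /r' sqrrB rr; ring.
  have rr'0 : r - r' != 0.
    apply: contraNneq disc => e.
    have : (r - r') ^+ 2 = 4%:R * r ^+ 2 - 4%:R * tau * r + tau ^+ 2.
      by rewrite /r'; ring.
    by rewrite e rr expr0n /= => E; apply/eqP; rewrite [RHS]E; ring.
  have alg1 c : c%:A = c :> F^o by rewrite /GRing.scale /= mulr1.
  have [f fE] := @quad_hom F^o r (etrans rr (congr2 +%R erefl (congr1 -%R (esym (alg1 nu))))).
  have [f' f'E] := @quad_hom F^o r' (etrans r'r' (congr2 +%R erefl (congr1 -%R (esym (alg1 nu))))).
  exists 2, (fun _ => F^o), (fun i => if i == 0 then f else f').
  split=> [_|y]; first by rewrite regular_fullv separable_refl.
  pose y0 : F := y 0; pose y1 : F := y 1.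
  pose b : F := (y0 - y1) / (r - r'); pose a := y0 - b * r.
  have e : b * (r - r') = y0 - y1 by rewrite divfK.
  have ar : a + b * r = y0 by rewrite /a; ring.
  have ar' : a + b * r' = y1.
    have -> : a + b * r' = y0 - b * (r - r') by rewrite /a; ring.
    by rewrite e opprB addrC subrK.
  exists (a%:A + b *: g); split=> [i|x].
    have [->|i1] := eqVneq i 0; first by rewrite fE /= alg1; exact: ar.
    have -> : i = 1 by apply/val_inj; case: i i1 => -[|[]].
    by rewrite f'E /= alg1; exact: ar'.
  move=> xy; have /= := xy 1; have /= := xy 0.
  rewrite [x in f x]quad_coord [x in f' x]quad_coord fE f'E !alg1.
  move=> e0 e1; have {}e0 : qc0 x + qc1 x * r = y0 by exact: e0.
  have {}e1 : qc0 x + qc1 x * r' = y1 by exact: e1.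
  have eb : qc1 x = b.
    by apply: (mulIf rr'0); rewrite e -e1 -e0; ring.
  by rewrite /a -eb -e0 addrK -quad_coord.
have irr : irreducible_poly quad_poly.
  apply: cubic_irreducible; rewrite ?size_quad_poly // => r.
  apply/negP=> rp; case: noroot; exists r; apply/eqP.
  by rewrite -(root_quad_poly (@idfun F)) map_poly_id.
have [K dimK [z]] := irredp_FAdjoin irr; rewrite size_quad_poly in dimK.
have -> : map_poly (in_alg K) quad_poly =
  map_poly (in_alg K : {rmorphism F -> K}) quad_poly by [].
move=> zroot fullK; have zz : z ^+ 2 = tau *: z - nu%:A.
  by move: zroot; rewrite root_quad_poly => /eqP ->; rewrite -scalerAl mul1r.
have [f fE] := quad_hom zz.
have zF : z \notin 1%VS.
  apply/negP=> z1; move: dimK; rewrite -fullK.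
  by rewrite (Fadjoin_idP z1) dimv1.
have f_inj : injective f.
  apply/raddf_inj => x fx0; rewrite [x]quad_coord.
  have : (qc0 x)%:A + qc1 x *: z = 0 by rewrite -fE -quad_coord.
  move: (qc0 x) (qc1 x) => a b /eqP; rewrite addrC addr_eq0 => /eqP e.
  have b0 : b = 0.
    apply/eqP/negPn/negP => b0; case/negP: zF; apply/vlineP.
    by exists (- (b^-1 * a)); rewrite scaleNr -scalerA -scalerN -e scalerA mulVf ?scale1r.
  move: e; rewrite b0 !scale0r addr0 => /esym/eqP; rewrite oppr_eq0.
  by rewrite scaler_eq0 oner_eq0 orbF => /eqP ->; rewrite scale0r.
have [h fK hK] : bijective f.
  by apply: inj_lfun_bij => //; rewrite dimB dimK.
exists 1%N, (fun _ => K), (fun _ => f); split=> [_|y].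
  rewrite -fullK -adjoin_separable_eq; apply/separable_elementP.
  exists (map_poly (in_alg K) quad_poly); split=> //; first exact: alg_polyOver.
  by rewrite separable_map separable_quad_poly.
exists (h (y 0)); split=> [i|x xy]; last by rewrite -(xy 0) fK.
by rewrite hK; congr y; apply/val_inj; case: i => -[].
Qed.

End Generator.
End QuadraticAlgebra.

Section Subalgebra.

Variables (F : fieldType) (A : falgType F) (L : {aspace A}).

Lemma vsval_one : 1 \in L -> vsval (1 : subvs_of L) = 1.
Proof. by rewrite -algid_eq1 => /eqP. Qed.

Lemma vsval_mul (x y : subvs_of L) : vsval (x * y) = vsval x * vsval y.
Proof. by []. Qed.

Lemma vsval_alg (k : F) : 1 \in L -> vsval (k%:A : subvs_of L) = k%:A.
Proof. by move=> L1; apply: (congr1 ( *:%R k) (vsval_one L1)). Qed.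

Lemma dim_subvs : \dim {:subvs_of L} = \dim L.
Proof. by rewrite dimvf. Qed.

Lemma vsval_in1 (x : subvs_of L) : 1 \in L ->
  (x \in 1%VS) = (vsval x \in 1%VS).
Proof.
move=> L1; apply/vlineP/vlineP => -[k e]; exists k.
  by rewrite e vsval_alg.
by apply: val_inj; apply: etrans e (esym (vsval_alg k L1)).
Qed.

End Subalgebra.

(** * Pfister forms *)

Section Pfister.

Variable F : fieldType.

Definition binary_form (tau nu : F) (u : (F^o * F^o)%type) : F :=
  let: (a, b) := u in (a : F) ^+ 2 + tau * ((a : F) * b) + nu * (b : F) ^+ 2.

Definition binary_space tau nu :=
  QuadSpace (qs_space := (F^o * F^o)%type) (binary_form tau nu).

Lemma binary_polar tau nu (a b c d : F) :
  polar (binary_form tau nu) (a, b) (c, d) = 2%:R * (a * c)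
    + tau * (a * d + b * c) + 2%:R * nu * (b * d).
Proof.
transitivity ((a + c) ^+ 2 + tau * ((a + c) * (b + d)) + nu * (b + d) ^+ 2
  - (a ^+ 2 + tau * (a * b) + nu * b ^+ 2)
  - (c ^+ 2 + tau * (c * d) + nu * d ^+ 2)); first by [].
by ring.
Qed.

Lemma binary_quadratic tau nu : quadratic_form (binary_form tau nu).
Proof.
split=> [a [x y]|a [x1 x2] [y1 y2] [z1 z2]].
  transitivity ((a * x) ^+ 2 + tau * ((a * x) * (a * y)) + nu * (a * y) ^+ 2 : F).
    by [].
  by rewrite /binary_form /=; ring.
rewrite -[_ + _]/(((a * x1 : F) + y1 : F), ((a * x2 : F) + y2 : F)).
by rewrite !binary_polar; ring.
Qed.

Lemma binary_nondegenerate tau nu : tau ^+ 2 - 4%:R * nu != 0 ->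
  nondegenerate (binary_form tau nu).
Proof.
move=> disc [x y] xy0; have := xy0 (1, 0); have := xy0 (0, 1).
rewrite !binary_polar /= => e1 e2; move: x y e1 e2 {xy0} => x y e1 e2.
have lin_comb (a b p q : F) : p = 0 -> q = 0 -> a * p + b * q = 0.
  by move=> -> ->; rewrite !mulr0 addr0.
have ex : (tau ^+ 2 - 4%:R * nu) * x = 0.
  by rewrite -[RHS](lin_comb tau (- (2%:R * nu)) _ _ e1 e2); ring.
have ey : (tau ^+ 2 - 4%:R * nu) * y = 0.
  by rewrite -[RHS](lin_comb (- 2%:R) tau _ _ e1 e2); ring.
by congr (_, _); [move/eqP: ex|move/eqP: ey];
  rewrite mulf_eq0 (negPf disc) => /eqP.
Qed.

(** Companion matrices realise every separable quadratic polynomial. *)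
Lemma quadratic_algebra_exists (tau nu : F) :
  exists (K : falgType F) (g : K),
    [/\ \dim {:K} = 2%N, g \notin 1%VS & g ^+ 2 = tau *: g - nu%:A].
Proof.
pose M : 'M[F]_2 := \matrix_(i, j) (if i == 0 then (j == 1)%:R
                                    else if j == 0 then - nu else tau).
have MM : M ^+ 2 = tau *: M - nu%:A.
  apply/matrixP=> i j; rewrite expr2 !mxE big_ord_recl big_ord1 !mxE.
  by case: i j => -[|[|//]] ? [] -[|[|//]] ?; rewrite /= ?eqE /=; ring.
have M1 : M \notin 1%VS.
  apply/negP=> /vlineP[k /matrixP/(_ 0 1)]; rewrite !mxE /= mulr0.
  by move/eqP; rewrite oner_eq0.
pose U : {vspace 'M[F]_2} := span [:: 1; M].
have UP x : x \in U -> exists a b, x = a%:A + b *: M.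
  rewrite /U span_cons span_seq1 => /memv_addP[_ /vlineP[a ->] [_ /vlineP[b ->] ->]].
  by exists a, b.
have UI a b : a%:A + b *: M \in U.
  by rewrite memvD // memvZ // memv_span // !inE eqxx ?orbT.
have mulE a b a' b' : (a%:A + b *: M) * (a'%:A + b' *: M) =
    (a * a' - nu * (b * b'))%:A + (a * b' + b * a' + tau * (b * b')) *: M.
  rewrite mulrDl !mulrDr -!scalerAl -!scalerAr !mul1r mulr1 -expr2 MM !scalerA.
  rewrite !scalerBr !scalerBl !scalerDl !scalerA [_ * nu]mulrC [_ * tau]mulrC.
  by rewrite [LHS](AC (2*(1*2)) ((1*5)*(2*3*4))).
have U1 : 1 \in U by have := UI 1 0; rewrite scale0r addr0 scale1r.
have Ua : is_aspace U.
  rewrite /is_aspace has_algid1 //=; apply/prodvP => x y /UP[a [b ->]].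
  by move=> /UP[a' [b' ->]]; rewrite mulE UI.
have MU : M \in U by have := UI 0 1; rewrite scale0r add0r scale1r.
exists (subvs_of (ASpace Ua)), (Subvs MU : subvs_of (ASpace Ua)).
split.
- rewrite dim_subvs /=; apply/eqP; rewrite (_ : 2%N = size [:: 1; M]) //.
  rewrite -/(free _) free_cons seq1_free span_seq1.
  apply/andP; split; last by apply: contraNneq M1 => ->; rewrite mem0v.
  apply/negP=> /vlineP[k e1]; have k0 : k != 0.
    by apply: contra_eq_neq e1 => ->; rewrite scale0r oner_eq0.
  by case/negP: M1; apply/vlineP; exists k^-1; rewrite e1 scalerA mulVf ?scale1r.
- by rewrite vsval_in1.
apply: val_inj; apply: etrans MM _.
exact: (congr1 (fun x => tau *: M - x) (esym (vsval_alg nu (U1 : 1 \in ASpace Ua)))).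
Qed.

Lemma binary_norm tau nu : tau ^+ 2 - 4%:R * nu != 0 ->
  exists2 K : falgType F, quadratic_etale K &
    isometric (binary_form tau nu) (@algebra_norm F K).
Proof.
move=> disc; have [K [g [dimK gF gg]]] := quadratic_algebra_exists tau nu.
exists K; first exact: quadratic_etale_disc dimK gF gg disc.
pose h (u : F^o * F^o) : K := u.1 *: 1 + u.2 *: g.
have h_lin : linear h.
  move=> k [a b] [a' b']; rewrite -[LHS]/((k * a + a') *: 1 + (k * b + b') *: g).
  by rewrite /h /= scalerDr !scalerA addrACA -!scalerDl.
pose hL : {linear (F^o * F^o)%type -> K} :=
  HB.pack h (GRing.isLinear.Build F _ _ _ h h_lin).
apply: (@isometricI _ _ _ _ _ (linfun hL)) => [[a b]|[a b] [a' b']|].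
- by rewrite lfunE /= /h /= (algebra_normE dimK gF gg).
- by rewrite !lfunE => /(quad_free dimK gF)[/= -> ->].
by rewrite dimK dim_prod !dimvf.
Qed.

Lemma quadratic_generator (K : falgType F) : \dim {:K} = 2%N ->
  exists (g : K) (tau nu : F), g \notin 1%VS /\ g ^+ 2 = tau *: g - nu%:A.
Proof.
move=> dimK; have [g _ gF] : exists2 g, g \in {:K}%VS & g \notin 1%VS.
  by apply/subvPn/negP=> /dimvS; rewrite dimK dimv1.
exists g; have := coord_basis (quad_basis dimK gF) (memvf (g ^+ 2)).
rewrite !big_ord_recl big_ord0 addr0 /= => gg.
exists (coord [tuple 1; g] (lift ord0 ord0) (g ^+ 2)).
exists (- coord [tuple 1; g] ord0 (g ^+ 2)).
by split=> //; rewrite scaleNr opprK addrC.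
Qed.

Definition norm_space (K : falgType F) := QuadSpace (@algebra_norm F K).

Lemma algebra_normM (K : falgType F) (x y : K) :
  algebra_norm (x * y) = algebra_norm x * algebra_norm y.
Proof.
rewrite /algebra_norm -det_mulmx det_mulmx mulrC -det_mulmx; congr (\det _).
rewrite -(passmx.mxof_comp _ _ (vbasisP _)); congr (passmx.mxof _ _ _).
by apply/lfunP=> z; rewrite comp_lfunE !lfunE /= mulrA.
Qed.

Lemma algebra_norm1 (K : falgType F) : algebra_norm (1 : K) = 1.
Proof.
by rewrite /algebra_norm amull1 passmx.mxof1 ?det1 // (basis_free (vbasisP _)).
Qed.

Lemma norm_quadratic (K : falgType F) : \dim {:K} = 2%N ->
  quadratic_form (@algebra_norm F K).
Proof.
move=> dimK; have [g [tau [nu [gF gg]]]] := quadratic_generator dimK.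
pose f (x : K) : F^o * F^o := (qc0 g x, qc1 g x).
have f_lin : linear f by move=> k x y; rewrite /f /qc0 /qc1 !linearP.
pose fL : {linear K -> (F^o * F^o)%type} :=
  HB.pack f (GRing.isLinear.Build F _ _ _ f f_lin).
apply: (@quadratic_form_isometric _ _ _ _ (binary_form tau nu)).
  apply: (@isometricI _ _ _ _ _ (linfun fL)) => [x|x y|].
  - by rewrite lfunE /= [x in RHS](quad_coord dimK gF) (algebra_normE dimK gF gg).
  - rewrite !lfunE => -[e0 e1].
    by rewrite [x](quad_coord dimK gF) e0 e1 -(quad_coord dimK gF).
  by rewrite dimK dim_prod !dimvf.
exact: binary_quadratic.
Qed.

(** Multiplication by an element of norm [c != 0] is a similitude of factor [c]. *)
Lemma norm_round (K : falgType F) : round (norm_space K).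
Proof.
move=> x /= x0; apply: isometric_sym.
apply: (@isometricI _ _ _ _ _ (amull x)) => [y|y z|//].
  by rewrite lfunE /= algebra_normM.
rewrite !lfunE /= => /eqP; rewrite -subr_eq0 -mulrBr => /eqP xyz.
apply/eqP; rewrite -subr_eq0; move: {y z}(y - z) xyz => y xy.
have e_basis := vbasisP {:K}.
have : passmx.rVof (vbasis {:K}) y *m passmx.mxof (vbasis {:K}) (vbasis {:K}) (amull x) = 0.
  by apply/eqP; rewrite -(passmx.rVof_app _ e_basis) (passmx.rVof_eq0 e_basis) lfunE /= xy.
move/(congr1 (fun v => v *m invmx
   (passmx.mxof (vbasis {:K}) (vbasis {:K}) (amull x)))).
rewrite mul0mx mulmxK ?unitmxE ?unitfE // => /eqP.
by rewrite (passmx.rVof_eq0 e_basis).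
Qed.

Lemma pfister_foldr (a : seq F) (K : falgType F) :
  all (fun c => c != 0) a -> quadratic_etale K ->
  let Q := foldr (@pfister_step F) (norm_space K) a in
  [/\ quadratic_form (qs_form (q := Q)), round Q & represents1 Q].
Proof.
move=> + [_ dimK]; elim: a => [_|a s IH /= /andP[a0 /IH[qQ rQ Q1]]] /=.
  split; [exact: norm_quadratic | exact: norm_round |].
  by exists 1; apply: algebra_norm1.
split; [exact: pfister_step_quadratic | exact: pfister_step_round |].
exact: pfister_step_represents1.
Qed.

(** If [P = c P'] and [P] represents 1, then [P'] represents [c^-1], so
    [P' = c^-1 P'] by roundness. *)
Lemma pfister_similar n n' (V V' : vectType F) (q : V -> F) (q' : V' -> F) :
  quadratic_pfister n q -> quadratic_pfister n' q' -> similar q q' ->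
  isometric q q'.
Proof.
case=> a [K [_ a0 etK iso]] [a' [K' [_ a0' etK' iso']]] [c c0 qq'].
have [_ _ [x x1]] := pfister_foldr a0 etK.
have [_ rQ' _] := pfister_foldr a0' etK'.
set Q' := foldr _ _ a' in iso' rQ'.
have e := isometric_trans (isometric_trans (isometric_sym iso) qq')
  (isometric_scale c iso').
have [f [_ fE]] := e; have Q'y := fE x; rewrite x1 in Q'y.
have Q'y0 : qs_form (f x : qs_space Q') = c^-1.
  by rewrite -[LHS](mulKf c0) Q'y mulr1.
have Q'iso := rQ' (f x); rewrite Q'y0 in Q'iso.
have {}Q'iso := isometric_scale c (Q'iso (invr_neq0 c0)).
apply: isometric_trans qq' _; apply: isometric_trans (isometric_scale c iso') _.
apply: isometric_trans Q'iso _; apply: isometric_trans (isometric_sym iso').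
by apply: isometric_ext => y; rewrite mulVKf.
Qed.

End Pfister.

(** * Composition of quadratic forms *)

Section Complement.

Variables (F : fieldType) (W : vectType F) (q : W -> F).
Hypotheses (qq : quadratic_form q) (qnd : nondegenerate q).

(** Nondegeneracy makes the adjoint map of [polar q] injective, hence bijective. *)
Lemma nondegenerate_repr (f : 'Hom(W, F^o)) :
  exists x, forall y, polar q x y = f y.
Proof.
have p_lin : linear (polar_lfun q).
  move=> a x y; apply/lfunP=> z.
  by rewrite add_lfunE scale_lfunE !polar_lfunE // (polarP qq).
pose p : {linear W -> 'Hom(W, F^o)} :=
  HB.pack (polar_lfun q) (GRing.isLinear.Build F _ _ _ (polar_lfun q) p_lin).
have p_inj : injective (linfun p).
  move=> x y; rewrite !lfunE /= => e; apply/eqP; rewrite -subr_eq0.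
  apply/eqP/qnd => z; rewrite addrC -scaleN1r (polarP qq) mulN1r.
  by rewrite -!polar_lfunE // e addNr.
have [|g _ gK] := inj_lfun_bij p_inj; first by rewrite !dimvf /dim /= muln1.
exists (g f) => y; rewrite -polar_lfunE //.
by have := gK f; rewrite lfunE /= => ->.
Qed.

End Complement.

Section Anisotropic.

Variables (F : fieldType) (W : vectType F) (q : W -> F).
Hypotheses (qq : quadratic_form q) (qnd : nondegenerate q).

(** A form vanishing identically has a zero polar form. *)
Lemma nondegenerate_anisotropic : (0 < \dim {:W})%N -> exists w, q w != 0.
Proof.
move=> W0; apply: NNPP => no; have q0 w : q w = 0.
  by apply/eqP/negPn/negP => qw; apply: no; exists w.
move: W0; rewrite lt0n dimv_eq0 => /eqP; case; apply/eqP.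
rewrite -subv0; apply/subvP=> w _; rewrite memv0; apply/eqP/qnd => y.
by rewrite /polar !q0 !subr0.
Qed.

(** A proper nondegenerate subspace [j H] has a nondegenerate, nonzero orthogonal
    complement, and a nonzero nondegenerate form takes a nonzero value. *)
Lemma complement_anisotropic (H : vectType F) (N : H -> F) (j : {linear H -> W})
    (c : F) : quadratic_form N -> nondegenerate N -> c != 0 ->
  (forall h, q (j h) = N h * c) -> (\dim {:H} < \dim {:W})%N ->
  exists2 w, q w != 0 & forall h, polar q (j h) w = 0.
Proof.
move=> qN Nnd c0 qj dimHW; apply: NNPP => no.
have q0 w : (forall h, polar q (j h) w = 0) -> q w = 0.
  by move=> wj; apply/eqP/negPn/negP => qw; apply: no; exists w.
have bj h k : polar q (j h) (j k) = c * polar N h k.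
  by rewrite /polar -linearD !qj; ring.
have proj v : exists h, forall k, polar q (j k) (v - j h) = 0.
  have qN' := quadZ_similar qN c.
  have Nnd' : nondegenerate (fun x => c * N x).
    move=> x x0; apply: Nnd => y; apply: (mulfI c0); rewrite mulr0 -[RHS](x0 y).
    by rewrite /polar; ring.
  have [h hE] := nondegenerate_repr qN' Nnd' (polar_lfun q v \o linfun j)%VF.
  exists h => k; rewrite polarC -[v - _]addrC -scaleN1r (polarP qq) bj mulN1r.
  move: (hE k); rewrite comp_lfunE polar_lfunE // lfunE /= => <-.
  by rewrite /polar; ring.
have [v vj] : exists v, v \notin limg (linfun j).
  apply: NNPP => all; suff : (\dim {:W} <= \dim {:H})%N by rewrite leqNgt dimHW.
  rewrite -(limg_ker_dim (linfun j) fullv) addnC (leq_trans _ (leq_addr _ _)) //.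
  apply: dimvS; apply/subvP => w _; apply/negPn/negP => wj; apply: all.
  by exists w.
have [h hE] := proj v; case/negP: vj; apply/memv_imgP; exists h; rewrite ?memvf //.
rewrite lfunE /=; apply/eqP; rewrite -subr_eq0; apply/eqP/qnd => y.
have [k kE] := proj y; rewrite -(subrK (j k) y) polarDr // [X in _ + X]polarC.
rewrite hE addr0 /polar !q0 ?subr0 // => l.
by rewrite polarDr // hE kE addr0.
Qed.

(** The map [h |-> j h] is injective because [N] is nondegenerate and [q w <> 0]. *)
Lemma module_rank1 (H : vectType F) (N : H -> F) (w : W) (j : {linear H -> W}) :
  q w != 0 -> nondegenerate N -> (forall h, q (j h) = N h * q w) ->
  \dim {:W} = \dim {:H} -> similar q N.
Proof.
move=> qw Nnd qj dimW; exists (q w) => //; apply: isometric_sym.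
apply: (@isometricI _ _ _ _ _ (linfun j)) => [h|x y|]; last by rewrite dimW.
  by rewrite lfunE /= qj mulrC.
rewrite !lfunE /= => e; apply/eqP; rewrite -subr_eq0; apply/eqP/Nnd => z.
apply: (mulIf qw); rewrite mul0r /polar !mulrBl -!qj !linearD !linearN /= e.
by rewrite subrr add0r (quad0 qq) subr0 subrr.
Qed.

(** A module [W] of rank two over [H]: a second generator is found in the
    orthogonal complement of [H w], which [H] preserves. *)
Lemma module_rank2 (H : vectType F) (N : H -> F) (rho : H -> W -> W) :
  quadratic_form N -> nondegenerate N ->
  (forall w, linear (rho^~ w)) ->
  (forall h w, q (rho h w) = N h * q w) ->
  (forall w w', (forall h, polar q (rho h w) w' = 0) ->
     forall h k, polar q (rho h w) (rho k w') = 0) ->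
  (0 < \dim {:H})%N -> \dim {:W} = (2 * \dim {:H})%N ->
  exists2 c : F, c != 0 &
    similar q (fun u : (H * H)%type => N u.1 - c * N u.2).
Proof.
move=> qN Nnd rho_lin qrho stable dimH dimW.
have [w qw] : exists w, q w != 0.
  by apply: nondegenerate_anisotropic; rewrite dimW muln_gt0.
pose j w : {linear H -> W} :=
  HB.pack (rho^~ w) (GRing.isLinear.Build F H W _ (rho^~ w) (rho_lin w)).
have [|w' qw' w'w] := complement_anisotropic (j := j w) qN Nnd qw (qrho^~ w).
  by rewrite dimW mul2n -addnn -[X in (X < _)%N]addn0 ltn_add2l.
have {}w'w := stable _ _ w'w.
exists (- (q w' / q w)); first by rewrite oppr_eq0 mulf_neq0 ?invr_eq0.
pose f (u : H * H) : W := j w u.1 + j w' u.2.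
have f_lin : linear f.
  by move=> a u v; rewrite /f !linearP /= scalerDr addrACA.
pose fL : {linear (H * H)%type -> W} :=
  HB.pack f (GRing.isLinear.Build F _ _ _ f f_lin).
apply: (@module_rank1 _ _ w fL) => // [u u0|[h k]|].
- have c0 : - - (q w' / q w) != 0 by rewrite opprK mulf_neq0 ?invr_eq0.
  have E (x y : H * H) : polar (fun u : H * H => N u.1 - - (q w' / q w) * N u.2) x y =
      polar N x.1 y.1 + - - (q w' / q w) * polar N x.2 y.2.
    by rewrite /polar /=; ring.
  case: u u0 => h k u0; congr (_, _).
    apply: Nnd => y; have := u0 (y, 0); rewrite E /= (polarC N k) (polar0 qN).
    by rewrite mulr0 addr0.
  apply: Nnd => y; apply: (mulfI c0); rewrite mulr0.
  by have := u0 (0, y); rewrite E /= (polarC N h) (polar0 qN) add0r.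
- by rewrite /= /f /= quadD w'w addr0 !qrho; field.
by rewrite dim_prod dimW mul2n addnn.
Qed.

End Anisotropic.

Section Composition.

Variables (F : fieldType) (V W : vectType F) (N : V -> F) (q : W -> F).
Hypotheses (qN : quadratic_form N) (Nnd : nondegenerate N).
Hypotheses (qq : quadratic_form q) (qnd : nondegenerate q).
Variable T : V -> W -> W.
Hypotheses (Tl : forall w, linear (T^~ w)) (Tr : forall v, linear (T v)).
Hypothesis qT : forall v w, q (T v w) = N v * q w.
Variable x0 : V.
Hypothesis T1 : forall w, T x0 w = w.
Hypothesis dimVW : \dim {:V} = \dim {:W}.

Local Notation b := (polar q).
Local Notation bN := (polar N).

Let TrD v : {morph T v : x y / x + y}.
Proof. by move=> x y; have := Tr v 1 x y; rewrite !scale1r. Qed.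
Let Tr0 v : T v 0 = 0.
Proof. by apply: (addrI (T v 0)); rewrite -TrD !addr0. Qed.
Let TrZ v a : {morph T v : x / a *: x}.
Proof. by move=> x; have := Tr v a x 0; rewrite !addr0 Tr0 addr0. Qed.
Let TlD w v v' : T (v + v') w = T v w + T v' w.
Proof. by have := Tl w 1 v v'; rewrite !scale1r. Qed.

Let bTT v w w' : b (T v w) (T v w') = N v * b w w'.
Proof. by rewrite /polar -TrD !qT; ring. Qed.

Let bTw v v' w : b (T v w) (T v' w) = bN v v' * q w.
Proof. by rewrite /polar -TlD !qT; ring. Qed.

Let bTTT v v' w w' :
  b (T v w) (T v' w') + b (T v' w) (T v w') = bN v v' * b w w'.
Proof.
transitivity (b (T (v + v') w) (T (v + v') w')
    - N v * b w w' - N v' * b w w').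
  by rewrite !TlD !(polarD qq, polarDr qq) !bTT; ring.
by rewrite bTT quadD; ring.
Qed.

(** The adjoint of [T v] is [bN v x0 - T v]. *)
Let adjT v w w' : b w (T v w') = bN v x0 * b w w' - b (T v w) w'.
Proof. by rewrite -bTTT !T1 addrC addKr. Qed.

(** Pair both sides with an arbitrary vector and move one factor [T v] to the other side. *)
Lemma composition_square v w : T v (T v w) = bN v x0 *: T v w - N v *: w.
Proof.
apply/eqP; rewrite -subr_eq0; apply/eqP/qnd => w'.
have E : b (T v (T v w)) w' = bN v x0 * b (T v w) w' - N v * b w w'.
  by have := adjT v (T v w) w'; rewrite bTT => ->; ring.
rewrite opprB addrA addrC -scaleN1r !(polarP qq) (polarD qq) E.
by rewrite !(polarZ qq); ring.
Qed.

Section Disc.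

Hypothesis N1 : N x0 = 1.

(** If all discriminants vanished, polarising [bN(a, x0)^2 = 4 N(a)] would put [x0] (in
    characteristic 2) or a nonzero vector orthogonal to [x0] into the radical of [N]. *)
Lemma composition_disc : (1 < \dim {:V})%N ->
  exists a, bN a x0 ^+ 2 - 4%:R * N a != 0.
Proof.
move=> dimV; apply: NNPP => no.
have e a : bN a x0 ^+ 2 = 4%:R * N a.
  by apply/eqP; rewrite -subr_eq0; apply/negPn/negP => a0; apply: no; exists a.
have e2 a a' : 2%:R * (bN a x0 * bN a' x0) = 4%:R * bN a a'.
  transitivity (bN (a + a') x0 ^+ 2 - bN a x0 ^+ 2 - bN a' x0 ^+ 2).
    by rewrite (polarD qN); ring.
  by rewrite !e /polar; ring.
have x00 : x0 != 0.
  by apply: contraPneq N1 => ->; rewrite (quad0 qN); apply/eqP; rewrite eq_sym oner_eq0.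
have four : 4%:R = 2%:R * 2%:R :> F by rewrite -natrM.
have [two0|two0] := eqVneq (2%:R : F) 0.
  case/eqP: x00; apply: Nnd => y; rewrite polarC.
  have : bN y x0 ^+ 2 == 0.
    by rewrite e four two0 !mul0r.
  by rewrite sqrf_eq0 => /eqP.
have [a ax0 a0] : exists2 a, bN a x0 = 0 & a != 0.
  have : lker (polar_lfun N x0) != 0%VS.
    rewrite -dimv_eq0 -lt0n; have := limg_ker_dim (polar_lfun N x0) fullv.
    rewrite capfv => dk; have := leq_trans dimV (eq_leq (esym dk)).
    have : (\dim (limg (polar_lfun N x0)) <= 1)%N.
      by rewrite (leq_trans (dimvS (subvf _))) // dimvf.
    by case: (\dim (lker _)) => //; rewrite add0n => l1 l2; rewrite leqNgt l2 in l1.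
  rewrite -vpick0 => p0; exists (vpick (lker (polar_lfun N x0))) => //.
  have := memv_pick (lker (polar_lfun N x0)).
  by rewrite memv_ker polar_lfunE // => /eqP; rewrite polarC.
case/eqP: a0; apply: Nnd => y; have := e2 a y; rewrite ax0 mul0r mulr0.
move=> /esym/eqP; rewrite four.
by rewrite !mulf_eq0 (negPf two0) => /eqP.
Qed.

Section Subalgebra.

Variable a : V.
Let tau := bN a x0.
Let nu := N a.
Hypothesis disc : tau ^+ 2 - 4%:R * nu != 0.

Let B := binary_form tau nu.
Let qB : quadratic_form B := binary_quadratic tau nu.
Let Bnd : nondegenerate B := binary_nondegenerate disc.

Definition rho1 (h : F^o * F^o) (w : W) : W := h.1 *: w + h.2 *: T a w.

Let rho1_lin w : linear (rho1^~ w).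
Proof.
move=> k [x y] [x' y'].
rewrite -[LHS]/((k * x + x') *: w + (k * y + y') *: T a w) /rho1 /=.
by rewrite scalerDr !scalerA addrACA -!scalerDl.
Qed.

Let rho1_sim h w : q (rho1 h w) = B h * q w.
Proof.
case: h => x y; rewrite /rho1 /= quadD !(quadZ qq) (polarZ qq) (polarZr qq) qT.
have -> : b w (T a w) = tau * q w by rewrite -{1}(T1 w) bTw polarC.
rewrite -/nu.
transitivity ((x ^+ 2 + tau * (x * y) + nu * y ^+ 2) * q w); last by [].
by ring.
Qed.

Let perp1 w w' := b w w' = 0 /\ b (T a w) w' = 0.

Let perp1_rho w w' : (forall h, b (rho1 h w) w' = 0) -> perp1 w w'.
Proof.
move=> w0; split.
  by have := w0 (1, 0); rewrite /rho1 /= scale1r scale0r addr0.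
by have := w0 (0, 1); rewrite /rho1 /= scale1r scale0r add0r.
Qed.

Let perp1_T w w' : perp1 w w' -> perp1 w (T a w').
Proof.
case=> e0 e1; split; first by rewrite adjT e0 e1 mulr0 subr0.
by rewrite bTT e0 mulr0.
Qed.

Let rho1_stable w w' : (forall h, b (rho1 h w) w' = 0) ->
  forall h k, b (rho1 h w) (rho1 k w') = 0.
Proof.
move=> /perp1_rho p h k; have [e0 e1] := p; have [e2 e3] := perp1_T p.
rewrite /rho1 !(polarD qq, polarDr qq, polarZ qq, polarZr qq) e0 e1 e2 e3.
by rewrite !mulr0 !addr0.
Qed.

Lemma composition_rank1 : \dim {:W} = 2%N -> similar q B.
Proof.
move=> dimW; have [|w qw] := nondegenerate_anisotropic qnd; first by rewrite dimW.
pose j : {linear (F^o * F^o)%type -> W} :=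
  HB.pack (rho1^~ w) (GRing.isLinear.Build F _ W _ (rho1^~ w) (rho1_lin w)).
apply: (module_rank1 qq (j := j) qw Bnd (rho1_sim^~ w)).
by rewrite dimW dim_prod !dimvf.
Qed.

Lemma composition_rank2 : \dim {:W} = 4%N -> exists2 c : F, c != 0 &
  similar q (qs_form (q := pfister_step c (binary_space tau nu))).
Proof.
move=> dimW; have dimB : \dim {:(F^o * F^o)%type} = 2%N by rewrite dim_prod !dimvf.
apply: (module_rank2 qq qnd qB Bnd rho1_lin rho1_sim rho1_stable).
  by rewrite dimB.
by rewrite dimB dimW.
Qed.

Let orthogonal_generator : (2 < \dim {:V})%N ->
  exists u, [/\ N u != 0, bN u x0 = 0 & bN a u = 0].
Proof.
move=> dimV; pose j (h : F^o * F^o) : V := h.1 *: x0 + h.2 *: a.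
have j_lin : linear j.
  move=> k [x y] [x' y'].
  rewrite -[LHS]/((k * x + x') *: x0 + (k * y + y') *: a) /j /=.
  by rewrite scalerDr !scalerA addrACA -!scalerDl.
pose jL : {linear (F^o * F^o)%type -> V} :=
  HB.pack j (GRing.isLinear.Build F _ _ _ j j_lin).
have [[x y]||u Nu uj] := complement_anisotropic qN Nnd (j := jL) qB Bnd (oner_neq0 F).
- rewrite /= /j /= quadD !(quadZ qN) (polarZ qN) (polarZr qN) N1 polarC !mulr1.
  transitivity (x ^+ 2 + tau * (x * y) + nu * y ^+ 2 : F); last by [].
  by rewrite /tau /nu; ring.
- have -> : \dim {:(F^o * F^o)%type} = 2%N by rewrite dim_prod !dimvf.
  exact: dimV.
exists u; split=> //.
  by have := uj (1, 0); rewrite /= /j /= scale1r scale0r addr0 polarC.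
by have := uj (0, 1); rewrite /= /j /= scale1r scale0r add0r.
Qed.

Section OrthogonalGenerator.

Variable u : V.
Hypotheses (Nu : N u != 0) (ux0 : bN u x0 = 0) (au : bN a u = 0).

Let TuTu w : T u (T u w) = - N u *: w.
Proof. by rewrite composition_square ux0 scale0r sub0r scaleNr. Qed.

Let adjTu w w' : b w (T u w') = - b (T u w) w'.
Proof. by rewrite adjT ux0 mul0r sub0r. Qed.

Let TuTa w : T u (T a w) = tau *: T u w - T a (T u w).
Proof.
apply/eqP; rewrite -subr_eq0; apply/eqP/qnd => w'.
have E : b (T u (T a w)) w' = tau * b (T u w) w' - b (T a (T u w)) w'.
  rewrite -[LHS]opprK -adjTu -[- _]addr0 -[0 in LHS](mul0r (b w w')) -au -bTTT.
  by rewrite addKr adjT.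
rewrite opprB addrA addrC -scaleN1r !(polarP qq) (polarD qq) E !(polarZ qq).
by ring.
Qed.

Definition rho2 (h : (F^o * F^o) * (F^o * F^o)) (w : W) : W :=
  rho1 h.1 w + rho1 h.2 (T u w).

Let Q2 := pfister_step (- N u) (binary_space tau nu).

Let rho2_lin w : linear (rho2^~ w).
Proof.
move=> k [x y] [x' y'].
have e1 : rho1 (k *: x + x') w = k *: rho1 x w + rho1 x' w := rho1_lin w k x x'.
have e2 : rho1 (k *: y + y') (T u w) = k *: rho1 y (T u w) + rho1 y' (T u w).
  exact: rho1_lin.
rewrite -[LHS]/(rho1 (k *: x + x') w + rho1 (k *: y + y') (T u w)) e1 e2.
by rewrite /rho2 /= (scalerDr k (rho1 x w)) [RHS]addrACA.
Qed.

Let orth w : [/\ b w (T u w) = 0, b (T a w) (T u w) = 0,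
  b w (T a (T u w)) = 0 & b (T a w) (T a (T u w)) = 0].
Proof.
have e0 : b w (T u w) = 0.
  by rewrite -{1}(T1 w) bTw polarC ux0 mul0r.
have e1 : b (T a w) (T u w) = 0 by rewrite bTw au mul0r.
split=> //; last by rewrite bTT e0 mulr0.
by rewrite adjT e0 e1 mulr0 subr0.
Qed.

Let rho2_sim h w : q (rho2 h w) = qs_form (h : qs_space Q2) * q w.
Proof.
case: h => h k; have [e0 e1 e2 e3] := orth w.
rewrite /rho2 /= quadD !rho1_sim qT /rho1.
rewrite !(polarD qq, polarDr qq, polarZ qq, polarZr qq) e0 e1 e2 e3.
by rewrite /B; ring.
Qed.

Let perp2 w w' := perp1 w w' /\ perp1 (T u w) w'.

Let perp2_rho w w' : (forall h, b (rho2 h w) w' = 0) -> perp2 w w'.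
Proof.
have r0 x : rho1 (0, 0) x = 0 by rewrite /rho1 /= !scale0r addr0.
move=> w0; split; apply: perp1_rho => h.
  by have := w0 (h, (0, 0)); rewrite /rho2 /= r0 addr0.
by have := w0 ((0, 0), h); rewrite /rho2 /= r0 add0r.
Qed.

Let perp2_Ta w w' : perp2 w w' -> perp2 w (T a w').
Proof. by case=> p p'; split; apply: perp1_T. Qed.

Let perp2_Tu w w' : perp2 w w' -> perp2 w (T u w').
Proof.
case=> -[e0 e1] [e2 e3]; split; split; rewrite adjTu.
- by rewrite e2 oppr0.
- rewrite TuTa -scaleN1r addrC (polarP qq) (polarZ qq) e2 e3.
  by rewrite !mulr0 addr0 oppr0.
- by rewrite TuTu (polarZ qq) e0 mulr0 oppr0.
rewrite TuTa TuTu -scaleN1r addrC (polarP qq) (polarZ qq) TrZ !(polarZ qq).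
by rewrite e0 e1 !mulr0 addr0 oppr0.
Qed.

Let rho2_stable w w' : (forall h, b (rho2 h w) w' = 0) ->
  forall h k, b (rho2 h w) (rho2 k w') = 0.
Proof.
move=> /perp2_rho p h k; have pu := perp2_Tu p.
have [[e0 e1] [e2 e3]] := p; have [[a0 a1] [a2 a3]] := perp2_Ta p.
have [[u0 u1] [u2 u3]] := pu; have [[v0 v1] [v2 v3]] := perp2_Ta pu.
rewrite /rho2 /rho1 !(polarD qq, polarDr qq, polarZ qq, polarZr qq).
rewrite e0 e1 e2 e3 a0 a1 a2 a3 u0 u1 u2 u3 v0 v1 v2 v3.
by rewrite !mulr0 !addr0.
Qed.

(** The algebra acting here, generated by [T a] and [T u], has dimension 4 and its norm is
    the Pfister form [<1, N u> (x) B]. *)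
Lemma composition_rank3_step : \dim {:W} = 8%N -> exists2 c : F, c != 0 &
  similar q (qs_form (q := pfister_step c Q2)).
Proof.
move=> dimW; have qQ2 : quadratic_form (qs_form (q := Q2)).
  exact: pfister_step_quadratic.
have dimB : \dim {:(F^o * F^o)%type} = 2%N by rewrite dim_prod !dimvf.
have Q2nd : nondegenerate (qs_form (q := Q2)).
  move=> [h k] hk0; have E (x y x' y' : F^o * F^o) :
      polar (qs_form (q := Q2)) (x, y) (x', y') = polar B x x' + N u * polar B y y'.
    by rewrite /polar /= -/B; ring.
  congr (_, _); apply: Bnd => y.
    have := hk0 (y, 0); rewrite E (polarC B k) (polar0 qB) mulr0 addr0.
    by [].
  apply: (mulfI Nu); rewrite mulr0; have := hk0 (0, y).
  by rewrite E (polarC B h) (polar0 qB) add0r.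
apply: (module_rank2 qq qnd qQ2 Q2nd rho2_lin rho2_sim rho2_stable).
  by rewrite dim_prod dimB.
by rewrite dim_prod dimB dimW.
Qed.

End OrthogonalGenerator.

Lemma composition_rank3 : \dim {:W} = 8%N -> exists c d : F,
  [/\ c != 0, d != 0 & similar q
    (qs_form (q := pfister_step c (pfister_step d (binary_space tau nu))))].
Proof.
move=> dimW; have [|u [Nu ux0 au]] := orthogonal_generator; first by rewrite dimVW dimW.
have [c c0 qc] := composition_rank3_step Nu ux0 au dimW.
by exists c, (- N u); split; rewrite ?oppr_eq0.
Qed.

End Subalgebra.
End Disc.
End Composition.

Section CompositionPfister.

Variable F : fieldType.

Lemma pfister_step_isometric (c : F) (Q Q' : quad_space F) :
  isometric (qs_form (q := Q)) (qs_form (q := Q')) ->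
  isometric (qs_form (q := pfister_step c Q)) (qs_form (q := pfister_step c Q')).
Proof.
move=> iso; have := isometric_sum iso (isometric_scale (- c) iso).
move=> iso2; refine (isometric_trans (isometric_trans _ iso2) _).
  by apply: isometric_ext => u /=; rewrite mulNr.
by apply: isometric_ext => u /=; rewrite mulNr.
Qed.

(** In dimension [2^n] the module over [F + F a] has rank 1, 2 or 4. *)
Lemma unital_composition_pfister n (V W : vectType F) (N : V -> F) (q : W -> F)
    (T : V -> W -> W) (x0 : V) :
  quadratic_form N -> nondegenerate N -> quadratic_form q -> nondegenerate q ->
  (forall w, linear (T^~ w)) -> (forall v, linear (T v)) ->
  (forall v w, q (T v w) = N v * q w) -> (forall w, T x0 w = w) -> N x0 = 1 ->
  \dim {:V} = (2 ^ n)%N -> \dim {:W} = (2 ^ n)%N -> (0 < n <= 3)%N ->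
  exists (U : vectType F) (pi : U -> F), quadratic_pfister n pi /\ similar q pi.
Proof.
move=> qN Nnd qq qnd Tl Tr qT T1 N1 dimV dimW n3.
have [|a disc] := composition_disc qN Nnd N1.
  by rewrite dimV; case: n n3 {dimV dimW} => // n _; rewrite expnS leq_pmulr ?expn_gt0.
have [K etK isoK] := binary_norm disc.
suff [s [size_s s0 qs]] : exists s : seq F, [/\ (size s).+1 = n,
    all (fun c => c != 0) s & similar q (qs_form (q := foldr (@pfister_step F)
      (binary_space (polar N a x0) (N a)) s))].
  have iso : isometric (qs_form (q := foldr (@pfister_step F)
      (binary_space (polar N a x0) (N a)) s))
      (qs_form (q := foldr (@pfister_step F) (norm_space K) s)).
    by elim: s {size_s s0 qs} => //= c s; apply: pfister_step_isometric.
  exists _, (qs_form (q := foldr (@pfister_step F) (norm_space K) s)); split.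
    by exists s, K; split=> //; apply: isometric_ext.
  exact: similar_trans qs (isometric_similar iso).
case: n n3 dimV dimW => [|[|[|[|//]]]] // _ dimV dimW.
- exists [::]; split=> //.
  exact: (composition_rank1 qq qnd Tl qT T1 disc dimW).
- have [c c0 qc] := composition_rank2 qq qnd Tl Tr qT T1 disc dimW.
  by exists [:: c]; rewrite /= c0.
have dimVW : \dim {:V} = \dim {:W} by rewrite dimV dimW.
have [c [d [c0 d0 qcd]]] :=
  composition_rank3 qN Nnd qq qnd Tl Tr qT T1 dimVW N1 disc dimW.
by exists [:: c; d]; rewrite /= c0 d0.
Qed.

(** The radical of [q2] contains the kernel of [m x]. *)
Lemma composition_injective (V1 V2 V3 : vectType F) (q1 : V1 -> F) (q2 : V2 -> F)
    (q3 : V3 -> F) (m : V1 -> V2 -> V3) (c : F) :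
  quadratic_form q2 -> nondegenerate q2 -> quadratic_form q3 -> c != 0 ->
  (forall x, linear (m x)) ->
  (forall x y, q3 (m x y) = c * (q1 x * q2 y)) ->
  forall x, q1 x != 0 -> exists f : 'Hom(V2, V3),
    [/\ injective f, f =1 m x & forall y, q3 (f y) = c * q1 x * q2 y].
Proof.
move=> qq2 nd2 qq3 c0 mr qm x qx.
pose f : {linear V2 -> V3} := HB.pack (m x) (GRing.isLinear.Build F _ _ _ (m x) (mr x)).
exists (linfun f); split=> [y z|y|y]; rewrite !lfunE //=; last first.
  by rewrite qm mulrA.
move=> e; apply/eqP; rewrite -subr_eq0; apply/eqP/nd2 => w.
have cx0 : c * q1 x != 0 by rewrite mulf_neq0.
have fE v : q3 (f v) = c * q1 x * q2 v by rewrite /= qm mulrA.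
apply: (mulfI cx0); rewrite mulr0 /polar !mulrBr -!fE linearD linearB /= e.
by rewrite subrr add0r (quad0 qq3) subr0 subrr.
Qed.

(** Division by a fixed [x0] with [q1 x0 != 0] turns the pairing into an action
    of the unital space [(V1, q1 / q1 x0)] on [V2]. *)
Lemma composition_pfister n (V1 V2 V3 : vectType F) (q1 : V1 -> F) (q2 : V2 -> F)
    (q3 : V3 -> F) (m : V1 -> V2 -> V3) (c : F) :
  quadratic_form q1 -> nondegenerate q1 ->
  quadratic_form q2 -> nondegenerate q2 -> quadratic_form q3 -> c != 0 ->
  (forall x, linear (m x)) -> (forall y, linear (m^~ y)) ->
  (forall x y, q3 (m x y) = c * (q1 x * q2 y)) ->
  \dim {:V1} = (2 ^ n)%N -> \dim {:V2} = (2 ^ n)%N -> \dim {:V3} = (2 ^ n)%N ->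
  (0 < n <= 3)%N ->
  exists (U : vectType F) (pi : U -> F),
    [/\ quadratic_pfister n pi, similar q1 pi, similar q2 pi & similar q3 pi].
Proof.
move=> qq1 nd1 qq2 nd2 qq3 c0 mr ml qm dim1 dim2 dim3 n3.
have pos k : (0 < 2 ^ k)%N by rewrite expn_gt0.
have [|x0 qx0] := nondegenerate_anisotropic nd1; first by rewrite dim1.
have [|y0 qy0] := nondegenerate_anisotropic nd2; first by rewrite dim2.
have [f [f_inj fm qf]] := composition_injective qq2 nd2 qq3 c0 mr qm qx0.
have [|g [g_inj gm qg]] := composition_injective (m := fun y => m^~ y)
  qq1 nd1 qq3 c0 ml _ qy0; first by move=> y x; rewrite qm [q1 _ * _]mulrC.
have sim32 : similar q3 q2.
  exists (c * q1 x0); first by rewrite mulf_neq0.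
  by apply: isometric_sym; apply: (isometricI qf f_inj); rewrite dim2 dim3.
have sim31 : similar q3 q1.
  exists (c * q2 y0); first by rewrite mulf_neq0.
  by apply: isometric_sym; apply: (isometricI qg g_inj); rewrite dim1 dim3.
have f0 : lker f == 0%VS by apply/lker0P.
have [|h fK hK] := inj_lfun_bij f_inj; first by rewrite dim2 dim3.
have fVK w : f (f^-1%VF w) = w by rewrite -(hK w) lker0_lfunK.
have [|||||||U [pi [pf sim2]]] := @unital_composition_pfister n V1 V2
  (fun x => (q1 x0)^-1 * q1 x) q2 (fun x y => f^-1%VF (m x y)) x0 _ _ qq2 nd2
    _ _ _ _ _ dim1 dim2 n3.
- exact: quadZ_similar.
- move=> x xx; apply: nd1 => y; apply: (mulfI (invr_neq0 qx0)); rewrite mulr0.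
  by rewrite -(xx y) /polar; ring.
- by move=> w a x y /=; rewrite ml linearP.
- by move=> v a x y; rewrite mr linearP.
- move=> v w; have c1 : c * q1 x0 != 0 by rewrite mulf_neq0.
  by apply: (mulfI c1); rewrite -qf fVK qm; field.
- by move=> w; rewrite -fm lker0_lfunK.
- by rewrite mulVf.
exists U, pi; split=> //; last exact: similar_trans sim32 sim2.
exact: similar_trans (similar_sym sim31) (similar_trans sim32 sim2).
Qed.

End CompositionPfister.

(** * Sandwich relations in algebras with involution *)

Section Center.

Variables (F : fieldType) (A : falgType F).

Lemma centerP (z : A) : reflect (forall c, z * c = c * z) (z \in 'Z({:A})%VS).
Proof.
rewrite memv_cap memvf /=.
apply: (iffP centvP) => [zC c|zC c _]; first by rewrite zC ?memvf.
by rewrite zC.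
Qed.

Definition ideals_meet_center : Prop :=
  forall I : {vspace A}, two_sided_ideal I -> I <> 0%VS ->
    exists2 z, z \in I & z \in 'Z({:A})%VS /\ z <> 0.

(** [I] and its image under the involution either span [A] directly, and then the
    component in [I] of 1 is central, or they coincide with [A]. *)
Lemma involution_ideals_meet_center (sigma : 'End(A)) :
  algebra_with_involution sigma -> ideals_meet_center.
Proof.
case=> sM sK _ simple I [AI IA] I0.
have idl x y : y \in I -> x * y \in I.
  by move=> yI; apply: (subvP AI); apply: memv_mul; rewrite ?memvf.
have idr x y : x \in I -> x * y \in I.
  by move=> xI; apply: (subvP IA); apply: memv_mul; rewrite ?memvf.
have sIP x : (x \in (sigma @: I)%VS) = (sigma x \in I).
  apply/memv_imgP/idP => [[y yI ->]|sxI]; first by rewrite sK.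
  by exists (sigma x); rewrite ?sK.
have twoI (J : {vspace A}) : (forall x y, y \in J -> x * y \in J) ->
    (forall x y, x \in J -> x * y \in J) -> two_sided_ideal J.
  by move=> l r; split; apply/prodvP => x y ? ?; [apply: l | apply: r].
have sS (J : {vspace A}) : (forall x, (x \in J) = (sigma x \in J)) -> (sigma @: J)%VS = J.
  move=> JE; apply/vspaceP=> x; apply/memv_imgP/idP => [[y yJ ->]|xJ].
    by rewrite -JE.
  by exists (sigma x); rewrite ?sK // -JE.
have [cap0|capA] : (I :&: sigma @: I)%VS = 0%VS \/ (I :&: sigma @: I)%VS = fullv.
- apply: simple.
    apply: twoI => x y; rewrite !memv_cap !sIP sM => /andP[yI syI].
      by rewrite idl // idr.
    by rewrite idr // idl.
  by apply: sS => x; rewrite !memv_cap !sIP sK andbC.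
- have [s0|sA] : (I + sigma @: I)%VS = 0%VS \/ (I + sigma @: I)%VS = fullv.
  + apply: simple; last first.
      apply: sS => x; apply/memv_addP/memv_addP => -[u uI [v vI e]].
        exists (sigma v); first by rewrite -sIP.
        by exists (sigma u); rewrite ?sIP ?sK // e linearD addrC.
      exists (sigma v); first by rewrite -sIP.
      exists (sigma u); rewrite ?sIP ?sK //.
      by rewrite -[x]sK e linearD addrC.
    apply: twoI => x y /memv_addP[u uI [v]]; rewrite sIP => vI ->.
      rewrite mulrDr memv_add ?idl // sIP sM idr //.
    by rewrite mulrDl memv_add ?idr // sIP sM idl.
  + case: I0; apply/eqP; rewrite -subv0 -s0; exact: addvSl.
  have : 1 \in (I + sigma @: I)%VS by rewrite sA memvf.
  case/memv_addP=> e eI [f fI e1]; exists e => //; split.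
    apply/centerP => c; apply/eqP; rewrite -subr_eq0 -memv0 -cap0 memv_cap.
    apply/andP; split; first by apply: memvB; [apply: idr | apply: idl].
    have -> : e = 1 - f by rewrite e1 addrK.
    have -> : (1 - f) * c - c * (1 - f) = c * f - f * c.
      by rewrite mulrBl mulrBr mul1r mulr1 opprB addrC addrA subrK.
    by move: fI; rewrite !sIP linearB /= !sM => fI; apply: memvB; [apply: idr | apply: idl].
  move=> e0; move: fI; rewrite sIP.
  have -> : f = 1 by rewrite e1 e0 add0r.
  move=> s1I; apply: I0; apply/eqP; rewrite -subv0 -cap0 subv_cap subvv /=.
  have s1 : sigma 1 = 1.
    by rewrite -[LHS]mulr1 -[1 in X in _ * X]sK -sM mulr1 sK.
  by apply/subvP=> x _; rewrite sIP -[sigma x]mulr1 idl // -s1.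
exists 1; last by split; [apply/centerP => c; rewrite mulr1 mul1r | apply/eqP/oner_neq0].
by apply: (subvP (capvSl I (sigma @: I)%VS)); rewrite capA memvf.
Qed.

(** A shortest nontrivial relation could be rescaled to have a nonzero central last
    entry; its commutators are shorter relations, so all its entries are central. *)
Lemma sandwich_independent k (l x : 'I_k -> A) : ideals_meet_center ->
  (forall z : 'I_k -> A, (forall i, z i \in 'Z({:A})%VS) ->
     \sum_i l i * z i = 0 -> forall i, z i = 0) ->
  (forall b, \sum_i l i * b * x i = 0) -> forall i, x i = 0.
Proof.
move=> meet; elim: k l x => [|k IH] l x indep rel; first by case.
pose l' i := l (widen_ord (leqnSn k) i).
have indep' z : (forall i, z i \in 'Z({:A})%VS) ->
    \sum_i l' i * z i = 0 -> forall i, z i = 0.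
  move=> zZ z0 i; pose z' (j : 'I_k.+1) := if unlift ord_max j is Some j' then z j' else 0.
  have z'E j : z' (widen_ord (leqnSn k) j) = z j.
    rewrite /z' (_ : widen_ord _ j = lift ord_max j) ?liftK //.
    by apply: val_inj; rewrite /= /bump leqNgt ltn_ord.
  rewrite -z'E; apply: indep => [j|].
    by rewrite /z'; case: unliftP => [j' _|_]; rewrite ?zZ ?mem0v.
  rewrite big_ord_recr /= /z' unlift_none mulr0 addr0 -[RHS]z0.
  by apply: eq_bigr => j _; rewrite -/(z' _) z'E.
have short y : (forall b, \sum_i l i * b * y i = 0) -> y ord_max = 0 ->
    forall i, y i = 0.
  move=> yrel y0 i; have yl := IH l' (fun i => y (widen_ord (leqnSn k) i)) indep'.
  case: (unliftP ord_max i) => [j ->|-> //].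
  rewrite (_ : lift ord_max j = widen_ord (leqnSn k) j); last first.
    by apply: val_inj; rewrite /= /bump leqNgt ltn_ord.
  apply: yl => b; have := yrel b; rewrite big_ord_recr /= y0 mulr0 addr0.
  by [].
have [x0|x0] := eqVneq (x ord_max) 0; first exact: short.
pose Phi (y : {ffun 'I_k.+1 -> A}) : 'End(A) :=
  \sum_i (amulr (y i) \o amull (l i))%VF.
have PhiE y b : Phi y b = \sum_i l i * b * y i.
  by rewrite sum_lfunE; apply: eq_bigr => i _; rewrite comp_lfunE !lfunE.
have Phi_lin : linear Phi.
  move=> a u v; apply/lfunP=> b; rewrite add_lfunE scale_lfunE !PhiE.
  rewrite scaler_sumr -big_split; apply: eq_bigr => i _ /=.
  by rewrite !ffunE mulrDr scalerAr.
pose PhiL : {linear {ffun 'I_k.+1 -> A} -> 'End(A)} :=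
  HB.pack Phi (GRing.isLinear.Build F _ _ _ Phi Phi_lin).
pose ev (y : {ffun 'I_k.+1 -> A}) := y ord_max.
have ev_lin : linear ev by move=> a u v; rewrite /ev !ffunE.
pose evL : {linear {ffun 'I_k.+1 -> A} -> A} :=
  HB.pack ev (GRing.isLinear.Build F _ _ _ ev ev_lin).
pose I := (linfun evL @: lker (linfun PhiL))%VS.
have IP z : reflect (exists2 y : {ffun 'I_k.+1 -> A},
    forall b, \sum_i l i * b * y i = 0 & y ord_max = z) (z \in I).
  apply: (iffP memv_imgP) => [[y]|[y yrel <-]].
    rewrite memv_ker !lfunE /= => /eqP y0 ->; exists y => // b.
    by rewrite -PhiE y0 zero_lfunE.
  exists y; rewrite ?lfunE // memv_ker lfunE /=; apply/eqP/lfunP=> b.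
  by rewrite PhiE yrel zero_lfunE.
have [||z /IP[y yrel ymax] [zZ z0]] := meet I.
- split; apply/prodvP => u v.
    move=> _ /IP[y yrel <-]; apply/IP; exists [ffun i => u * y i].
      by move=> b; rewrite -[RHS](yrel (b * u)); apply: eq_bigr => i _; rewrite ffunE !mulrA.
    by rewrite ffunE.
  move=> /IP[y yrel <-] _; apply/IP; exists [ffun i => y i * v].
    move=> b; transitivity ((\sum_i l i * b * y i) * v); last by rewrite yrel mul0r.
    by rewrite mulr_suml; apply: eq_bigr => i _; rewrite ffunE !mulrA.
  by rewrite ffunE.
- move=> I0; case/eqP: x0; apply/eqP; rewrite -memv0 -I0.
  apply/IP; exists [ffun i => x i]; last by rewrite ffunE.
  by move=> b; rewrite -[RHS](rel b); apply: eq_bigr => i _; rewrite ffunE.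
have yZ i : y i \in 'Z({:A})%VS.
  apply/centerP=> c; apply/eqP; rewrite -subr_eq0; apply/eqP.
  apply: (short (fun i => y i * c - c * y i)); last first.
    by rewrite /= ymax (centerP _ zZ) subrr.
  move=> b; transitivity ((\sum_i l i * b * y i) * c - \sum_i l i * (b * c) * y i).
    rewrite mulr_suml -sumrB; apply: eq_bigr => j _.
    by rewrite mulrBr !mulrA.
  by rewrite !yrel mul0r subrr.
case: z0; rewrite -ymax; apply: indep => //.
by rewrite -[RHS](yrel 1); apply: eq_bigr => i _; rewrite mulr1.
Qed.

End Center.

(** * Grading by a biquadratic subalgebra *)

(** The part of the hypotheses used to decompose [A] and to multiply the [W_i], transported
    from the algebra [L] to maps and elements of [A].  The three [g i] are only constrained
    on [L]; [a i] generates the subalgebra of [L] fixed by [g i]. *)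
Record klein_data (F : fieldType) (A : falgType F) (sigma : 'End(A))
    (L : {vspace A}) (g : 'I_3 -> 'End(A)) (a : 'I_3 -> A) : Prop := KleinData {
  kd_sM : forall x y, sigma (x * y) = sigma y * sigma x;
  kd_sK : forall x, sigma (sigma x) = x;
  kd_1 : 1 \in L;
  kd_M : forall x y, x \in L -> y \in L -> x * y \in L;
  kd_C : forall x y, x \in L -> y \in L -> x * y = y * x;
  kd_s : forall x, x \in L -> sigma x = x;
  kd_red : forall x, x \in L -> x * x = 0 -> x = 0;
  kd_gL : forall i x, x \in L -> g i x \in L;
  kd_gM : forall i x y, x \in L -> y \in L -> g i (x * y) = g i x * g i y;
  kd_g1 : forall i, g i 1 = 1;
  kd_gK : forall i x, x \in L -> g i (g i x) = x;
  kd_gg : forall i j k x, i != j -> j != k -> i != k -> x \in L ->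
    g i (g j x) = g k x;
  kd_gF : forall i j x, i != j -> x \in L -> g i x = x -> g j x = x -> x \in 1%VS;
  kd_aL : forall i, a i \in L;
  kd_ga : forall i, g i (a i) = a i;
  kd_aF : forall i, a i \notin 1%VS;
  kd_gen : forall i x, x \in L -> g i x = x ->
    exists p q : F, x = p%:A + q *: a i
}.

Section Klein.

Variables (F : fieldType) (A : falgType F) (sigma : 'End(A)) (L : {vspace A}).
Variables (g : 'I_3 -> 'End(A)) (a : 'I_3 -> A).
Hypothesis kd : klein_data sigma L g a.

Let sM := kd_sM kd.
Let sK := kd_sK kd.
Let LM := kd_M kd.
Let LC := kd_C kd.
Let aL := kd_aL kd.
Let gM := kd_gM kd.

Lemma kd_s1 : sigma 1 = 1.
Proof. exact: (kd_s kd) (kd_1 kd). Qed.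

(** The automorphism [g (ordS i)] is one of the two that do not fix [a i]; both of them have
    the same effect on it. *)
Definition conj_gen i := g (ordS i) (a i).
Local Notation c := conj_gen.

Lemma ordS_neq (i : 'I_3) : i != ordS i.
Proof. by case: i => -[|[|[|]]]. Qed.

Lemma g_conj i j : j != i -> g j (a i) = c i.
Proof.
move=> ji; have [->//|jS] := eqVneq j (ordS i).
by rewrite -{1}(kd_ga kd i) (kd_gg kd ji (ordS_neq i) jS).
Qed.

Lemma conjL i : c i \in L.
Proof. exact: (kd_gL kd). Qed.

Lemma g_conjK i j : j != i -> g j (c i) = a i.
Proof. by move=> ji; rewrite -(g_conj ji) (kd_gK kd). Qed.

Lemma g_conj_fix i : g i (c i) = c i.
Proof.
have [j [ji [k [ki kj]]]] : exists j : 'I_3, j != i /\ exists k, k != i /\ k != j.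
  exists (ordS i); split; last (exists (ordS (ordS i)); split);
    by case: i => -[|[|[|]]].
have ij : i != j by rewrite eq_sym.
have [ik jk] : i != k /\ j != k by rewrite ![_ == k]eq_sym.
by rewrite -(g_conj ji) (kd_gg kd ij jk ik (aL i)) !g_conj.
Qed.

(** The square of [a i - conj_gen i] is the discriminant of [a i], a nonzero scalar. *)
Definition gap i := a i - c i.
Local Notation d := gap.

Lemma gapL i : d i \in L.
Proof. by rewrite memvB ?conjL. Qed.

Lemma quad_rel i : exists t n e : F, [/\ a i + c i = t%:A, a i * c i = n%:A,
  d i * d i = e%:A & e != 0].
Proof.
have ji : ordS i != i by rewrite eq_sym ordS_neq.
have inF x : x \in L -> g i x = x -> g (ordS i) x = x -> exists k : F, x = k%:A.
  by move=> xL x1 x2; apply/vlineP; apply: (kd_gF kd (ordS_neq i)).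
have [t tE] : exists t : F, a i + c i = t%:A.
  apply: inF; first by rewrite memvD ?conjL.
    by rewrite linearD /= (kd_ga kd) g_conj_fix.
  by rewrite linearD /= g_conj // g_conjK // addrC.
have [n nE] : exists n : F, a i * c i = n%:A.
  apply: inF; first by rewrite LM ?conjL.
    by rewrite gM ?conjL ?(kd_ga kd) ?g_conj_fix.
  by rewrite gM ?conjL // g_conj // g_conjK // LC ?conjL.
have [e eE] : exists e : F, d i * d i = e%:A.
  apply: inF; first by rewrite LM ?gapL.
    by rewrite gM ?gapL // /d linearB /= (kd_ga kd) g_conj_fix.
  rewrite gM ?gapL // /d linearB /= g_conj // g_conjK // -opprB mulrNN.
  by [].
exists t, n, e; split=> //; apply/eqP=> e0.
have := kd_aF kd i; apply/negP/negPn; apply: (kd_gF kd (ordS_neq i)) => //.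
  exact: (kd_ga kd).
apply/eqP; rewrite eq_sym -subr_eq0; apply/eqP; apply: (kd_red kd) (gapL i) _.
by rewrite eE e0 scale0r.
Qed.

Lemma gap_regl i x : d i * x = 0 -> x = 0.
Proof.
have [t [n [e [_ _ de e0]]]] := quad_rel i => dx.
apply: (scalerI e0); rewrite scaler0 -[LHS]mulr_algl -de -mulrA dx mulr0 //.
Qed.

Lemma gap_regr i x : x * d i = 0 -> x = 0.
Proof.
have [t [n [e [_ _ de e0]]]] := quad_rel i => dx.
by apply: (scalerI e0); rewrite scaler0 -mulr_algr -de mulrA dx mul0r.
Qed.

(** [L] is generated by [K_j] over [K_i]: the coefficient of [a j] is found by applying
    [1 - g i]. *)
Lemma kd_decomp i j y : i != j -> y \in L ->
  exists p q r s : F, y = p%:A + q *: a i + r *: a j + s *: (a j * a i).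
Proof.
move=> ij yL; have [t [n [e [_ _ de e0]]]] := quad_rel j.
have ji : j != i by rewrite eq_sym.
pose y2 := e^-1 *: ((y - g i y) * d j).
have giL : g i y \in L by exact: (kd_gL kd).
have y2L : y2 \in L by rewrite memvZ // LM ?gapL // memvB.
have gd : g i (d j) = - d j by rewrite linearB /= g_conj // g_conjK // opprB.
have gy2 : g i y2 = y2.
  rewrite /y2 linearZ /= gM ?gapL ?memvB // gd linearB /= (kd_gK kd) //.
  by rewrite mulrN -mulNr opprB.
have y2d : y2 * d j = y - g i y.
  by rewrite /y2 -scalerAl -mulrA de mulr_algr scalerA mulVf ?scale1r.
have [r [s y2E]] := kd_gen kd y2L gy2.
have [p [q y1E]] : exists p q : F, y - y2 * a j = p%:A + q *: a i.
  apply: (kd_gen kd); first by rewrite memvB ?LM.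
  rewrite linearB /= gM // gy2 g_conj //.
  have -> : g i y = y - (y2 * a j - y2 * c j) by rewrite -mulrBr -/(d j) y2d subKr.
  by rewrite -addrA -opprD subrK.
exists p, q, r, s; rewrite -[LHS](subrK (y2 * a j)) y1E y2E mulrDl mulr_algl.
by rewrite -scalerAl [a i * _]LC // addrA.
Qed.

Lemma kd_indep i j (p q r s : F) : i != j ->
  p%:A + q *: a i + r *: a j + s *: (a j * a i) = 0 ->
  [/\ p = 0, q = 0, r = 0 & s = 0].
Proof.
have indep1 k (x y : F) : x%:A + y *: a k = 0 -> x = 0 /\ y = 0.
  move=> xy0; have y0 : y = 0.
    apply/eqP/negPn/negP => y0; case/negP: (kd_aF kd k); apply/vlineP.
    exists (- (y^-1 * x)); rewrite scaleNr -scalerA -scalerN.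
    have -> : - x%:A = y *: a k by apply/eqP; rewrite eq_sym -addr_eq0 addrC xy0.
    by rewrite scalerA mulVf ?scale1r.
  split=> //; move/eqP: xy0; rewrite y0 scale0r addr0 scaler_eq0 oner_eq0 orbF.
  by move/eqP.
move=> ij E; have ji : j != i by rewrite eq_sym.
have E2 : p%:A + q *: a i + (r%:A + s *: a i) * a j = 0.
  by rewrite mulrDl mulr_algl -scalerAl [a i * _]LC // addrA.
have := congr1 (g i) E2; rewrite linear0 linearD /=.
have uL (x y : F) : x%:A + y *: a i \in L by rewrite memvD ?memvZ ?(kd_1 kd).
have gu (x y : F) : g i (x%:A + y *: a i) = x%:A + y *: a i.
  by rewrite linearD !linearZ /= (kd_g1 kd) (kd_ga kd).
rewrite gM // !gu g_conj // => E3.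
have rs0 : (r%:A + s *: a i) * d j = 0.
  have neg u v : u + v = 0 -> v = - u :> A by move/eqP; rewrite addrC addr_eq0 => /eqP.
  by rewrite /d mulrBr (neg _ _ E2) (neg _ _ E3) subrr.
have [r0 s0] := indep1 _ _ _ (gap_regr rs0).
move: E2; rewrite r0 s0 !scale0r addr0 mul0r addr0 => /indep1[-> ->].
by [].
Qed.

Definition twisted (h : A -> A) (x : A) : Prop := forall y, y \in L -> y * x = x * h y.

Lemma twistedD h x y : twisted h x -> twisted h y -> twisted h (x + y).
Proof. by move=> xh yh z zL; rewrite mulrDr mulrDl xh ?yh. Qed.

Lemma twistedN h x : twisted h x -> twisted h (- x).
Proof. by move=> xh z zL; rewrite mulrN mulNr xh. Qed.

Lemma twisted_Ll h x y : y \in L -> twisted h x -> twisted h (y * x).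
Proof. by move=> yL xh z zL; rewrite mulrA [z * y]LC // -mulrA xh // mulrA. Qed.

Definition gal (o : option 'I_3) : 'End(A) := if o is Some i then g i else \1%VF.

Lemma gal_L o y : y \in L -> gal o y \in L.
Proof. by case: o => [i|] yL /=; rewrite ?id_lfunE // (kd_gL kd). Qed.

Lemma gal_M o x y : x \in L -> y \in L -> gal o (x * y) = gal o x * gal o y.
Proof. by case: o => [i|] xL yL /=; rewrite ?id_lfunE // gM. Qed.

Lemma gal_1 o : gal o 1 = 1.
Proof. by case: o => [i|] /=; rewrite ?id_lfunE // (kd_g1 kd). Qed.

Lemma gal_K o y : y \in L -> gal o (gal o y) = y.
Proof. by case: o => [i|] yL /=; rewrite ?id_lfunE // (kd_gK kd). Qed.

Lemma gal_gen o i : gal o (a i) = a i \/ gal o (a i) = c i.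
Proof.
case: o => [j|] /=; last by rewrite id_lfunE; left.
by have [->|ji] := eqVneq j i; [left; apply: (kd_ga kd)|right; apply: g_conj].
Qed.

Lemma twisted_gen o i j x : i != j -> a i * x = x * gal o (a i) ->
  a j * x = x * gal o (a j) -> twisted (gal o) x.
Proof.
move=> ij xi xj y yL; have [p [q [r [s ->]]]] := kd_decomp ij yL.
rewrite !linearD !linearZ /= gal_1 gal_M // !mulrDl !mulrDr -!scalerAl -!scalerAr.
by rewrite mul1r mulr1 xi xj -mulrA xi mulrA xj mulrA.
Qed.

(** [k] is the root of the polynomial of [a i] other than its image under the
    automorphism: this makes [a i * x - x * k] twisted by it. *)
Lemma twist_gen_step o i x (k := a i + c i - gal o (a i)) (n := a i * x - x * k) :
  a i * n = n * gal o (a i).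
Proof.
have [t [nu [e [tE nE _ _]]]] := quad_rel i.
have kE : k = c i /\ gal o (a i) = a i \/ k = a i /\ gal o (a i) = c i.
  rewrite /k; case: (gal_gen o i) => ->; [left|right]; split=> //.
    by rewrite addrC addrA addNr add0r.
  by rewrite addrK.
have kg : k * gal o (a i) = nu%:A by case: kE => -[-> ->]; rewrite // LC ?conjL.
have kt : k = t%:A - gal o (a i) by rewrite /k tE.
have aa : a i * a i = t *: a i - nu%:A.
  have -> : t *: a i = a i * (a i + c i) by rewrite tE mulr_algr.
  by rewrite mulrDr nE addrK.
have L1 : a i * a i * x = t *: (a i * x) - nu *: x.
  by rewrite aa mulrBl -scalerAl mulr_algl.
have L2 : a i * x * k = t *: (a i * x) - a i * x * gal o (a i).
  by rewrite {1}kt mulrBr mulr_algr.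
rewrite /n mulrBr mulrBl -[x * k * _]mulrA kg mulr_algr !mulrA L1 L2.
by rewrite opprB addrC addrA subrK.
Qed.

(** Applying the polynomial [(a i - ki) (a j - kj)] to the commuting left and right actions
    of [L] kills the components of [x] in all but one [A_g]. *)
Definition twist_sum o i j x : A :=
  let ki := a i + c i - gal o (a i) in
  let kj := a j + c j - gal o (a j) in
  a j * (a i * x - x * ki) - (a i * x - x * ki) * kj.

Lemma conj_genL o i : a i + c i - gal o (a i) \in L.
Proof. by rewrite memvB ?memvD ?conjL ?gal_L. Qed.

Lemma twist_sum_twisted o i j x : i != j -> twisted (gal o) (twist_sum o i j x).
Proof.
move=> ij; apply: (twisted_gen ij); last exact: twist_gen_step.
rewrite /twist_sum; set ki := a i + _ - _; set kj := a j + _ - _.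
set n := a i * x - x * ki; have nE : a i * n = n * gal o (a i).
  exact: twist_gen_step.
clearbody n; rewrite mulrBr mulrBl !mulrA [a i * a j]LC // -[a j * a i * n]mulrA nE mulrA.
by rewrite -[n * kj * _]mulrA [kj * _]LC ?gal_L ?conj_genL // mulrA.
Qed.

Lemma twist_sumE o i j x : twist_sum o i j x =
  a j * a i * x - a j * x * (a i + c i - gal o (a i))
  - a i * x * (a j + c j - gal o (a j))
  + x * ((a i + c i - gal o (a i)) * (a j + c j - gal o (a j))).
Proof.
rewrite /twist_sum; set ki := a i + _ - _; set kj := a j + _ - _.
rewrite mulrBr mulrBl opprB !mulrA.
by rewrite [x * ki * kj - _]addrC addrA.
Qed.

Lemma gap_inv i : exists2 u, u \in L & u * d i = 1 /\ d i * u = 1.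
Proof.
have [t [n [e [_ _ de e0]]]] := quad_rel i.
exists (e^-1 *: d i); first by rewrite memvZ ?gapL.
by rewrite -scalerAl -scalerAr de scalerA mulVf // scale1r.
Qed.

(** The four elements [twist_sum o i j x] are, up to units of [L], the components of [x]. *)
Lemma twisted_decomp i j k x : i != j -> j != k -> i != k ->
  exists x0 xi xj xk, [/\ twisted (gal None) x0, twisted (gal (Some i)) xi,
    twisted (gal (Some j)) xj, twisted (gal (Some k)) xk & x = x0 + xi + xj + xk].
Proof.
move=> ij jk ik; have [u uL [ud _]] := gap_inv i; have [v vL [vd _]] := gap_inv j.
pose y := x * v * u; pose S o := twist_sum o i j y.
exists (S None), (- S (Some i)), (- S (Some j)), (S (Some k)).
split; try exact: twist_sum_twisted; try (apply: twistedN; exact: twist_sum_twisted).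
pose np := a i * y - y * c i; pose nm := a i * y - y * a i.
have kc l : a l + c l - a l = c l by rewrite addrC addrA addNr add0r.
have ka l : a l + c l - c l = a l by rewrite addrK.
have S0 : S None = a j * np - np * c j.
  by rewrite /S /twist_sum /= !id_lfunE !kc.
have Si : S (Some i) = a j * np - np * a j.
  by rewrite /S /twist_sum /= (kd_ga kd) g_conj // kc ka.
have Sj : S (Some j) = a j * nm - nm * c j.
  by rewrite /S /twist_sum /= (kd_ga kd) g_conj ?ka ?kc // eq_sym.
have Sk : S (Some k) = a j * nm - nm * a j.
  by rewrite /S /twist_sum /= !g_conj ?ka // eq_sym.
have dif n : a j * n - n * c j - (a j * n - n * a j) = n * d j.
  by rewrite opprB addrC addrA subrK -mulrBr.
rewrite S0 Si Sj Sk dif -addrA (addrC (- (a j * nm - nm * c j))).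
rewrite -[X in _ + X]opprB dif -mulrBl.
have -> : np - nm = y * d i.
  by rewrite /np /nm opprB addrC addrA subrK -mulrBr.
by rewrite /y -!mulrA [u * _]mulrA ud mul1r vd mulr1.
Qed.

(** The [A_g] are the joint eigenspaces of the two generators: [a i] separates two pairs of
    them and [a j] the members of each pair. *)
Lemma twisted_unique i j k x0 xi xj xk : i != j -> j != k -> i != k ->
  twisted (gal None) x0 -> twisted (gal (Some i)) xi ->
  twisted (gal (Some j)) xj -> twisted (gal (Some k)) xk ->
  x0 + xi + xj + xk = 0 -> [/\ x0 = 0, xi = 0, xj = 0 & xk = 0].
Proof.
move=> ij jk ik t0 ti tj tk E.
have ji : j != i by rewrite eq_sym. have ki : k != i by rewrite eq_sym.
have kj : k != j by rewrite eq_sym.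
have a0 l : a l * x0 = x0 * a l by rewrite t0 //= id_lfunE.
have aii : a i * xi = xi * a i by rewrite ti //= (kd_ga kd).
have aij : a i * xj = xj * c i by rewrite tj //= g_conj.
have aik : a i * xk = xk * c i by rewrite tk //= g_conj.
have ajj : a j * xj = xj * a j by rewrite tj //= (kd_ga kd).
have aji : a j * xi = xi * c j by rewrite ti //= g_conj.
have ajk : a j * xk = xk * c j by rewrite tk //= g_conj.
have split2 l u v : a l * u = u * a l -> a l * v = v * c l -> u + v = 0 ->
    u = 0 /\ v = 0.
  move=> au av uv; have u0 : u = 0.
    apply: (@gap_regr l); rewrite /d mulrBr -au.
    have -> : u = - v by apply/eqP; rewrite -addr_eq0 uv.
    by rewrite mulrN av mulNr subrr.
  by move: uv; rewrite u0 add0r.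
have [] := split2 i (x0 + xi) (xj + xk) _ _ _; rewrite ?mulrDr ?mulrDl ?a0 ?aii
  ?aij ?aik // ?addrA //.
move=> e1 e2; have [-> ->] := split2 j _ _ (a0 j) aji e1.
by have [-> ->] := split2 j _ _ ajj ajk e2.
Qed.

Lemma twisted_sigma o x : twisted (gal o) x -> twisted (gal o) (sigma x).
Proof.
move=> xo y yL; have oyL := gal_L o yL.
have xy : x * y = gal o y * x by rewrite xo // gal_K.
by rewrite -{1}(kd_s kd yL) -sM xy sM (kd_s kd oyL).
Qed.

Lemma symd_sigma x : x \in symd sigma -> sigma x = x.
Proof. by move=> /symdP[y ->]; rewrite linearD /= sK addrC. Qed.

Lemma symdI x : x + sigma x \in symd sigma.
Proof. by apply/symdP; exists x. Qed.

Lemma symd_sandwich x u : u \in symd sigma -> sigma x = x -> x * u * x \in symd sigma.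
Proof.
move=> /symdP[y ->] sx; apply/symdP; exists (x * y * x).
by rewrite !sM sx mulrDr mulrDl mulrA.
Qed.

Definition W i x := x \in symd sigma /\ twisted (gal (Some i)) x.

Hypothesis one_symd : 1 \in symd sigma.

Lemma third_index (i j : 'I_3) : i != j -> exists k : 'I_3, j != k /\ i != k.
Proof.
case: i j => -[|[|[|//]]] p [[|[|[|//]]] q] // _;
  by [exists 0 | exists 1 | exists 2%:R].
Qed.

Lemma other_indices (i : 'I_3) : exists j k : 'I_3, [/\ i != j, j != k & i != k].
Proof.
exists (ordS i), (ordS (ordS i)); split; last by case: i => -[|[|[|]]].
  exact: ordS_neq.
exact: ordS_neq.
Qed.

(** The component in the centraliser of an element [x] with [x + sigma x = 1]. *)
Lemma trace_one : exists b, twisted (gal None) b /\ b + sigma b = 1.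
Proof.
have [j [k [ij jk ik]]] := other_indices 0.
have /symdP[x xE] := one_symd.
have [x0 [xi [xj [xk [t0 ti tj tk e]]]]] := twisted_decomp x ij jk ik.
exists x0; split=> //; apply/eqP; rewrite -subr_eq0; apply/eqP.
have t1 : twisted (gal None) (-1).
  by move=> y yL; rewrite mulrN mulNr mulr1 mul1r /= id_lfunE.
have E : x0 + sigma x0 + (xi + sigma xi) + (xj + sigma xj) + (xk + sigma xk) = 1.
  by rewrite [RHS]xE e !linearD /= [RHS](AC (4*4) ((1*5)*(2*6)*(3*7)*(4*8))).
have ts o y : twisted (gal o) y -> twisted (gal o) (y + sigma y).
  by move=> yo; apply: twistedD => //; apply: twisted_sigma.
have [] := @twisted_unique _ _ _ (x0 + sigma x0 - 1) (xi + sigma xi)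
  (xj + sigma xj) (xk + sigma xk) ij jk ik _ (ts _ _ ti) (ts _ _ tj) (ts _ _ tk).
- by apply: twistedD => //; apply: ts.
- by rewrite !(addrAC _ (-1)) E subrr.
by [].
Qed.

Lemma L_symd y : y \in L -> y \in symd sigma.
Proof.
move=> yL; have [b [tb b1]] := trace_one; apply/symdP; exists (y * b).
rewrite sM (kd_s kd yL) -[LHS]mulr1 -b1 mulrDr; congr (_ + _).
by rewrite (twisted_sigma tb) //= id_lfunE.
Qed.

Lemma symd_decomp i j k x : i != j -> j != k -> i != k -> x \in symd sigma ->
  exists x0 xi xj xk, [/\ x0 \in symd sigma /\ twisted (gal None) x0,
    W i xi, W j xj, W k xk & x = x0 + xi + xj + xk].
Proof.
move=> ij jk ik /symdP[y ->].
have [x0 [xi [xj [xk [t0 ti tj tk e]]]]] := twisted_decomp y ij jk ik.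
have ts o z : twisted (gal o) z -> z + sigma z \in symd sigma /\
    twisted (gal o) (z + sigma z).
  by move=> yo; split; [exact: symdI | apply: twistedD => //; apply: twisted_sigma].
exists (x0 + sigma x0), (xi + sigma xi), (xj + sigma xj), (xk + sigma xk).
split; try exact: ts.
by rewrite e !linearD /= [LHS](AC (4*4) ((1*5)*(2*6)*(3*7)*(4*8))).
Qed.

Hypothesis symd_centralizer : forall x, x \in symd sigma -> twisted (gal None) x ->
  x \in L.

(** [x^2] is symmetrised, being [x 1 x], and centralises [L].  Writing [u = x^2],
    associativity of [x u = u x] gives [x (u - g_i u) = 0], and [L] is reduced. *)
Lemma W_square i x : W i x -> x * x \in L /\ g i (x * x) = x * x.
Proof.
move=> [xS xt]; have sx := symd_sigma xS.
have xx : x * x \in L.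
  apply: symd_centralizer.
    by have := symd_sandwich one_symd sx; rewrite mulr1.
  move=> y yL; rewrite mulrA (xt y yL) -mulrA (xt _ (gal_L _ yL)) /=.
  by rewrite (kd_gK kd) // id_lfunE mulrA.
split=> //; set u := x * x; apply/eqP; rewrite eq_sym -subr_eq0; apply/eqP.
have gu := kd_gL kd i xx.
have xu : x * (u - g i u) = 0.
  by rewrite mulrBr -[x * g i u](xt _ xx) /u mulrA subrr.
have uu : u * (u - g i u) = 0 by rewrite /u -mulrA xu mulr0.
apply: (kd_red kd); first by rewrite memvB.
have gu0 : g i u * (g i u - u) = 0.
  have := congr1 (g i) uu; rewrite gM ?memvB // linear0 linearB /=.
  by rewrite (kd_gK kd).
rewrite mulrBl uu sub0r -[X in _ * X]opprB mulrN opprK; exact: gu0.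
Qed.

Lemma WD i x y : W i x -> W i y -> W i (x + y).
Proof. by move=> [? ?] [? ?]; split; [rewrite memvD | apply: twistedD]. Qed.

Lemma W_polar i x y : W i x -> W i y ->
  x * y + y * x \in L /\ g i (x * y + y * x) = x * y + y * x.
Proof.
move=> xW yW; have [xx gx] := W_square xW; have [yy gy] := W_square yW.
have [zz gz] := W_square (WD xW yW).
have -> : x * y + y * x = (x + y) * (x + y) - x * x - y * y.
  rewrite mulrDl !mulrDr addrA [X in _ = X]addrAC addrK -(addrA (x * x)).
  by rewrite [X in _ = X]addrC addKr.
by rewrite !memvB // !linearB /= gx gy gz.
Qed.

Lemma W_trace i x : twisted (gal (Some i)) x -> W i (x + sigma x).
Proof.
by move=> xt; split; [exact: symdI | apply: twistedD => //; apply: twisted_sigma].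
Qed.

Lemma W_mul i j k x y : i != j -> j != k -> i != k -> W i x -> W j y ->
  W k (x * y + y * x).
Proof.
move=> ij jk ik [xS xt] [yS yt].
have sx := symd_sigma xS; have sy := symd_sigma yS.
have ji : j != i by rewrite eq_sym.
split; first by rewrite -{2}sx -{2}sy -sM; exact: symdI.
apply: twistedD => z zL; rewrite mulrA.
  by rewrite (xt z zL) -mulrA (yt _ (gal_L _ zL)) /= (kd_gg kd ji ik jk) // mulrA.
by rewrite (yt z zL) -mulrA (xt _ (gal_L _ zL)) /= (kd_gg kd ij jk ik) // mulrA.
Qed.

(** The twists by the two factors [y] cancel. *)
Lemma W_sandwich i j x y : i != j -> W i x -> W j y -> W i (y * x * y).
Proof.
move=> ij [xS xt] [yS yt]; have [k [jk ik]] := third_index ij.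
have ji : j != i by rewrite eq_sym. have kj : k != j by rewrite eq_sym.
have ki : k != i by rewrite eq_sym.
split; first by apply: symd_sandwich; rewrite // (symd_sigma yS).
move=> z zL; have gz := kd_gL kd j zL; have gz' := kd_gL kd k zL.
rewrite !mulrA (yt z zL) -[y * _ * x]mulrA (xt _ gz) /= (kd_gg kd ij jk ik) //.
by rewrite -!mulrA (yt _ gz') /= (kd_gg kd jk ki ji).
Qed.

End Klein.

(** * The squares of the elements of the [W_i] *)

Section KleinForms.

Variables (F : fieldType) (A : falgType F) (sigma : 'End(A)) (L : {vspace A}).
Variables (g : 'I_3 -> 'End(A)) (a : 'I_3 -> A).
Hypothesis kd : klein_data sigma L g a.
Hypothesis one_symd : 1 \in symd sigma.

Let sM := kd_sM kd.
Let sK := kd_sK kd.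
Let LM := kd_M kd.
Let LC := kd_C kd.
Let aL := kd_aL kd.
Let gM := kd_gM kd.
Local Notation c := (conj_gen g a).
Local Notation d := (gap g a).
Local Notation twisted := (twisted L).
Local Notation gal := (gal g).
Local Notation W := (W sigma L g).

Section Values.

Hypothesis symd_centralizer : forall x, x \in symd sigma -> twisted (gal None) x ->
  x \in L.
Variable s : 'I_3 -> A -> F.
Hypothesis sE : forall i p q, s i (p%:A + q *: a i) = q.

Lemma s_eq0 i x : x \in L -> g i x = x -> s i x = 0 -> x \in 1%VS.
Proof.
move=> xL gx; have [p [q ->]] := kd_gen kd xL gx; rewrite sE => ->.
by rewrite scale0r addr0 memvZ // memv_line.
Qed.

(** Invariance of this element under [g i] would make the product of two gaps vanish. *)
Lemma mixed_gen_neq0 i j (p : F) : i != j ->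
  c j * a i + c i * a j <> p%:A.
Proof.
move=> ij B; have ji : j != i by rewrite eq_sym.
have gB : g i (c j * a i + c i * a j) = c j * a i + c i * a j.
  by rewrite B linearZ /= (kd_g1 kd).
move: gB; rewrite linearD /= !gM ?(conjL kd) //.
rewrite (g_conjK kd ij) (kd_ga kd) (g_conj_fix kd) (g_conj kd ij) => gB.
have dd : d j * d i = 0.
  rewrite /gap mulrBl !mulrBr opprB (LC (aL j) (conjL kd i)).
  rewrite (LC (conjL kd j) (conjL kd i)) addrACA -opprD gB.
  by rewrite [X in _ - X]addrC subrr.
have d1 : d i * 1 = 0 by rewrite (gap_regl kd dd) mul0r.
by have /eqP := gap_regl kd d1; rewrite oner_eq0.
Qed.

(** With [x ^ 2 = u] and [y ^ 2 = v], the square of [x y + y x] is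
    [g_i v u + g_j u v] plus a term [x y x y + y x y x] fixed by both [g_i] and
    [g_j], hence scalar. *)
Lemma W_composition i j k : i != j -> j != k -> i != k ->
  exists2 e : F, e != 0 & forall x y, W i x -> W j y ->
    s k ((x * y + y * x) * (x * y + y * x)) = e * (s i (x * x) * s j (y * y)).
Proof.
move=> ij jk ik; have ji : j != i by rewrite eq_sym.
have ki : k != i by rewrite eq_sym. have kj : k != j by rewrite eq_sym.
(* [B] is the part of [g_i(y^2) x^2 + g_j(x^2) y^2] in which both squares contribute
   their nonscalar terms, and [e] is its coefficient at [a k]. *)
pose B := c j * a i + c i * a j.
have BL : B \in L by rewrite memvD ?LM ?(conjL kd).
have gB : g k B = B.
  rewrite linearD /= !gM ?(conjL kd) // (g_conjK kd kj) (g_conjK kd ki).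
  rewrite (g_conj kd ki) (g_conj kd kj) addrC.
  by rewrite (LC (aL i) (conjL kd j)) (LC (aL j) (conjL kd i)).
have [p [e BE]] := kd_gen kd BL gB.
exists e.
  apply/eqP=> e0; apply: (@mixed_gen_neq0 i j p ij).
  by rewrite -/B BE e0 scale0r addr0.
move=> x y xW yW; have [xx gx] := W_square kd one_symd symd_centralizer xW.
have [yy gy] := W_square kd one_symd symd_centralizer yW.
have [u0 [u1 uE]] := kd_gen kd xx gx; have [v0 [v1 vE]] := kd_gen kd yy gy.
rewrite uE vE !sE.
pose T := x * y * x * y + y * x * y * x.
have [TL giT] : T \in L /\ g i T = T.
  have := W_polar kd one_symd symd_centralizer xW (W_sandwich kd ij xW yW).
  by rewrite /T !mulrA.
have [_ gjT] : T \in L /\ g j T = T.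
  have := W_polar kd one_symd symd_centralizer yW (W_sandwich kd ji yW xW).
  by rewrite /T !mulrA addrC.
have /vlineP[T0 TE] := kd_gF kd ij TL giT gjT.
have xyyx : x * y * y * x = g i (y * y) * (x * x).
  by rewrite -[x * y * y]mulrA -[in LHS](kd_gK kd i yy) -(proj2 xW) ?(kd_gL kd) ?mulrA.
have yxxy : y * x * x * y = g j (x * x) * (y * y).
  by rewrite -[y * x * x]mulrA -[in LHS](kd_gK kd j xx) -(proj2 yW) ?(kd_gL kd) ?mulrA.
have sq : (x * y + y * x) * (x * y + y * x) =
    T + (g i (y * y) * (x * x) + g j (x * x) * (y * y)).
  rewrite -xyyx -yxxy /T mulrDl !mulrDr !mulrA.
  by rewrite [LHS](AC (2*2) ((1*4)*(2*3))).
have [ti [_ [_ [tiE _ _ _]]]] := quad_rel kd i.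
have [tj [_ [_ [tjE _ _ _]]]] := quad_rel kd j.
have mixed : g i (y * y) * (x * x) + g j (x * x) * (y * y) =
    (2%:R * (u0 * v0) + u1 * v0 * ti + u0 * v1 * tj)%:A + (u1 * v1) *: B.
  rewrite uE vE !linearD !linearZ /= !(kd_g1 kd) (g_conj kd ij) (g_conj kd ji).
  rewrite !mulrDl !mulrDr -!scalerAl -!scalerAr !mul1r !mulr1 !scalerA.
  rewrite !scalerDl -!scalerA -tiE -tjE !scalerDr.
  have sw (k' l : F) z : k' *: (l *: z) = l *: (k' *: z) :> A.
    by rewrite !scalerA mulrC.
  rewrite (sw v0 u0) (sw v0 u1) (sw v1 u0) (sw v1 u1).
  by rewrite [LHS](AC ((2*2)*(2*2)) ((1*5)*(2*7)*(6*3)*(4*8))).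
rewrite sq mixed BE TE scalerDr !scalerA addrA addrA -!scalerDl sE.
by rewrite mulrC.
Qed.

(** If [x] is orthogonal to [W_i], then [x y + y x] is a scalar for every [y] in [W_i], and
    replacing [y] by [a_i y] shows that it is zero.  With [y = b + sigma b] this says that
    the symmetrisations of [x b] and [b x] are opposite; replacing [b] by [a_j b] multiplies
    one by [a_j] and the other by its conjugate, so both vanish. *)
Lemma W_form_nondegenerate i x :
  (forall y, W i y -> (forall b, twisted (gal (Some i)) b -> b * y + sigma (b * y) = 0)
     -> y = 0) ->
  W i x -> (forall y, W i y -> s i (x * y + y * x) = 0) -> x = 0.
Proof.
move=> nd xW x0; have [j [k [ij jk ik]]] := other_indices i.
have ji : j != i by rewrite eq_sym.
have sx := symd_sigma kd (proj1 xW); have [xS xt] := xW.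
have pol y : W i y -> exists w : F, x * y + y * x = w%:A.
  move=> yW; have [wL gw] := W_polar kd one_symd symd_centralizer xW yW.
  exact/vlineP/(s_eq0 wL gw)/x0.
have aiC z : twisted (gal (Some i)) z -> a i * z = z * a i.
  by move=> zt; rewrite (zt _ (aL i)) /= (kd_ga kd).
have pol0 b : twisted (gal (Some i)) b -> x * (b + sigma b) + (b + sigma b) * x = 0.
  move=> bt; have st := twisted_sigma kd bt.
  have [w wE] := pol _ (W_trace kd bt).
  have bt' := twisted_Ll kd (aL i) bt; have [w' w'E] := pol _ (W_trace kd bt').
  have E : w *: a i = w'%:A.
    rewrite -w'E sM (kd_s kd (aL i)) -(aiC _ st) -mulrDr.
    by rewrite mulrA -(aiC _ xt) -!mulrA -mulrDr wE mulr_algr.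
  have w0 : w = 0.
    apply/eqP/negPn/negP => w0; case/negP: (kd_aF kd i); apply/vlineP.
    by exists (w^-1 * w'); rewrite -scalerA -E scalerA mulVf ?scale1r.
  by rewrite wE w0 scale0r.
apply: nd => // b bt; have st := twisted_sigma kd bt.
pose X := x * b + sigma (x * b); pose Y := b * x + sigma (b * x).
have XY b' : twisted (gal (Some i)) b' ->
    x * b' + sigma (x * b') + (b' * x + sigma (b' * x)) = 0.
  move=> bt'; rewrite -[RHS](pol0 b') // !sM sx mulrDr mulrDl.
  by rewrite [LHS](AC (2*2) ((1*4)*(3*2))).
have E1 : X + Y = 0 := XY b bt.
have E2 : c j * X + a j * Y = 0.
  rewrite -[RHS](XY _ (twisted_Ll kd (aL j) bt)) /X /Y !mulrDr.
  have xa : x * (a j * b) = c j * (x * b).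
    by rewrite !mulrA (xt _ (conjL kd j)) /= (g_conjK kd ij).
  have sxb z : twisted (gal None) z -> sigma (c j * z) = c j * sigma z.
    move=> zt; rewrite sM (kd_s kd (conjL kd j)).
    by rewrite (twisted_sigma kd zt) ?(conjL kd) //= id_lfunE.
  have sxa z : twisted (gal None) z -> sigma (a j * z) = a j * sigma z.
    move=> zt; rewrite sM (kd_s kd (aL j)).
    by rewrite (twisted_sigma kd zt) ?aL //= id_lfunE.
  have tw u v : twisted (gal (Some i)) u -> twisted (gal (Some i)) v ->
      twisted (gal None) (u * v).
    move=> ut vt z zL; rewrite mulrA (ut _ zL) -mulrA (vt _ (gal_L kd _ zL)) /=.
    by rewrite (kd_gK kd) // id_lfunE mulrA.
  rewrite xa (sxb _ (tw _ _ xt bt)) -[a j * b * x]mulrA.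
  by rewrite (sxa _ (tw _ _ bt xt)).
apply: (gap_regl kd (i := j)); rewrite -/Y /gap mulrBl.
move: E2; have -> : X = - Y by apply/eqP; rewrite -addr_eq0 E1.
by rewrite mulrN addrC.
Qed.

End Values.

Section Sandwich.

Hypothesis meet : ideals_meet_center A.
Hypothesis center_indep : forall i j (z : 'I_4 -> A), i != j ->
  (forall n, z n \in 'Z({:A})%VS) ->
  z 0 + a i * z 1 + a j * z 2%:R + a j * a i * z 3%:R = 0 -> forall n, z n = 0.

(** The projector onto [A_g] is a sandwich map whose left factors are a basis of [L]. *)
Lemma twisted_annihilator o x : (forall b, twisted (gal o) b -> b * x = 0) -> x = 0.
Proof.
move=> bx0; have [j [_ [ij _ _]]] := other_indices 0.
set i : 'I_3 := 0 in ij.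
pose ki := a i + c i - gal o (a i); pose kj := a j + c j - gal o (a j).
(* The left and right factors of [twist_sum o i j b * x] as a function of [b]. *)
pose l (n : 'I_4) := tnth [tuple 1; a i; a j; a j * a i] n.
pose y (n : 'I_4) := tnth [tuple ki * kj * x; - (kj * x); - (ki * x); x] n.
have sum4 (G : 'I_4 -> A) : \sum_n G n = G 0 + G 1 + G 2%:R + G 3%:R.
  rewrite !big_ord_recl big_ord0 addr0 !addrA.
  by congr (_ + G _ + G _ + G _); apply: val_inj.
suff : forall n, y n = 0 by move/(_ 3%:R).
apply: (sandwich_independent (l := l) meet) => [z zZ|b].
  by rewrite sum4 /l /tnth /= mul1r => E; apply: (center_indep ij zZ E).
rewrite sum4 /l /y /tnth /= mul1r -[RHS](bx0 _ (twist_sum_twisted kd o b ij)).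
rewrite twist_sumE -/ki -/kj; move: (ki) (kj) => k1 k2.
rewrite !mulrDl !mulNr !mulrN !mulrA.
by rewrite [LHS](AC (4) (4*3*2*1)).
Qed.

(** If all symmetrisations from [A_(gamma_i)] vanished, then [a_j b] and [b] would both be
    skew, so [b (a_j - g_i a_j) = 0] for all [b] in [A_(gamma_i)]. *)
Lemma W_neq0 i : exists2 x, W i x & x != 0.
Proof.
apply: NNPP => no; have [j [k [ij _ _]]] := other_indices i.
suff : 1 = 0 :> A by apply/eqP/oner_neq0.
apply: (@twisted_annihilator (Some i)) => b bt.
have W0 b' : twisted (gal (Some i)) b' -> b' + sigma b' = 0.
  move=> bt'; apply/eqP/negPn/negP => n0; apply: no.
  by exists (b' + sigma b') => //; apply: (W_trace kd).
rewrite mulr1; apply: (gap_regl kd (i := j)); rewrite /gap mulrBl.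
have := W0 _ (twisted_Ll kd (aL j) bt); rewrite sM (kd_s kd (aL j)).
have -> : sigma b = - b by apply/eqP; rewrite -addr_eq0 addrC W0.
by rewrite mulNr (bt _ (conjL kd j)) /= (g_conjK kd ij).
Qed.

(** If the involution moves a central element [z], a right ideal of skew elements
    closed under [z] vanishes. *)
Lemma nondegenerate_unitary i x z : z \in 'Z({:A})%VS ->
  (forall y, (z - sigma z) * y = 0 -> y = 0) ->
  (forall b, twisted (gal (Some i)) b -> b * x + sigma (b * x) = 0) -> x = 0.
Proof.
move=> zZ zreg bx; apply: (@twisted_annihilator (Some i)) => b bt.
apply: zreg; have zC := centerP _ zZ.
have szC y : sigma z * y = y * sigma z.
  by rewrite -[y]sK -!sM zC.
have zbt : twisted (gal (Some i)) (z * b).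
  by move=> y yL; rewrite mulrA -zC -mulrA bt // mulrA.
have := bx _ zbt; rewrite -mulrA sM -szC.
have -> : sigma (b * x) = - (b * x) by apply/eqP; rewrite -addr_eq0 addrC bx.
by rewrite mulrN -mulNr -mulrDl.
Qed.

Section Char2.

Hypothesis two0 : 2%:R = 0 :> F.
Hypothesis center_scalar : 'Z({:A})%VS = 1%VS.

(** Right multiplications by [w = b x] reverse products in the centraliser; with
    [beta + sigma beta = 1], commutators [beta v - v beta] annihilate [w], although
    [L] and [beta L] are independent. *)
Lemma nondegenerate_char2 i x :
  (forall b, twisted (gal (Some i)) b -> b * x + sigma (b * x) = 0) -> x = 0.
Proof.
move=> bx; apply: (@twisted_annihilator (Some i)) => b bt.
have [beta [betat beta1]] := trace_one kd one_symd.
set w := b * x.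
have tw u : twisted (gal None) u -> twisted (gal (Some i)) (u * b).
  move=> ut y yL; rewrite mulrA (ut _ yL) -mulrA (bt _ (gal_L kd _ yL)) /=.
  by rewrite id_lfunE mulrA.
have skew u : twisted (gal None) u -> sigma (u * w) = - (u * w).
  by move=> ut; apply/eqP; rewrite -addr_eq0 addrC mulrA (bx _ (tw _ ut)).
have t1 : twisted (gal None) 1 by move=> y yL; rewrite mulr1 mul1r /= id_lfunE.
have sw : sigma w = - w by rewrite -[w]mul1r (skew _ t1).
have wu u : twisted (gal None) u -> u * w = w * sigma u.
  by move=> ut; apply: oppr_inj; rewrite -(skew _ ut) sM sw mulNr.
have tt u v : twisted (gal None) u -> twisted (gal None) v ->
    twisted (gal None) (u * v).
  move=> ut vt y yL; rewrite mulrA (ut _ yL) -mulrA (vt _ (gal_L kd _ yL)) /=.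
  by rewrite !id_lfunE mulrA.
have com v : twisted (gal None) v -> beta * v * w = v * beta * w.
  move=> vt; rewrite (wu _ (tt _ _ betat vt)) sM mulrA -(wu _ vt).
  by rewrite -[v * beta * w]mulrA (wu _ betat) mulrA.
have two0A y : y + y = 0 :> A by rewrite -mulr2n -scaler_nat two0 scale0r.
have betaL y y' : y \in L -> y' \in L -> y + beta * y' = 0 -> y = 0 /\ y' = 0.
  move=> yL y'L E; have := congr1 sigma E.
  rewrite linear0 linearD /= sM (kd_s kd yL) (kd_s kd y'L) => E'.
  have y'0 : y' = 0.
    have := congr2 (fun p q => p + q) E E'; rewrite addr0 => <-.
    rewrite (twisted_sigma kd betat) //= id_lfunE addrACA two0A add0r -mulrDl.
    by rewrite beta1 mul1r.
  by move: E; rewrite y'0 mulr0 addr0.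
have [j [_ [ij _ _]]] := other_indices 0.
set i0 : 'I_3 := 0 in ij.
pose ki := a i0 + c i0 - a i0; pose kj := a j + c j - a j.
(* The relation [beta v w = v beta w] at the component [v] in the centraliser of an
   arbitrary element is a sandwich relation with eight terms. *)
pose l (n : 'I_8) := tnth [tuple 1; a i0; a j; a j * a i0;
  beta * 1; beta * a i0; beta * a j; beta * (a j * a i0)] n.
pose y (n : 'I_8) := tnth [tuple - (ki * kj * beta * w); kj * beta * w;
   ki * beta * w; - (beta * w); ki * kj * w; - (kj * w); - (ki * w); w] n.
have sum8 (G : 'I_8 -> A) : \sum_n G n = G 0 + G 1 + G 2%:R + G 3%:R
    + G 4%:R + G 5%:R + G 6%:R + G 7%:R.
  rewrite !big_ord_recl big_ord0 addr0 !addrA.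
  by congr (_ + G _ + G _ + G _ + G _ + G _ + G _ + G _); apply: val_inj.
suff : forall n, y n = 0 by move/(_ 7%:R).
apply: (sandwich_independent (l := l) meet) => [z zZ|v].
  have [k kE] : exists k : 'I_8 -> F, forall n, z n = (k n)%:A.
    apply: (@fin_all_exists _ (fun _ => F) (fun n k => z n = k%:A)) => n.
    by apply/vlineP; rewrite -center_scalar.
  pose U (p q r t : F) := p%:A + q *: a i0 + r *: a j + t *: (a j * a i0).
  have UL p q r t : U p q r t \in L.
    by rewrite !memvD // memvZ ?LM ?(kd_1 kd).
  rewrite sum8 /l /tnth /= !kE !mulr_algr => E.
  have {E} : U (k 0) (k 1) (k 2%:R) (k 3%:R)
      + beta * U (k 4%:R) (k 5%:R) (k 6%:R) (k 7%:R) = 0.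
    by rewrite -[RHS]E /U !mulrDr -!scalerAr !addrA.
  case/(betaL _ _ (UL _ _ _ _) (UL _ _ _ _)).
  move=> /(kd_indep kd ij)[k0 k1 k2 k3] /(kd_indep kd ij)[k4 k5 k6 k7] n.
  apply/eqP; rewrite kE scaler_eq0 oner_eq0 orbF; apply/eqP.
  by case: n => -[|[|[|[|[|[|[|[|//]]]]]]]] p;
    [rewrite -[RHS]k0|rewrite -[RHS]k1|rewrite -[RHS]k2|rewrite -[RHS]k3
    |rewrite -[RHS]k4|rewrite -[RHS]k5|rewrite -[RHS]k6|rewrite -[RHS]k7];
    congr (k _); apply: val_inj.
have := com _ (twist_sum_twisted kd None v ij).
rewrite twist_sumE /= !id_lfunE -/ki -/kj => /eqP; rewrite -subr_eq0 => /eqP E.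
rewrite sum8 -[RHS]E /l /y /tnth /=; move: (ki) (kj) => k1 k2.
rewrite !mulrDr !mulrDl !mulrN !mulNr !mulrA mul1r mulr1 !opprD !opprK.
by rewrite [LHS](AC 8 (8*7*6*5*4*3*2*1)) /= !addrA.
Qed.

End Char2.

(** The trace form pairs [A_g] with [A_h] trivially unless [g h = 1], since [T] vanishes
    on the [A_g] with [g <> 1].  On [A_(gamma_i)] the hypothesis reads [2 T (b x) = 0]. *)
Lemma nondegenerate_trace (K : fieldType) (T : A -> K) i x : 2%:R != 0 :> K ->
  {morph T : y z / y + z} ->
  (forall y z, T (y * z) = T (z * y)) -> (forall y, T (sigma y) = T y) ->
  (forall y, (forall b, T (b * y) = 0) -> y = 0) -> twisted (gal (Some i)) x ->
  (forall b, twisted (gal (Some i)) b -> b * x + sigma (b * x) = 0) -> x = 0.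
Proof.
move=> two0 TD TC Ts Tnd xt bx.
have T0 : T 0 = 0 by apply: (addrI (T 0)); rewrite -TD !addr0.
have TN y : T (- y) = - T y by apply/eqP; rewrite -addr_eq0 -TD addNr T0.
have TB y z : T (y - z) = T y - T z by rewrite TD TN.
have Toff l w : a l * w = w * c l -> T w = 0.
  have off w' : a l * w' = w' * c l -> T (d l * w') = 0.
    by move=> aw; rewrite /gap mulrBl TB aw [T (c l * _)]TC subrr.
  move=> aw; have [u uL [_ du]] := gap_inv kd l.
  rewrite -[w]mul1r -du -mulrA; apply: off.
  by rewrite mulrA (LC (aL l) uL) -!mulrA aw.
apply: Tnd => b; have [j [k [ij jk ik]]] := other_indices i.
have ji : j != i by rewrite eq_sym. have ki : k != i by rewrite eq_sym.
have kj : k != j by rewrite eq_sym.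
have [b0 [bi [bj [bk [t0 ti tj tk ->]]]]] := twisted_decomp kd b ij jk ik.
rewrite !mulrDl !TD.
have -> : T (b0 * x) = 0.
  apply: (@Toff j); rewrite mulrA (t0 _ (aL j)) /= id_lfunE -mulrA (xt _ (aL j)).
  by rewrite /= (g_conj kd ij) mulrA.
have -> : T (bj * x) = 0.
  apply: (@Toff i); rewrite mulrA (tj _ (aL i)) /= (g_conj kd ji) -mulrA.
  by rewrite (xt _ (conjL kd i)) /= (g_conj_fix kd) mulrA.
have -> : T (bk * x) = 0.
  apply: (@Toff i); rewrite mulrA (tk _ (aL i)) /= (g_conj kd ki) -mulrA.
  by rewrite (xt _ (conjL kd i)) /= (g_conj_fix kd) mulrA.
rewrite !addr0 add0r; apply: (mulfI two0); rewrite mulr0 mulr_natl mulr2n.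
by rewrite -{2}Ts -TD bx ?T0.
Qed.

End Sandwich.
End KleinForms.

(** * The Galois group of an etale biquadratic algebra *)

Lemma sq_disc (F : fieldType) (B : falgType F) (g : B) (tau nu : F) :
  g ^+ 2 = tau *: g - nu%:A ->
  (2%:R *: g - tau%:A) * (2%:R *: g - tau%:A) = (tau ^+ 2 - 4%:R * nu)%:A.
Proof.
move=> gg; have -> : 2%:R *: g - tau%:A = (- tau)%:A + 2%:R *: g.
  by rewrite scaleNr addrC.
rewrite (quad_mul gg) [X in _ + X *: g](_ : _ = 0); last by ring.
by rewrite scale0r addr0; congr (_ *: _); ring.
Qed.

Section Etale.

Variables (F : fieldType) (B : falgType F).
Hypothesis etB : etale B.

Lemma etale_embedding : exists (r : nat) (K : 'I_r -> fieldExtType F)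
    (phi : forall i, 'AHom(B, K i)), (forall i, separable 1%VS {:K i}) /\
    (forall x, (forall i, phi i x = 0) -> x = 0).
Proof.
case: etB => r [K [phi [sepK bijK]]]; exists r, K, phi; split=> // x x0.
have [b [_ bu]] := bijK (fun i => 0).
by rewrite -(bu x) // (bu 0) // => i; rewrite raddf0.
Qed.

Lemma etale_reduced (x : B) : x * x = 0 -> x = 0.
Proof.
have [r [K [phi [_ inj]]]] := etale_embedding => xx; apply: inj => i.
by apply/eqP; rewrite -[_ == 0]orbb -mulf_eq0 -rmorphM xx raddf0.
Qed.

(** If the discriminant vanished, [g - tau / 2] would be nilpotent, or in
    characteristic 2 every image of [g] would be purely inseparable. *)
Lemma etale_disc (g : B) (tau nu : F) : g \notin 1%VS ->
  g ^+ 2 = tau *: g - nu%:A -> tau ^+ 2 - 4%:R * nu != 0.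
Proof.
move=> gF gg; apply/eqP=> disc.
have g2 : 2%:R *: g - tau%:A = 0.
  by apply: etale_reduced; rewrite (sq_disc gg) disc scale0r.
have [two0|two0] := eqVneq (2%:R : F) 0; last first.
  case/negP: gF; apply/vlineP; exists (2%:R^-1 * tau).
  move/eqP: g2; rewrite subr_eq0 => /eqP g2.
  by rewrite -scalerA -g2 scalerA mulVf ?scale1r.
have tau0 : tau = 0.
  apply/eqP; rewrite -sqrf_eq0; move/eqP: disc.
  have -> : 4%:R = 2%:R * 2%:R :> F by rewrite -natrM.
  by rewrite two0 !mul0r subr0.
have [r [K [phi [sepK inj]]]] := etale_embedding.
have phiF i : exists k : F, phi i g = k%:A /\ k ^+ 2 = - nu.
  have p2 : 2%N \in [pchar K i].
    rewrite inE /= -(rmorph_nat (in_alg (K i))) two0 rmorph0 eqxx.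
    by [].
  have sq_phi : phi i g ^+ 2 = (- nu)%:A.
    rewrite -rmorphXn gg tau0 scale0r sub0r rmorphN /= linearZ /= rmorph1.
    by rewrite scaleNr.
  have : phi i g \in 1%AS.
    rewrite -separable_inseparable_element; apply/andP; split.
      by have /separableP := sepK i; apply; rewrite memvf.
    apply/purely_inseparable_elementP_pchar; exists 2%N.
      by rewrite pnatE.
    by rewrite sq_phi memvZ // memv_line.
  case/vlineP=> k kE; exists k; split=> //.
  apply: (@fmorph_inj _ _ (in_alg (K i))); rewrite rmorphXn /= -kE sq_phi.
  by [].
case: r K phi sepK inj phiF => [|r] K phi sepK inj phiF.
  by case/negP: gF; rewrite (inj g) ?mem0v // => -[].
have [k [kE k2]] := phiF 0; case/negP: gF; apply/vlineP; exists k.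
apply/eqP; rewrite -subr_eq0; apply/eqP/inj => i.
have [k' [k'E k'2]] := phiF i; rewrite raddfB /= linearZ /= rmorph1 k'E.
rewrite -scalerBl; have -> : k' - k = 0; last by rewrite scale0r.
apply/eqP; rewrite -sqrf_eq0 sqrrB k2 k'2 -mulr_natl two0 mul0r subr0.
by rewrite -mulr2n -mulr_natl two0 mul0r.
Qed.

End Etale.

Lemma sum4 (V : nmodType) (G : 'I_4 -> V) : \sum_n G n = G 0 + G 1 + G 2%:R + G 3%:R.
Proof.
rewrite !big_ord_recl big_ord0 addr0 !addrA.
by congr (_ + G _ + G _ + G _); apply: val_inj.
Qed.

Section Conjugation.

Variables (F : fieldType) (B : falgType F).
Hypothesis mulC : forall x y : B, x * y = y * x.
Variables (al be : B) (t1 n1 t2 n2 : F).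
Hypothesis al2 : al ^+ 2 = t1 *: al - n1%:A.
Hypothesis be2 : be ^+ 2 = t2 *: be - n2%:A.
Hypothesis e_basis : basis_of {:B} [tuple 1; al; be; al * be].

Let e := [tuple 1; al; be; al * be].

Definition lin1 (p q : F) : B := p%:A + q *: al.

Let X x := lin1 (coord e 0 x) (coord e 1 x).
Let Y x := lin1 (coord e 2%:R x) (coord e 3%:R x).

Lemma biquad_span x : exists p q r s, x = lin1 p q + lin1 r s * be.
Proof.
exists (coord e 0 x), (coord e 1 x), (coord e 2%:R x), (coord e 3%:R x).
rewrite {1}(coord_basis e_basis (memvf x)) sum4 /=.
by rewrite /lin1 mulrDl -!scalerAl mul1r !addrA.
Qed.

Let coordE p q r s : X (lin1 p q + lin1 r s * be) = lin1 p q /\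
  Y (lin1 p q + lin1 r s * be) = lin1 r s.
Proof.
have fr := basis_free e_basis.
have := coord_sum_free (fun i : 'I_4 => tnth [tuple p; q; r; s] i) _ fr.
rewrite !big_ord_recl big_ord0 addr0 /tnth /= => H.
have E : lin1 p q + lin1 r s * be = p *: 1 + (q *: al + (r *: be + s *: (al * be))).
  by rewrite /lin1 mulrDl -!scalerAl mul1r !addrA.
by rewrite /X /Y E (H 0) (H 1) (H 2%:R) (H 3%:R).
Qed.

Lemma biquad_inj p q r s p' q' r' s' :
  lin1 p q + lin1 r s * be = lin1 p' q' + lin1 r' s' * be ->
  [/\ p = p', q = q', r = r' & s = s'].
Proof.
have fr := basis_free e_basis.
have C a b c d : [/\ coord e 0 (lin1 a b + lin1 c d * be) = a,
   coord e 1 (lin1 a b + lin1 c d * be) = b,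
   coord e 2%:R (lin1 a b + lin1 c d * be) = c &
   coord e 3%:R (lin1 a b + lin1 c d * be) = d].
  have := coord_sum_free (fun i : 'I_4 => tnth [tuple a; b; c; d] i) _ fr.
  rewrite !big_ord_recl big_ord0 addr0 /tnth /= => H.
  have -> : lin1 a b + lin1 c d * be = a *: 1 + (b *: al + (c *: be + d *: (al * be))).
    by rewrite /lin1 mulrDl -!scalerAl mul1r !addrA.
  by rewrite (H 0) (H 1) (H 2%:R) (H 3%:R).
move=> E; have := C p q r s; rewrite E.
by case: (C p' q' r' s') => -> -> -> -> [-> -> -> ->].
Qed.

Let mul2 (u v u' v' w : B) : w ^+ 2 = t2 *: w - n2%:A ->
  (u + v * w) * (u' + v' * w) =
  (u * u' - n2 *: (v * v')) + (u * v' + v * u' + t2 *: (v * v')) * w.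
Proof.
move=> ww; rewrite mulrDl !mulrDr.
have -> : v * w * u' = v * u' * w by rewrite -!mulrA [w * _]mulC.
have -> : v * w * (v' * w) = t2 *: (v * v') * w - n2 *: (v * v').
  rewrite -!mulrA [w * (_ * _)]mulC -[v' * w * w]mulrA -expr2 ww mulrBr mulrBr.
  by rewrite mulr_algr -scalerAr -!scalerAl -!scalerAr mulrA.
rewrite !mulrDl [u * (v' * w)]mulrA.
by rewrite [LHS](AC (2*(1*2)) ((1*5)*(2*3*4))).
Qed.

(** The conjugation of [B] over [F(al)] that exchanges the two roots of the equation of [be]. *)
Lemma quad_conj : exists h : 'AEnd(B), forall p q r s,
  h (lin1 p q + lin1 r s * be) = lin1 p q + lin1 r s * (t2%:A - be).
Proof.
pose h x := X x + Y x * (t2%:A - be).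
have hE p q r s : h (lin1 p q + lin1 r s * be) = lin1 p q + lin1 r s * (t2%:A - be).
  by rewrite /h; have [-> ->] := coordE p q r s.
have h_lin : linear h.
  have lin1_lin k p q p' q' : lin1 (k * p + p') (k * q + q') =
      k *: lin1 p q + lin1 p' q'.
    by rewrite /lin1 scalerDr !scalerA addrACA -!scalerDl.
  move=> k x y; rewrite /h /X /Y !linearP /= !lin1_lin mulrDl -scalerAl (scalerDr k (lin1 _ _) (_ * _)).
  by rewrite addrACA.
pose hL : {linear B -> B} := HB.pack h (GRing.isLinear.Build F _ _ _ h h_lin).
have be2' : (t2%:A - be) ^+ 2 = t2 *: (t2%:A - be) - n2%:A.
  rewrite expr2 mulrBl !mulrBr !mulr_algl mulr_algr -expr2 be2 scalerBr.
  by congr (_ - _); rewrite opprB addrC subrK.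
have closed p q p' q' : exists a b, lin1 p q * lin1 p' q' = lin1 a b.
  by rewrite /lin1 (quad_mul al2); eexists _, _.
have hM x y : h (x * y) = h x * h y.
  have [p [q [r [s ->]]]] := biquad_span x.
  have [p' [q' [r' [s' ->]]]] := biquad_span y.
  rewrite (mul2 _ _ _ _ be2) !hE (mul2 _ _ _ _ be2').
  have [a1 [b1 ->]] := closed p q p' q'; have [a2 [b2 ->]] := closed r s r' s'.
  have [a3 [b3 ->]] := closed p q r' s'; have [a4 [b4 ->]] := closed r s p' q'.
  have Z k a b : k *: lin1 a b = lin1 (k * a) (k * b).
    by rewrite /lin1 scalerDr !scalerA.
  have D a b a' b' : lin1 a b + lin1 a' b' = lin1 (a + a') (b + b').
    by rewrite /lin1 addrACA -!scalerDl.
  have N a b : - lin1 a b = lin1 (- a) (- b).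
    by rewrite /lin1 opprD !scaleNr.
  by rewrite !(Z, N, D) hE.
have h1 : h 1 = 1.
  have -> : 1 = lin1 1 0 + lin1 0 0 * be :> B.
    by rewrite /lin1 !scale0r scale1r !addr0 mul0r addr0.
  by rewrite hE /lin1 !scale0r !addr0 !mul0r.
have hA : ahom_in {:B} (linfun hL).
  by apply/ahom_inP; split=> [x y _ _|]; rewrite !lfunE //=.
by exists (AHom hA) => p q r s; rewrite lfunE /= hE.
Qed.

End Conjugation.

Section GaloisGroup.

Variables (F : fieldType) (B : falgType F).
Hypothesis etB : etale B.
Hypothesis mulC : forall x y : B, x * y = y * x.
Hypothesis dimB : \dim {:B} = 4%N.

Lemma fixedSpaceE (h : 'AEnd(B)) x : (x \in fixedSpace_aspace h) = (h x == x).
Proof. by apply/fixedSpaceP/eqP. Qed.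

Lemma fixed_one (h : 'AEnd(B)) : 1 \in fixedSpace_aspace h.
Proof. by rewrite fixedSpaceE rmorph1. Qed.

(** The fixed algebra [K] of [h] contains [dl]; as [K] and [K rho] are independent its
    dimension is at most 2, and the discriminant of [dl] decides that it is etale. *)
Lemma galois_involutionI (h h' : 'AEnd(B)) (dl rho : B) :
  (forall x, h (h x) = x) -> (forall x, h' (h' x) = x) ->
  (forall x, h (h' x) = h' (h x)) ->
  (forall x, h x = x -> h' x = x -> x \in 1%VS) ->
  h dl = dl -> dl \notin 1%VS -> (forall y, y * (rho - h rho) = 0 -> y = 0) ->
  galois_involution h.
Proof.
move=> hh h'h' hh' fixF hdl dlF rho_reg; split=> //.
  exists rho => e; have /eqP : 1 = 0 :> B by apply: rho_reg; rewrite e subrr mulr0.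
  by rewrite oner_eq0.
set K := fixedSpace_aspace h; have K1 : 1 \in K by apply: fixed_one.
have dlK : dl \in K by rewrite fixedSpaceE hdl.
have inF x : h x = x -> h' x = x -> exists k : F, x = k%:A.
  by move=> hx h'x; apply/vlineP/fixF.
have [tau tauE] : exists k : F, dl + h' dl = k%:A.
  by apply: inF; rewrite !linearD /= ?hh' ?hdl // h'h' addrC.
have [nu nuE] : exists k : F, dl * h' dl = k%:A.
  by apply: inF; rewrite !rmorphM /= ?hh' ?hdl // h'h' mulC.
have dl2 : dl ^+ 2 = tau *: dl - nu%:A.
  have -> : tau *: dl = dl * (dl + h' dl) by rewrite tauE mulr_algr.
  by rewrite mulrDr nuE addrK.
have disc := etale_disc etB dlF dl2.
have dimK : \dim K = 2%N.
  apply/eqP; rewrite eqn_leq; apply/andP; split.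
    have capK : (K :&: amulr rho @: K = 0)%VS.
      apply/eqP; rewrite -subv0; apply/subvP=> x; rewrite memv_cap memv0.
      case/andP; rewrite fixedSpaceE => /eqP hx /memv_imgP[y].
      rewrite fixedSpaceE => /eqP hy; rewrite lfunE /= => xE.
      have hxE : x = y * h rho by rewrite -hx xE rmorphM /= hy.
      by rewrite xE (rho_reg y) ?mul0r // mulrBr -xE -hxE subrr.
    have dimr : \dim (amulr rho @: K) = \dim K.
      apply: limg_dim_eq; apply/eqP; rewrite -subv0; apply/subvP=> y.
      rewrite memv_cap memv_ker lfunE memv0 /= fixedSpaceE => /andP[/eqP hy /eqP y0].
      apply/eqP/rho_reg; rewrite mulrBr y0 sub0r -hy -rmorphM y0.
      by rewrite rmorph0 oppr0.
    have := dimvS (subvf (K + amulr rho @: K)).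
    by rewrite dimB dimv_disjoint_sum // dimr addnn -mul2n -[4%N]/(2 * 2)%N leq_pmul2l.
  pose s1 : seq B := [:: 1; dl]; have : (span s1 <= K)%VS.
    by apply/span_subvP=> x; rewrite !inE => /orP[] /eqP ->.
  move/dimvS; suff /eqP -> : free [:: 1; dl] by [].
  rewrite free_cons seq1_free span_seq1; apply/andP; split; last first.
    by apply: contraNneq dlF => ->; rewrite mem0v.
  apply/negP=> /vlineP[k e1]; have k0 : k != 0.
    by apply: contra_eq_neq e1 => ->; rewrite scale0r oner_eq0.
  by case/negP: dlF; apply/vlineP; exists k^-1; rewrite e1 scalerA mulVf ?scale1r.
apply: (@quadratic_etale_disc F tau nu _ (Subvs dlK)) disc.
- by rewrite dim_subvs.
- by rewrite vsval_in1.
apply: val_inj; apply: etrans dl2 _.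
exact: (congr1 (fun x => tau *: dl - x) (esym (vsval_alg nu K1))).
Qed.

Lemma galois_generator (h : 'AEnd(B)) : galois_involution h ->
  exists a, [/\ h a = a, a \notin 1%VS &
    forall y, h y = y -> exists p q : F, y = p%:A + q *: a].
Proof.
case=> _ _ [_ dimK]; have K1 := fixed_one h.
have [a [tau [nu [aF _]]]] := quadratic_generator dimK.
exists (vsval a); split.
- by apply/eqP; rewrite -fixedSpaceE subvsP.
- by rewrite -vsval_in1.
move=> y /eqP; rewrite -fixedSpaceE => yK.
set k0 := qc0 a (Subvs yK); set k1 := qc1 a (Subvs yK).
exists k0, k1; apply: etrans (congr1 vsval (quad_coord dimK aF (Subvs yK))) _.
exact: (congr1 (fun t => t + k1 *: vsval a) (vsval_alg k0 K1)).
Qed.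

Lemma biquad_generators : biquadratic B -> exists (al be : B) (t1 n1 t2 n2 : F),
  [/\ al ^+ 2 = t1 *: al - n1%:A, be ^+ 2 = t2 *: be - n2%:A
    & basis_of {:B} [tuple 1; al; be; al * be]].
Proof.
case=> _ _ [Q1 [Q2 [i1 [i2 [dim1 dim2 [_ basis12]]]]]].
have [x [t1 [n1 [xF xx]]]] := quadratic_generator dim1.
have [y [t2 [n2 [yF yy]]]] := quadratic_generator dim2.
exists (i1 x), (i2 y), t1, n1, t2, n2; split.
- by rewrite -rmorphXn xx rmorphB /= !linearZ /= rmorph1.
- by rewrite -rmorphXn yy rmorphB /= !linearZ /= rmorph1.
rewrite basisEdim dimB leqnn andbT -(span_basis basis12); apply/span_subvP.
move=> _ /allpairsP[[u v] /= [_ _ ->]].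
rewrite (quad_coord dim1 xF u) (quad_coord dim2 yF v) !linearD !linearZ /= !rmorph1.
rewrite mulrDl !mulrDr -!scalerAl -!scalerAr !mul1r !mulr1.
by rewrite !memvD ?memvZ ?memv_span ?inE ?eqxx ?orbT.
Qed.

Lemma ord3_cover (i1 i2 i3 : 'I_3) : i1 != i2 -> i2 != i3 -> i1 != i3 ->
  forall i, [\/ i = i1, i = i2 | i = i3].
Proof.
move=> n12 n23 n13 i.
have [->|ni1] := eqVneq i i1; first exact: Or31.
have [->|ni2] := eqVneq i i2; first exact: Or32.
apply: Or33; apply/val_inj; move: n12 n23 n13 ni1 ni2; rewrite -!val_eqE /=.
by case: i i1 i2 i3 => [[|[|[|i]]] ?] [[|[|[|i1]]] ?] [[|[|[|i2]]] ?] [[|[|[|i3]]] ?].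
Qed.

(** The conjugations of the two quadratic factors and their product are Galois
    involutions, hence exhaust the enumeration [gamma]. *)
Lemma galois_klein (gamma : 'I_3 -> 'AEnd(B)) :
  biquadratic B -> galois_enumeration gamma ->
  [/\ forall i x, gamma i (gamma i x) = x,
      forall i j k x, i != j -> j != k -> i != k -> gamma i (gamma j x) = gamma k x
    & forall i j x, i != j -> gamma i x = x -> gamma j x = x -> x \in 1%VS].
Proof.
move=> biq [gamma_inj gamma_inv gamma_surj].
have [al [be [t1 [n1 [t2 [n2 [al2 be2 e_basis]]]]]]] := biquad_generators biq.
have e_basis' : basis_of {:B} [tuple 1; be; al; be * al].
  rewrite [be * al]mulC (@perm_basis _ _ _ [:: 1; al; be; al * be]) //=.
  by rewrite perm_cons; apply/permPl; apply: (perm_catCA [:: be] [:: al] [:: _]).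
have genF (x y : B) : basis_of {:B} [tuple 1; x; y; x * y] -> x \notin 1%VS.
  move=> xy; apply/negP=> /vlineP[k xE].
  have E : lin1 x 0 1 + lin1 x 0 0 * y = lin1 x k 0 + lin1 x 0 0 * y.
    by rewrite /lin1 -xE !scale0r scale1r !add0r !addr0.
  by case: (biquad_inj xy E) => _ /eqP; rewrite oner_eq0.
have alF := genF _ _ e_basis; have beF := genF _ _ e_basis'.
have span x := biquad_span e_basis x.
have lin10 : lin1 al 0 0 = 0 by rewrite /lin1 !scale0r addr0.
have [h1 h1E] := quad_conj mulC al2 be2 e_basis.
have [h2 h2E] := quad_conj mulC be2 al2 e_basis'.
set b' := t2%:A - be in h1E; set a' := t1%:A - al in h2E.
have lin1al : lin1 al 0 1 = al by rewrite /lin1 scale0r scale1r add0r.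
have lin1be : lin1 be 0 1 = be by rewrite /lin1 scale0r scale1r add0r.
have lin11 x : lin1 x 1 0 = 1 by rewrite /lin1 scale0r scale1r addr0.
have lin0 x : lin1 x 0 0 = 0 by rewrite /lin1 !scale0r addr0.
have h1al : h1 al = al by have := h1E 0 1 0 0; rewrite lin1al lin0 !mul0r !addr0.
have h1be : h1 be = b' by have := h1E 0 0 1 0; rewrite lin11 lin0 !mul1r !add0r.
have h2be : h2 be = be by have := h2E 0 1 0 0; rewrite lin1be lin0 !mul0r !addr0.
have h2al : h2 al = a' by have := h2E 0 0 1 0; rewrite lin11 lin0 !mul1r !add0r.
have alg (h : 'AEnd(B)) (k : F) : h k%:A = k%:A by rewrite linearZ /= rmorph1.
have h1a' : h1 a' = a' by rewrite linearB /= alg h1al.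
have h1b' : h1 b' = be by rewrite linearB /= alg h1be subKr.
have h2a' : h2 a' = al by rewrite linearB /= alg h2al subKr.
have h2b' : h2 b' = b' by rewrite linearB /= alg h2be.
have hE (h : 'AEnd(B)) p q r s : h (lin1 al p q + lin1 al r s * be) =
    lin1 (h al) p q + lin1 (h al) r s * h be.
  by rewrite rmorphD rmorphM /= /lin1 !linearD !linearZ /= rmorph1.
have hext (f f' : B -> B) : (exists2 h : 'AEnd(B), f =1 h & True) ->
    (exists2 h : 'AEnd(B), f' =1 h & True) ->
    f al = f' al -> f be = f' be -> f =1 f'.
  move=> [h fh _] [h' f'h' _]; rewrite !fh !f'h' => eal ebe x.
  have [p [q [r [s ->]]]] := span x.
  by rewrite fh f'h' !hE eal ebe.
have hX (h : 'AEnd(B)) : exists2 h' : 'AEnd(B), h =1 h' & True by exists h.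
have hXX (h h' : 'AEnd(B)) : exists2 f : 'AEnd(B), (fun x => h (h' x)) =1 f & True.
  by exists (comp_ahom h h') => // x; rewrite comp_lfunE.
have idX : exists2 f : 'AEnd(B), @id B =1 f & True.
  by exists (id_ahom B) => // x; rewrite id_lfunE.
have h11 x : h1 (h1 x) = x.
  by apply: (hext _ _ (hXX h1 h1) idX); rewrite /= ?h1al ?h1be ?h1b'.
have h22 x : h2 (h2 x) = x.
  by apply: (hext _ _ (hXX h2 h2) idX); rewrite /= ?h2be ?h2al ?h2a'.
have h12 x : h1 (h2 x) = h2 (h1 x).
  by apply: (hext _ _ (hXX h1 h2) (hXX h2 h1)); rewrite ?(h1al, h2be, h2al, h1be, h1a', h2b').
pose h3 := comp_ahom h1 h2.
have h3E x : h3 x = h1 (h2 x) by rewrite comp_lfunE.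
have reg (x x' : B) (t n : F) : x ^+ 2 = t *: x - n%:A -> x \notin 1%VS ->
    x' = t%:A - x -> forall y, y * (x - x') = 0 -> y = 0.
  move=> xx xF -> y; have disc := etale_disc etB xF xx => y0.
  apply: (scalerI disc); rewrite scaler0 -mulr_algr -(sq_disc xx) mulrA.
  have -> : 2%:R *: x - t%:A = x - (t%:A - x).
    by rewrite opprB addrA -mulr2n scaler_nat.
  by rewrite y0 mul0r.
have regal := reg al a' t1 n1 al2 alF erefl.
have regbe := reg be b' t2 n2 be2 beF erefl.
have fix12 x : h1 x = x -> h2 x = x -> x \in 1%VS.
  have [p [q [r [s ->]]]] := span x; rewrite hE h1al h1be => /addrI e1.
  have rs0 : lin1 al r s = 0 by apply: regbe; rewrite mulrBr e1 subrr.
  rewrite rs0 mul0r addr0 /lin1 linearD !linearZ /= rmorph1 h2al => /addrI e2.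
  have q0 : q%:A = 0 :> B.
    by apply: regal; rewrite mulrBr !mulr_algl e2 subrr.
  by move: q0; rewrite -[q *: al]mulr_algl => ->; rewrite mul0r addr0 memvZ ?memv_line.
have fix13 x : h1 x = x -> h3 x = x -> x \in 1%VS.
  by move=> e1 e3; apply: fix12 => //; rewrite -{2}e3 h3E h12 e1.
have fix23 x : h2 x = x -> h3 x = x -> x \in 1%VS.
  by move=> e2 e3; apply: fix12 => //; rewrite -{2}e3 h3E e2.
have h33 x : h3 (h3 x) = x by rewrite !h3E -h12 h11 h22.
have h13 x : h1 (h3 x) = h2 x by rewrite h3E h11.
have h31 x : h3 (h1 x) = h2 x by rewrite h3E -h12 h11.
have h23 x : h2 (h3 x) = h1 x by rewrite h3E h12 h22.
have h32 x : h3 (h2 x) = h1 x by rewrite h3E h22.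
have g1 : galois_involution h1.
  by apply: (@galois_involutionI h1 h2 al be) => //; rewrite h1be.
have g2 : galois_involution h2.
  apply: (@galois_involutionI h2 h1 be al) => //; last by rewrite h2al.
  by move=> x e2 e1; apply: fix12.
pose dl := al * be + a' * b'.
have g3 : galois_involution h3.
  apply: (@galois_involutionI h3 h1 dl al) => //.
  - by move=> x; rewrite h31 h13.
  - by move=> x e3 e1; apply: fix13.
  - by rewrite h3E /dl !rmorphD !rmorphM /= h2al h2be h2a' h2b' h1a' h1be h1al h1b' addrC.
  - apply/negP=> /vlineP[k dlE]; have := alg h1 k; rewrite -dlE /dl.
    rewrite rmorphD !rmorphM /= h1al h1be h1a' h1b' => e.
    suff /eqP : 1 = 0 :> B by rewrite oner_eq0.
    have gen x y : al * y + x * be = al * be + x * y -> 1 * (al - x) * (be - y) = 0.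
      by move=> exy; rewrite mul1r mulrBl !mulrBr opprB addrACA -opprD exy subrr.
    by apply: regal; apply: regbe; apply: gen.
  by rewrite h3E h2al h1a'.
have [i1 E1] := gamma_surj _ g1; have [i2 E2] := gamma_surj _ g2.
have [i3 E3] := gamma_surj _ g3.
have alne : al <> a'.
  move=> e; suff /eqP : 1 = 0 :> B by rewrite oner_eq0.
  by apply: regal; rewrite -e subrr mulr0.
have bene : be <> b'.
  move=> e; suff /eqP : 1 = 0 :> B by rewrite oner_eq0.
  by apply: regbe; rewrite -e subrr mulr0.
have n12 : i1 != i2.
  by apply/eqP=> e; case: alne; rewrite -{1}h1al -h2al E1 E2 e.
have n13 : i1 != i3.
  by apply/eqP=> e; case: alne; rewrite -{1}h1al -h1a' -h2al -h3E E1 E3 e.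
have n23 : i2 != i3.
  by apply/eqP=> e; case: bene; rewrite -{1}h2be -h1be -{2}h2be -h3E E2 E3 e.
have cover := ord3_cover n12 n23 n13.
split.
- move=> i x; case: (cover i) => ->.
  + by rewrite -E1 h11.
  + by rewrite -E2 h22.
  by rewrite -E3 h33.
- move=> i j k x; case: (cover i) => ->; case: (cover j) => ->; case: (cover k) => ->;
  rewrite ?eqxx // -?E1 -?E2 -?E3 => _ _ _;
  by rewrite ?h13 ?h31 ?h23 ?h32 ?h3E ?h12.
move=> i j x; case: (cover i) => ->; case: (cover j) => ->;
  rewrite ?eqxx // -?E1 -?E2 -?E3 => _ e1 e2;
  by [exact: fix12 | exact: fix13 | exact: fix23].
Qed.

End GaloisGroup.

(** * The Pfister form of a neat biquadratic subalgebra *)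

Section Transfer.

Variables (F : fieldType) (A : falgType F) (sigma : 'End(A)) (L : {aspace A}).
Hypotheses (sM : forall x y, sigma (x * y) = sigma y * sigma x).
Hypotheses (sK : forall x, sigma (sigma x) = x).
Hypotheses (L1 : 1 \in L) (etL : etale (subvs_of L)).
Hypotheses (Ls : (L <= fixedSpace sigma)%VS) (biqL : biquadratic (subvs_of L)).
Variable gamma : 'I_3 -> 'AEnd(subvs_of L).
Hypothesis galL : galois_enumeration gamma.

Definition galois_lift i : 'End(A) :=
  linfun ((vsval : subvs_of L -> A) \o gamma i \o vsproj L).

Lemma galois_liftE i x : galois_lift i x = vsval (gamma i (vsproj L x)).
Proof. by rewrite lfunE. Qed.

Lemma neat_klein_data : exists a : 'I_3 -> A,
  klein_data sigma L galois_lift a.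
Proof.
have [mulC dimL _] := biqL.
have [gK gg gF] := galois_klein etL mulC dimL biqL galL.
have LM x y : x \in L -> y \in L -> x * y \in L.
  by move=> xL yL; apply: (subvP (asubv L)); apply: memv_mul.
have projM x y : x \in L -> y \in L -> vsproj L (x * y) = vsproj L x * vsproj L y.
  move=> xL yL; apply: subvs_inj; rewrite vsprojK ?LM // vsval_mul.
  by rewrite !vsprojK.
have proj1 : vsproj L 1 = 1.
  by apply: subvs_inj; rewrite vsprojK // vsval_one.
have [a aE] : exists a : 'I_3 -> subvs_of L, forall i, [/\ gamma i (a i) = a i,
    a i \notin 1%VS & forall y, gamma i y = y -> exists p q : F, y = p%:A + q *: a i].
  apply: (@fin_all_exists _ (fun _ => subvs_of L) (fun i x => [/\ gamma i x = x,
    x \notin 1%VS & forall y, gamma i y = y -> exists p q : F, y = p%:A + q *: x])).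
  by move=> i; apply: (galois_generator); case: galL.
exists (fun i => vsval (a i)); split=> //.
- move=> x y xL yL; rewrite -[x](vsprojK xL) -[y](vsprojK yL) -!vsval_mul.
  by rewrite mulC.
- by move=> x /(subvP Ls)/fixedSpaceP.
- move=> x xL xx; have e : vsproj L x = 0.
    by apply: (etale_reduced etL); rewrite -projM // xx linear0.
  by rewrite -[x](vsprojK xL) e linear0.
- by move=> i x _; rewrite galois_liftE subvsP.
- by move=> i x y xL yL; rewrite !galois_liftE projM // rmorphM.
- by move=> i; rewrite galois_liftE proj1 rmorph1 vsval_one.
- by move=> i x xL; rewrite !galois_liftE vsvalK gK vsprojK.
- by move=> i j k x ij jk ik xL; rewrite !galois_liftE vsvalK (gg i j k).
- move=> i j x ij xL; rewrite !galois_liftE => ex ex'.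
  rewrite -[x](vsprojK xL) -vsval_in1 //; apply: (gF i j) => //; apply: subvs_inj.
    by rewrite ex vsprojK.
  by rewrite ex' vsprojK.
- by move=> i; apply: subvsP.
- by move=> i; rewrite galois_liftE vsvalK; case: (aE i) => ->.
- by move=> i; rewrite -vsval_in1 //; case: (aE i).
move=> i x xL; rewrite galois_liftE => gx.
have [_ _ gen] := aE i; have [|p [q xE]] := gen (vsproj L x).
  by apply: subvs_inj; rewrite gx vsprojK.
exists p, q; rewrite -[x](vsprojK xL) xE linearD /=; congr (_ + _).
exact: vsval_alg.
Qed.

Lemma twisted_symd_W i x :
  x \in twisted_symd sigma (gamma i) <-> W sigma L galois_lift i x.
Proof.
split=> [/twisted_symdP[xS xt]|[xS xt]].
  split=> // y yL; rewrite /= galois_liftE -{1}[y](vsprojK yL).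
  exact: xt.
apply/twisted_symdP; split=> // y; rewrite (xt _ (subvsP y)) /=.
by rewrite galois_liftE vsvalK.
Qed.

End Transfer.

Section Assembly.

Variables (F : fieldType) (A : falgType F) (sigma : 'End(A)) (L : {aspace A}).
Variable gamma : 'I_3 -> 'AEnd(subvs_of L).
Variable a : 'I_3 -> A.
Hypothesis dimL : \dim L = 4%N.
Hypothesis one_symd : 1 \in symd sigma.
Local Notation g := (galois_lift gamma).
Hypothesis kd : klein_data sigma L g a.
Hypothesis dimK : forall i, \dim (fixedSpace_aspace (gamma i)) = 2%N.

Local Notation V i := (twisted_symd sigma (gamma i)).

Let VW i x : x \in V i <-> W sigma L g i x := twisted_symd_W sigma gamma i x.

Let L1 : 1 \in L := kd_1 kd.

Lemma sum3 (U : nmodType) (G : 'I_3 -> U) : \sum_i G i = G 0 + G 1 + G 2%:R.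
Proof.
rewrite !big_ord_recl big_ord0 addr0 !addrA.
by congr (_ + G _ + G _); apply: val_inj.
Qed.

Lemma ord3_ind (P : 'I_3 -> Prop) : P 0 -> P 1 -> P 2%:R -> forall i, P i.
Proof.
move=> P0 P1 P2 [[|[|[|//]]] p].
- by have <- : 0 = Ordinal p by apply: val_inj.
- by have <- : 1 = Ordinal p by apply: val_inj.
by have <- : 2%:R = Ordinal p by apply: val_inj.
Qed.

Let twistL y : y \in L -> twisted L (gal g None) y.
Proof. by move=> yL z zL /=; rewrite id_lfunE (kd_C kd). Qed.

Lemma twisted_symd_direct (w : 'I_3 -> A) y : y \in L -> (forall i, w i \in V i) ->
  y + (w 0 + w 1 + w 2%:R) = 0 -> y = 0 /\ forall i, w i = 0.
Proof.
move=> yL wV E; have wt i : twisted L (gal g (Some i)) (w i).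
  by have /VW[] := wV i.
have [] := twisted_unique kd (i := 0) (j := 1) (k := 2%:R) _ _ _ (twistL yL)
  (wt 0) (wt 1) (wt 2%:R); rewrite ?addrA // -?addrA //.
  by rewrite -E !addrA.
by move=> -> w0 w1 w2; split=> //; apply: ord3_ind.
Qed.

Lemma symd_directv : directv (L + \sum_(i < 3) V i).
Proof.
have ind : directv (\sum_(i < 3) V i).
  apply/directv_sum_independent => w wV w0 i _.
  have [] := @twisted_symd_direct w 0 (mem0v _) (fun i => wV i isT); last by [].
  by rewrite add0r -sum3.
rewrite directv_addE directv_trivial ind /=; apply/eqP.
apply/eqP; rewrite -subv0; apply/subvP=> y; rewrite memv_cap memv0 => /andP[yL].
case/memv_sumP=> w wV yE; apply/eqP.
have [] := @twisted_symd_direct (fun i => - w i) y yL; last by [].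
  by move=> i; rewrite memvN wV.
by rewrite -!opprD -sum3 yE subrr.
Qed.

Section Decomposition.

Hypothesis symd_centralizer : forall x, x \in symd sigma ->
  twisted L (gal g None) x -> x \in L.

Lemma symd_sum : (symd sigma = L + \sum_(i < 3) V i)%VS.
Proof.
apply/vspaceP=> x; apply/idP/idP.
  move=> xS; have [x0 [xi [xj [xk [[x0S x0t] Wi Wj Wk ->]]]]] :=
    symd_decomp kd (i := 0) (j := 1) (k := 2%:R) isT isT isT xS.
  rewrite -!addrA memv_add ?symd_centralizer //.
  pose w (i : 'I_3) := tnth [tuple xi; xj; xk] i.
  have -> : xi + (xj + xk) = \sum_i w i by rewrite sum3 /w /tnth /= addrA.
  by rewrite memv_sumr // => i _; apply/VW; move: i; apply: ord3_ind.
case/memv_addP=> y yL [z /memv_sumP[w wV ->] ->].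
apply: memvD; first exact: (L_symd kd one_symd yL).
by apply: memv_suml => i _; have /VW[] := wV i isT.
Qed.

Lemma dim_symd : \dim (symd sigma) = (4 + \sum_(i < 3) \dim (V i))%N.
Proof. by rewrite symd_sum (directvP symd_directv) /= dimL. Qed.

End Decomposition.

Local Notation K i := (fixedSpace_aspace (gamma i)).

Definition gen_lift i : subvs_of (K i) := vsproj (K i) (vsproj L (a i)).

Lemma vsval_gen i : vsval (vsval (gen_lift i)) = a i.
Proof.
rewrite !vsprojK ?(kd_aL kd) //; apply/fixedSpaceP; apply: subvs_inj.
rewrite vsprojK ?(kd_aL kd) //; have := kd_ga kd i.
by rewrite galois_liftE.
Qed.

Let K1 i : 1 \in K i.
Proof. by apply/fixedSpaceP; rewrite rmorph1. Qed.

Lemma gen_liftF i : gen_lift i \notin 1%VS.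
Proof. by rewrite vsval_in1 // vsval_in1 // vsval_gen (kd_aF kd). Qed.

Let dimKi i : \dim {:subvs_of (K i)} = 2%N.
Proof. by rewrite dim_subvs dimK. Qed.

Definition lift_form i (s : 'Hom(subvs_of (K i), F^o)) (y : A) : F :=
  s (vsproj (K i) (vsproj L y)).

Lemma lift_form_linear i s (k : F) x y :
  @lift_form i s (k *: x + y) = k * lift_form s x + lift_form s y.
Proof. by rewrite /lift_form !linearP. Qed.

Lemma lift_formE i s (p q : F) : lker s = 1%VS ->
  @lift_form i s (p%:A + q *: a i) = q * s (gen_lift i).
Proof.
move=> s1; rewrite addrC lift_form_linear /lift_form -/(gen_lift i).
suff -> : s (vsproj (K i) (vsproj L p%:A)) = 0 by rewrite addr0.
apply/eqP; rewrite -memv_ker s1 vsval_in1 // vsval_in1 //.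
have e : vsproj L p%:A = p%:A by apply: subvs_inj; rewrite vsprojK ?vsval_alg // memvZ.
by rewrite !vsprojK ?e ?memvZ ?memv_line ?vsval_alg // memvZ ?memv_line.
Qed.

Lemma form_exists i : exists2 s : 'Hom(subvs_of (K i), F^o),
  lker s = 1%VS & s (gen_lift i) = 1.
Proof.
pose f (x : subvs_of (K i)) : F^o := qc1 (gen_lift i) x.
have f_lin : linear f by move=> k x y; rewrite /f /qc1 linearP.
pose fL : {linear subvs_of (K i) -> F^o} :=
  HB.pack f (GRing.isLinear.Build F _ F^o *:%R f f_lin).
have qE p q := quad_free (dimKi i) (gen_liftF i)
  (esym (quad_coord (dimKi i) (gen_liftF i) (p%:A + q *: gen_lift i))).
exists (linfun fL).
  apply/vspaceP=> x; rewrite memv_ker lfunE /= /f.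
  apply/eqP/vlineP=> [x1|[k ->]].
    exists (qc0 (gen_lift i) x); rewrite {1}[x](quad_coord (dimKi i) (gen_liftF i)).
    by rewrite x1 scale0r addr0.
  by have [_] := qE k 0; rewrite scale0r addr0.
by rewrite lfunE /= /f; have [_] := qE 0 1; rewrite scale0r add0r scale1r.
Qed.

Lemma form_gen_neq0 i (s : 'Hom(subvs_of (K i), F^o)) :
  lker s = 1%VS -> s (gen_lift i) != 0.
Proof. by move=> s1; rewrite -memv_ker s1 gen_liftF. Qed.

Lemma square_form_quadratic i s :
  quadratic_form (square_form (sigma := sigma) (gamma := gamma i) s).
Proof.
pose S := lift_form s; have SE x : square_form s x = S (vsval x * vsval x).
  by rewrite /square_form expr2.
have SD x y : S (x + y) = S x + S y.
  by have := lift_form_linear s 1 x y; rewrite scale1r mul1r.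
have SZ k x : S (k *: x) = k * S x.
  have S0 : S 0 = 0 by apply: (addrI (S 0)); rewrite -SD !addr0.
  by have := lift_form_linear s k x 0; rewrite !addr0 -/S S0 addr0.
have polE x y : polar (square_form s) x y = S (vsval x * vsval y + vsval y * vsval x).
  rewrite /polar !SE /= mulrDl !mulrDr !SD.
  by ring.
split=> [k x|k x y z]; first by rewrite !SE /= -scalerAl -scalerAr scalerA SZ expr2.
by rewrite !polE /= mulrDl mulrDr -!scalerAl -!scalerAr !SD !SZ; ring.
Qed.

(** Two linear forms on a plane with the same kernel are proportional. *)
Lemma square_form_similar i (s s' : 'Hom(subvs_of (K i), F^o)) :
  lker s = 1%VS -> lker s' = 1%VS ->
  similar (square_form (sigma := sigma) s) (square_form (sigma := sigma) s').
Proof.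
move=> s1 s'1; have n0 := form_gen_neq0 s1; have n0' := form_gen_neq0 s'1.
exists (s (gen_lift i) / s' (gen_lift i)); first by rewrite mulf_neq0 ?invr_eq0.
apply: isometric_ext => x; rewrite /square_form.
set y := vsproj _ _; have val (t : 'Hom(subvs_of (K i), F^o)) : lker t = 1%VS ->
    t y = qc1 (gen_lift i) y * t (gen_lift i).
  move=> t1; rewrite {1}[y](quad_coord (dimKi i) (gen_liftF i)) linearD !linearZ /=.
  have -> : t 1 = 0 by apply/eqP; rewrite -memv_ker t1 memv_line.
  by rewrite scaler0 add0r.
by rewrite !val // mulrCA divfK.
Qed.

Section Main.

Hypothesis symd_centralizer : forall x, x \in symd sigma ->
  twisted L (gal g None) x -> x \in L.
Hypothesis nondeg : forall i y, W sigma L g i y ->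
  (forall b, twisted L (gal g (Some i)) b -> b * y + sigma (b * y) = 0) -> y = 0.
Hypothesis Wn0 : forall i, exists2 x, W sigma L g i x & x != 0.

Lemma square_in_fixed_field i : square_form_well_defined sigma (gamma i).
Proof.
move=> x /VW xW; have [xL gx] := W_square kd one_symd symd_centralizer xW.
split; rewrite expr2 //; apply/fixedSpaceP; apply: subvs_inj.
by rewrite -galois_liftE gx vsprojK.
Qed.

Variable s : forall i, 'Hom(subvs_of (K i), F^o).
Hypothesis s1 : forall i, lker (s i) = 1%VS.
Hypothesis sgen : forall i, s i (gen_lift i) = 1.

Local Notation q i := (square_form (sigma := sigma) (s i)).

Let sE i p q' : lift_form (s i) (p%:A + q' *: a i) = q'.
Proof. by rewrite (lift_formE _ _ (s1 i)) sgen mulr1. Qed.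

Let valW i (x : subvs_of (V i)) : W sigma L g i (vsval x).
Proof. by apply/VW; rewrite subvsP. Qed.

Let q_nd i : nondegenerate (q i).
Proof.
move=> x x0; apply: subvs_inj; rewrite linear0.
apply: (W_form_nondegenerate (s := fun i => lift_form (s i)) kd one_symd
  symd_centralizer sE (@nondeg i) (valW x)).
move=> y /VW yV; have := x0 (Subvs yV); rewrite /polar /square_form /= => <-.
have SD (u v : A) : lift_form (s i) (u + v) = lift_form (s i) u + lift_form (s i) v.
  by have := lift_form_linear (s i) 1 u v; rewrite scale1r mul1r.
rewrite -!/(lift_form _ _) !expr2 mulrDl !mulrDr !SD.
by ring.
Qed.

Let prod i j k (x : subvs_of (V i)) (y : subvs_of (V j)) : subvs_of (V k) :=
  vsproj (V k) (vsval x * vsval y + vsval y * vsval x).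

Let prodE i j k : i != j -> j != k -> i != k ->
  [/\ forall x, linear (@prod i j k x), forall y, linear ((@prod i j k)^~ y) &
   exists2 e : F, e != 0 & forall x y, q k (@prod i j k x y) = e * (q i x * q j y)].
Proof.
move=> ij jk ik; split.
- move=> x c y z; rewrite -linearP; congr (vsproj _ _) => /=.
  by rewrite mulrDr mulrDl scalerDr -!scalerAl -!scalerAr addrACA.
- move=> y c x z; rewrite -linearP; congr (vsproj _ _) => /=.
  by rewrite mulrDr mulrDl scalerDr -!scalerAl -!scalerAr addrACA.
have [e e0 eE] := W_composition (s := fun i => lift_form (s i)) kd one_symd
  symd_centralizer sE ij jk ik.
exists e => // x y; rewrite /square_form.
rewrite -!/(lift_form _ _) !expr2 vsprojK.
  exact: eE.
exact: (proj2 (VW _ _) (W_mul kd ij jk ik (valW x) (valW y))).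
Qed.

Let dimV_gt0 i : (0 < \dim (V i))%N.
Proof.
rewrite lt0n dimv_eq0; apply/eqP=> V0; have [x /VW xV /negP] := Wn0 i; apply.
by rewrite -memv0 -V0.
Qed.

Let dimV_le i j k : i != j -> j != k -> i != k -> (\dim (V j) <= \dim (V k))%N.
Proof.
move=> ij jk ik; have [ml mr [e e0 qm]] := prodE ij jk ik.
have [|x qx] := nondegenerate_anisotropic (@q_nd i).
  by rewrite dimvf; apply: dimV_gt0.
have [f [f_inj _ _]] := composition_injective (square_form_quadratic (s j))
  (@q_nd j) (square_form_quadratic (s k)) e0 ml qm qx.
have /lker0P f0 := f_inj; have := dimvS (subvf (limg f)).
by rewrite limg_dim_eq ?(eqP f0) ?capv0 // !dimvf.
Qed.

(** Multiplying by an anisotropic vector of [W_i] embeds [W_j] into [W_k], so the three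
    dimensions agree and are found from the dimension of [Symd]. *)
Lemma square_forms_pfister n : \dim (symd sigma) = (4 + 3 * 2 ^ n)%N -> (0 < n <= 3)%N ->
  exists (U : vectType F) (pi : U -> F), quadratic_pfister n pi /\
    forall i, similar (q i) pi.
Proof.
move=> dimS n3; have dimV_eq i : \dim (V i) = (2 ^ n)%N.
  have dimV_le' j k : (\dim (V j) <= \dim (V k))%N.
    have [->//|jk] := eqVneq j k.
    have [l [kl jl]] := third_index jk.
    by apply: (@dimV_le l); rewrite // eq_sym.
  have dimV_eq' j : \dim (V j) = \dim (V i).
    by apply/eqP; rewrite eqn_leq !dimV_le'.
  move: dimS; rewrite (dim_symd symd_centralizer) => /addnI.
  rewrite (eq_bigr (fun=> \dim (V i))) => [|j _]; last exact: dimV_eq'.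
  by rewrite sum_nat_const card_ord => /eqP; rewrite eqn_pmul2l // => /eqP.
have dimV i : \dim {:subvs_of (V i)} = (2 ^ n)%N by rewrite dimvf; apply: dimV_eq.
have [ml mr [e e0 qm]] := @prodE 0 1 2%:R isT isT isT.
have [U [pi [pf sim0 sim1 sim2]]] := composition_pfister (square_form_quadratic (s 0))
  (@q_nd 0) (square_form_quadratic (s 1)) (@q_nd 1) (square_form_quadratic (s 2%:R))
  e0 ml mr qm (dimV 0) (dimV 1) (dimV 2%:R) n3.
by exists U, pi; split=> //; apply: ord3_ind.
Qed.

Lemma square_forms_invariant n : \dim (symd sigma) = (4 + 3 * 2 ^ n)%N -> (0 < n <= 3)%N ->
  exists (U : vectType F) (pi : U -> F), pfister_invariant sigma n gamma pi /\
     forall (V' : vectType F) (pi' : V' -> F),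
       pfister_invariant sigma n gamma pi' -> isometric pi' pi.
Proof.
move=> dimS n3; have [U [pi [pf sim]]] := square_forms_pfister dimS n3.
exists U, pi; split.
  split=> // i; exists (s i); split=> //; first exact: square_in_fixed_field.
  exact: square_form_quadratic.
move=> V' pi' [pf' inv']; have [s' [s'1 _ _ sim']] := inv' 0.
apply: (pfister_similar pf' pf); apply: similar_trans (similar_sym sim') _.
exact: similar_trans (square_form_similar s'1 (s1 0)) (sim 0).
Qed.

End Main.
End Assembly.

(** * Split algebras *)

Section Representation.

Variables (F : fieldType) (A : falgType F) (K : fieldType).
Variables (iota : {rmorphism F -> K}) (m : nat) (phi : A -> 'M[K]_m).
Hypothesis phi_split : is_splitting iota phi.

Lemma split_D : {morph phi : x y / x + y}.
Proof. by case: phi_split. Qed.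

Lemma split_Z a x : phi (a *: x) = iota a *: phi x.
Proof. by case: phi_split. Qed.

Lemma split_1 : phi 1 = 1%:M.
Proof. by case: phi_split. Qed.

Lemma split_M x y : phi (x * y) = phi x *m phi y.
Proof. by case: phi_split. Qed.

Lemma split_0 : phi 0 = 0.
Proof. by apply: (addrI (phi 0)); rewrite -split_D !addr0. Qed.

Lemma split_sum (I : finType) (G : I -> A) : phi (\sum_i G i) = \sum_i phi (G i).
Proof. exact: (big_morph phi split_D split_0). Qed.

Lemma split_dim : \dim {:A} = (m * m)%N.
Proof.
have [_ _ _ _ /size_basis] := phi_split.
by rewrite dimvf /dim /= => ->.
Qed.

Lemma split_span (X : 'M[K]_m) : exists c : 'I_(\dim {:A}) -> K,
  X = \sum_i c i *: phi (vbasis {:A})`_i.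
Proof.
have [_ _ _ _ bas] := phi_split.
have size_b : size [seq phi x | x <- vbasis {:A}] == \dim {:A}.
  by rewrite size_map size_tuple.
pose b := Tuple size_b; have b_basis : basis_of {:'M[K]_m} b by [].
exists (fun i => coord b i X); rewrite {1}(coord_basis b_basis (memvf X)).
by apply: eq_bigr => i _; rewrite /= (nth_map 0) // size_tuple.
Qed.

Lemma split_basis_free (c : 'I_(\dim {:A}) -> K) :
  \sum_i c i *: phi (vbasis {:A})`_i = 0 -> forall i, c i = 0.
Proof.
have [_ _ _ _ bas] := phi_split.
have size_b : size [seq phi x | x <- vbasis {:A}] == \dim {:A}.
  by rewrite size_map size_tuple.
pose b := Tuple size_b; have b_free : free b by apply: basis_free bas.
move=> E; move/freeP: b_free; apply; rewrite -[RHS]E.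
by apply: eq_bigr => i _; rewrite /= (nth_map 0) // size_tuple.
Qed.

(** Linear independence over [F] is independence over [K]: the rank of a matrix of
    coordinates does not depend on the field. *)
Lemma split_free k (x : k.-tuple A) (c : 'I_k -> K) : free x ->
  \sum_i c i *: phi x`_i = 0 -> forall i, c i = 0.
Proof.
move=> /freeP xfree E.
pose M : 'M[F]_(k, \dim {:A}) := \matrix_(i, j) coord (vbasis {:A}) j x`_i.
have Mfree : row_free M.
  rewrite -kermx_eq0; apply/eqP/row_matrixP => l; rewrite row0.
  have : row l (kermx M) *m M = 0 by rewrite -row_mul mulmx_ker row0.
  move: (row l _) => u uM; apply/rowP=> i; rewrite mxE; move: i.
  apply: xfree.
  transitivity (\sum_j (u *m M) 0 j *: (vbasis {:A})`_j); last first.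
    by rewrite uM big1 // => j _; rewrite mxE scale0r.
  transitivity (\sum_i \sum_j (u 0 i * M i j) *: (vbasis {:A})`_j).
    apply: eq_bigr => i _; rewrite {1}(coord_vbasis (memvf x`_i)) scaler_sumr.
    by apply: eq_bigr => j _; rewrite scalerA mxE.
  by rewrite exchange_big; apply: eq_bigr => j _; rewrite mxE scaler_suml.
have cM : (\row_i c i) *m map_mx iota M = 0.
  apply/rowP=> j; rewrite !mxE; move: j.
  apply: split_basis_free; rewrite -[RHS]E.
  transitivity (\sum_i \sum_j (c i * iota (M i j)) *: phi (vbasis {:A})`_j).
    rewrite exchange_big; apply: eq_bigr => j _; rewrite scaler_suml.
    by apply: eq_bigr => i _; rewrite !mxE.
  apply: eq_bigr => i _; rewrite {1}(coord_vbasis (memvf x`_i)) split_sum scaler_sumr.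
  by apply: eq_bigr => j _; rewrite split_Z scalerA mxE.
have rf : row_free (map_mx iota M) by rewrite /row_free mxrank_map.
move=> i; have : \row_i c i = 0 :> 'rV_k.
  by apply: (row_free_inj rf); rewrite cM mul0mx.
by move/rowP/(_ i); rewrite !mxE.
Qed.

Lemma split_inj x : phi x = 0 -> x = 0.
Proof.
move=> x0; apply/eqP/negPn/negP => nz; have xfree : free [tuple x] by rewrite seq1_free.
have := @split_free 1 [tuple x] (fun _ => 1) xfree; rewrite big_ord1 scale1r /=.
by move/(_ x0 0)/eqP; rewrite oner_eq0.
Qed.

End Representation.

(** ** Alternating and symmetric parts *)

Section SymmetricParts.

Variables (K : fieldType) (m : nat) (eps : K) (d : bool).
Hypotheses (eps2 : eps * eps = 1) (eps_d : if d then eps = -1 else 1 + eps != 0).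

Definition sym_part (M : 'M[K]_m) : 'M[K]_m := M + eps *: M^T.

Lemma sym_part_linear : linear sym_part.
Proof.
move=> k X Y; rewrite /sym_part linearD linearZ /= !scalerDr scalerA mulrC -scalerA.
by rewrite addrACA.
Qed.

HB.instance Definition _ := GRing.isLinear.Build K 'M[K]_m 'M[K]_m _ sym_part
  sym_part_linear.

(** The flag [d] selects strictly increasing pairs, for alternating matrices. *)
Definition sym_index : seq ('I_m * 'I_m) := enum [pred p : 'I_m * 'I_m | (p.1 + d <= p.2)%N].

Definition sym_gen (p : 'I_m * 'I_m) : 'M[K]_m := sym_part (delta_mx p.1 p.2).

Definition sym_space : {vspace 'M[K]_m} := span [seq sym_gen p | p <- sym_index].

(** The entry at [p] of a linear combination recovers the coefficient of the generator
    at [p], up to the factor [1 + eps] if [p] is diagonal. *)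
Lemma sym_gen_free : free [seq sym_gen p | p <- sym_index].
Proof.
have size_b : size [seq sym_gen p | p <- sym_index] == size sym_index.
  by rewrite size_map.
suff : free (Tuple size_b) by [].
pose pt := tnth (in_tuple sym_index).
have ptP i : ((pt i).1 + d <= (pt i).2)%N.
  by have := mem_tnth i (in_tuple sym_index); rewrite mem_enum inE.
have pt_inj : injective pt by apply/tuple_uniqP; apply: enum_uniq.
apply/freeP=> k E i.
have {}E : sym_part (\sum_l k l *: delta_mx (pt l).1 (pt l).2) = 0.
  rewrite linear_sum -[RHS]E; apply: eq_bigr => l _; rewrite linearZ.
  by rewrite /= (nth_map (pt i)) ?ltn_ord // /pt (tnth_nth (pt i)).
have entry l (a b : 'I_m) : delta_mx (pt l).1 (pt l).2 a b = (pt l == (a, b))%:R :> K.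
  by rewrite mxE -pair_eqE /= ![_ == a]eq_sym ![_ == b]eq_sym eq_sym [b == _]eq_sym.
have sel (a b : 'I_m) : (\sum_l k l *: delta_mx (pt l).1 (pt l).2) a b
    = \sum_l k l * (pt l == (a, b))%:R.
  by rewrite summxE; apply: eq_bigr => l _; rewrite mxE entry.
have sel_pt l0 : (\sum_l k l *: delta_mx (pt l).1 (pt l).2) (pt l0).1 (pt l0).2 = k l0.
  rewrite sel (bigD1 l0) //= -surjective_pairing eqxx mulr1 big1 ?addr0 // => l nl.
  by rewrite (inj_eq pt_inj) (negPf nl) mulr0.
move/matrixP/(_ (pt i).1 (pt i).2): E; rewrite !mxE.
rewrite -![X in _ + eps * X]/(_ (pt i).2 (pt i).1).
case: (eqVneq (pt i).1 (pt i).2) => [eqi|neqi].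
  rewrite -{2}eqi {3}eqi sel_pt -[X in X + _]mul1r -mulrDl => /eqP.
  rewrite mulf_eq0; case/orP=> [|/eqP //]; move: eps_d (ptP i); rewrite eqi.
  by case: (d) => [_|/negPf->]; rewrite ?addn1 ?ltnn.
rewrite sel_pt sel big1 ?mulr0 ?addr0 // => l _.
case: eqP => [El|]; last by rewrite mulr0.
case/eqP: neqi; apply/val_inj/eqP; rewrite eqn_leq.
have := ptP l; rewrite El /= => /(leq_trans (leq_addr _ _)) ->.
by rewrite (leq_trans (leq_addr _ _) (ptP i)).
Qed.

Lemma sym_part_in M : sym_part M \in sym_space.
Proof.
rewrite [M]matrix_sum_delta linear_sum; apply: memv_suml => i _.
rewrite linear_sum; apply: memv_suml => j _; rewrite linearZ; apply: memvZ.
change (sym_part (delta_mx i j) \in sym_space).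
have gen_in (k l : 'I_m) : (k + d <= l)%N -> sym_part (delta_mx k l) \in sym_space.
  move=> le; apply: memv_span; apply/mapP; exists (k, l) => //.
  by rewrite mem_enum inE.
have swap : sym_part (delta_mx i j) = eps *: sym_part (delta_mx j i).
  by rewrite /sym_part !trmx_delta scalerDr scalerA eps2 scale1r addrC.
case: (leqP (i + d) j) => [/gen_in //|ltji].
case: (leqP (j + d) i) => [/gen_in le|ltij]; first by rewrite swap memvZ.
move: eps_d ltji ltij; case: (d) => [e1|_]; last first.
  by rewrite !addn0 => h1 h2; have := ltn_trans h1 h2; rewrite ltnn.
rewrite !addn1 !ltnS => h1 h2; have -> : i = j by apply/val_inj/eqP; rewrite eqn_leq h1 h2.
by rewrite /sym_part trmx_delta e1 scaleN1r subrr mem0v.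
Qed.

Lemma sym_space_sub (U : {vspace 'M[K]_m}) :
  (forall M, sym_part M \in U) -> (sym_space <= U)%VS.
Proof. by move=> sU; apply/span_subvP=> _ /mapP[p _ ->]; apply: sU. Qed.

End SymmetricParts.

Lemma sym_space_dim (K : fieldType) (m : nat) (eps : K) (d : bool) :
  (if d then eps = -1 else 1 + eps != 0) ->
  \dim (sym_space m eps d) = (\sum_(i < m) \sum_(j < m) (i + d <= j))%N.
Proof.
move=> h; rewrite (eqP (sym_gen_free m h)) size_map -cardE -sum1_card.
rewrite pair_bigA big_mkcond; apply: eq_bigr => p _ /=; rewrite inE.
by case: (_ <= _)%N.
Qed.

Section SymmetrizedDimension.

Variables (F : fieldType) (A : falgType F) (sigma : 'End(A)) (K : fieldType).
Variables (iota : {rmorphism F -> K}) (m : nat) (phi : A -> 'M[K]_m) (B : 'M[K]_m).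
Hypotheses (phi_split : is_splitting iota phi) (B_unit : B \in unitmx).
Hypothesis adj : adjoint_over sigma phi B.
Variables (eps : K) (d : bool).
Hypotheses (eps2 : eps * eps = 1) (eps_d : if d then eps = -1 else 1 + eps != 0).
Hypothesis B_sym : B^T = eps *: B.

(** The adjunction turns [B phi (sigma x)] into [(phi x)^T B], which is [eps] times the
    transpose of [B phi x]. *)
Lemma adjoint_symd x : B *m phi (x + sigma x) = sym_part eps (B *m phi x).
Proof.
rewrite (split_D phi_split) mulmxDr -(adj x) /sym_part trmx_mul B_sym.
by rewrite -scalemxAr scalerA eps2 scale1r.
Qed.

(** An [F]-basis of [Symd] is sent by [x |-> B phi x] to a [K]-basis of the symmetric parts. *)
Lemma symd_dim : \dim (symd sigma) = \dim (sym_space m eps d).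
Proof.
pose k := \dim (symd sigma).
have size_b : size [seq B *m phi x | x <- vbasis (symd sigma)] == k.
  by rewrite size_map size_tuple.
have b_free : free (Tuple size_b).
  apply/freeP=> c E; apply: (split_free phi_split (basis_free (vbasisP _))).
  have : B *m \sum_i c i *: phi (vbasis (symd sigma))`_i = 0.
    rewrite mulmx_sumr -[RHS]E; apply: eq_bigr => i _.
    by rewrite -scalemxAr /= (nth_map 0) // size_tuple.
  by move/(congr1 (mulmx (invmx B))); rewrite mulKmx // mulmx0.
rewrite -[LHS](eqP size_b) -(eqP b_free); congr (\dim _).
have in_span x : x \in symd sigma -> B *m phi x \in <<Tuple size_b>>%VS.
  move=> xS; rewrite (coord_vbasis xS) (split_sum phi_split) mulmx_sumr.
  apply: memv_suml => i _; rewrite (split_Z phi_split) -scalemxAr memvZ //.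
  apply: memv_span; apply: (map_f (fun x => B *m phi x)).
  by rewrite mem_nth // size_tuple.
apply/eqP; rewrite eqEsubv; apply/andP; split.
  apply/span_subvP=> _ /mapP[x /vbasis_mem/symdP[y ->] ->].
  by rewrite adjoint_symd sym_part_in.
apply: sym_space_sub => M; have [c Ec] := split_span phi_split (invmx B *m M).
have -> : M = \sum_i c i *: (B *m phi (vbasis {:A})`_i).
  rewrite -[LHS](mulKVmx B_unit) Ec mulmx_sumr.
  by apply: eq_bigr => i _; rewrite -scalemxAr.
rewrite linear_sum; apply: memv_suml => i _; rewrite linearZ memvZ //.
rewrite -[X in X \in _]adjoint_symd; apply: in_span.
by apply/symdP; exists (vbasis {:A})`_i.
Qed.

End SymmetrizedDimension.

Lemma count_upper4 : (\sum_(i < 4) \sum_(j < 4) (i + false <= j) = 10)%N.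
Proof. by rewrite !big_ord_recl !big_ord0. Qed.

Lemma count_strict_upper8 : (\sum_(i < 8) \sum_(j < 8) (i + true <= j) = 28)%N.
Proof. by rewrite !big_ord_recl !big_ord0. Qed.

(** ** The type of the form *)

Lemma alternating_entries (K : fieldType) (m : nat) (B : 'M[K]_m) :
  alternating_form B -> (forall i, B i i = 0) /\ B^T = -1 *: B.
Proof.
move=> alt; have ent i j : (delta_mx 0 i *m B *m delta_mx j 0 : 'M_1) 0 0 = B i j.
  by rewrite -rowE -colE !mxE.
have diag i : B i i = 0.
  by rewrite -ent; have := alt (delta_mx i 0); rewrite trmx_delta => ->; rewrite mxE.
split=> //; apply/matrixP=> i j; rewrite !mxE mulN1r; apply/eqP; rewrite -addr_eq0.
have addE (X Y : 'M[K]_1) : (X + Y) 0 0 = X 0 0 + Y 0 0 by rewrite mxE.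
have := congr1 (fun M : 'M_1 => M 0 0) (alt (delta_mx i 0 + delta_mx j 0)).
rewrite /= [(_ + _)^T]linearD /= !trmx_delta !(mulmxDl, mulmxDr) !addE !ent !diag mxE add0r addr0.
by rewrite addrC => ->.
Qed.

(** A symmetric form [M + M^T] has even diagonal, in every basis; if it is moreover
    diagonalisable, then it vanishes in characteristic two. *)
Lemma diagonalisable_char (F : fieldType) (A : falgType F) (sigma : 'End(A))
    (K : fieldType) (iota : {rmorphism F -> K}) (m : nat) (phi : A -> 'M[K]_m)
    (B : 'M[K]_m) :
  is_splitting iota phi -> B \in unitmx -> adjoint_over sigma phi B -> B^T = B ->
  diagonalisable_form B -> 1 \in symd sigma -> (0 < m)%N -> 2%:R != 0 :> K.
Proof.
move=> sp Bu adj Bs [P Pu /is_diag_mxP diag] /symdP[a a1] m_gt0.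
apply/negP=> /eqP two; case/negP: (oner_neq0 K).
have Bs1 : B^T = 1 *: B by rewrite scale1r.
have EB : B = sym_part 1 (B *m phi a).
  by rewrite -(adjoint_symd sp adj (mul1r 1) Bs1) -a1 (split_1 sp) mulmx1.
have D0 : P^T *m B *m P = 0.
  apply/matrixP=> i j; case: (eqVneq i j) => [<-|ne]; last by rewrite diag ?mxE.
  rewrite EB /sym_part scale1r mulmxDr mulmxDl; move: (B *m _) => S.
  have -> : P^T *m S^T *m P = (P^T *m S *m P)^T by rewrite !trmx_mul trmxK mulmxA.
  by move: (_ *m P) => X; rewrite mxE [X^T i i]mxE -mulr2n -mulr_natl two mul0r mxE.
have : 1%:M = 0 :> 'M[K]_m.
  have U : P^T *m B *m P \in unitmx by rewrite !unitmx_mul unitmx_tr Pu Bu.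
  by rewrite -(mulVmx U) D0 mulmx0.
by move/matrixP/(_ (Ordinal m_gt0) (Ordinal m_gt0)); rewrite !mxE eqxx mulr1n => ->.
Qed.

(** ** Centralisers in split algebras *)

Lemma quadratic_splits (K : fieldType) (t n : K) :
  exists (K1 : fieldType) (j : {rmorphism K -> K1}) (x y : K1),
    x + y = j t /\ x * y = j n.
Proof.
case: (classic (exists r, root (quad_poly t n) r)) => [[r]|noroot].
  have := root_quad_poly t n (@idfun K) r; rewrite map_poly_id // => -> /eqP /= E.
  exists K, (@idfun K), r, (t - r); split; first by rewrite addrC subrK.
  by rewrite mulrBr -expr2 E /= mulrC opprB addrC subrK.
have irr : irreducible_poly (quad_poly t n).
  apply: cubic_irreducible; rewrite ?size_quad_poly // => r.
  by apply/negP=> h; apply: noroot; exists r.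
have [K1 _ [z]] := irredp_FAdjoin irr.
have -> : map_poly (in_alg K1) (quad_poly t n) =
  map_poly (in_alg K1 : {rmorphism K -> K1}) (quad_poly t n) by [].
rewrite root_quad_poly => /eqP E _.
exists K1, (in_alg K1 : {rmorphism K -> K1}), z, (in_alg K1 t - z).
split; first by rewrite addrC subrK.
by rewrite mulrBr -expr2 E mulrC opprB addrC subrK.
Qed.

Lemma splitting_extension (F : fieldType) (A : falgType F) (K K1 : fieldType)
    (iota : {rmorphism F -> K}) (j : {rmorphism K -> K1}) (m : nat) (phi : A -> 'M[K]_m) :
  is_splitting iota phi ->
  is_splitting (j \o iota : {rmorphism F -> K1}) (fun x => map_mx j (phi x)).
Proof.
move=> sp; have [phiD phiZ phi1 phiM _] := sp; split.
- by move=> x y; rewrite phiD map_mxD.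
- by move=> k x; rewrite phiZ map_mxZ.
- by rewrite phi1 map_mx1.
- by move=> x y; rewrite phiM map_mxM.
rewrite basisEdim; apply/andP; split; last first.
  by rewrite size_map size_tuple (split_dim sp) dimvf.
apply/subvP=> M _; rewrite [M]matrix_sum_delta; apply: memv_suml => k _.
apply: memv_suml => l _; apply: memvZ; have [c E] := split_span sp (delta_mx k l).
rewrite -(map_delta_mx j) E raddf_sum; apply: memv_suml => i _ /=.
rewrite map_mxZ memvZ //; apply: memv_span; apply: (map_f (fun x => map_mx j (phi x))).
by rewrite mem_nth // size_tuple.
Qed.

Section EigenProjector.

Variables (K : fieldType) (m : nat).
Implicit Types X Y Z : 'M[K]_m.

Definition projector X Y (r s : K) : 'M[K]_m := (X - r%:M) *m (Y - s%:M).

Lemma projectorE X Y r s :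
  projector X Y r s = X *m Y - s *: X - r *: Y + (r * s)%:M.
Proof.
rewrite /projector mulmxBl !mulmxBr mul_mx_scalar !mul_scalar_mx.
move: (X *m Y) => XY; apply/matrixP=> i k; rewrite !mxE.
by case: (i == k); ring.
Qed.

Lemma projectorC X Y r s : X *m Y = Y *m X -> projector X Y r s = projector Y X s r.
Proof. by move=> XY; rewrite !projectorE XY [r * s]mulrC; congr (_ + _); rewrite addrAC. Qed.

Lemma eigen_factor Z (p q : K) : Z *m Z = (p + q) *: Z - (p * q)%:M ->
  Z *m (Z - q%:M) = p *: (Z - q%:M).
Proof.
move=> Z2; rewrite mulmxBr Z2 mul_mx_scalar scalerDl scalerBr scale_scalar_mx.
by rewrite addrAC addrK.
Qed.

Lemma projector_eigenl X Y r r' s : X *m X = (r + r') *: X - (r * r')%:M ->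
  X *m projector X Y r' s = r *: projector X Y r' s.
Proof. by move=> X2; rewrite mulmxA (eigen_factor X2) -scalemxAl. Qed.

Lemma projector_sq X Y r r' s s' : X *m Y = Y *m X ->
  X *m X = (r + r') *: X - (r * r')%:M -> Y *m Y = (s + s') *: Y - (s * s')%:M ->
  projector X Y r' s' *m projector X Y r' s' =
  ((r - r') * (s - s')) *: projector X Y r' s'.
Proof.
move=> XY X2 Y2; set Q := projector X Y r' s'.
have XQ : X *m Q = r *: Q by apply: projector_eigenl.
have YQ : Y *m Q = s *: Q by rewrite /Q projectorC //; apply: projector_eigenl.
rewrite {1}/Q /projector -mulmxA [(Y - _) *m Q]mulmxBl YQ mul_scalar_mx -scalerBl.
by rewrite -scalemxAr mulmxBl XQ mul_scalar_mx -scalerBl scalerA mulrC.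
Qed.

(** Lagrange interpolation at the eigenvalues. *)
Lemma projector_sum X Y r r' s s' :
  projector X Y r' s' - projector X Y r' s - projector X Y r s' + projector X Y r s
  = ((r - r') * (s - s'))%:M.
Proof.
rewrite !projectorE; move: (X *m Y) => XY; apply/matrixP=> i k; rewrite !mxE.
by case: (i == k); ring.
Qed.

End EigenProjector.

(** If [Q] is an eigenvector of [phi L] on the right then [Q M_m(K)] is spanned by the
    images of a basis of [A] over [L]. *)
Lemma split_rank (F : fieldType) (A : falgType F) (K : fieldType)
    (iota : {rmorphism F -> K}) (m : nat) (phi : A -> 'M[K]_m) (L : {vspace A}) r
    (b : 'I_r -> A) (Q : 'M[K]_m) :
  is_splitting iota phi ->
  (forall x, exists l : {ffun 'I_r -> subvs_of L}, x = \sum_j vsval (l j) * b j) ->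
  (forall l, l \in L -> exists k, Q *m phi l = k *: Q) ->
  (\rank Q * m <= r)%N.
Proof.
move=> sp gen eig; pose V := row_base Q; pose U := col_base Q.
have Vfree : row_free V by apply: row_base_free.
have Ufull : row_full U by apply: col_base_full.
pose f : 'M[K]_(\rank Q, m) -> 'M[K]_m := mulmx Q \o mulmx (pinvmx V).
have fE N : f N = U *m N.
  by rewrite /f /= -{1}(mulmx_base Q) -mulmxA [V *m (_ *m N)]mulmxA mulmxVp // mul1mx.
have f_lin : linear f.
  by move=> k N N'; rewrite !fE mulmxDr -scalemxAr.
pose fl := linfun (HB.pack_for {linear _ -> _} f (GRing.isLinear.Build _ _ _ _ f f_lin)).
have flE N : fl N = f N by rewrite lfunE.
have <- : \dim (fl @: fullv) = (\rank Q * m)%N.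
  rewrite limg_dim_eq ?dimvf //; apply/eqP; rewrite -subv0; apply/subvP=> N.
  rewrite memv_cap memvf memv_ker flE fE => /eqP E; rewrite memv0; apply/eqP.
  by apply: (row_full_inj Ufull); rewrite E mulmx0.
apply: leq_trans (_ : \dim <<[seq Q *m phi (b j) | j <- enum 'I_r]>> <= r)%N; last first.
  by apply: leq_trans (dim_span _) _; rewrite size_map size_enum_ord.
apply/dimvS/subvP=> _ /memv_imgP[N _ ->]; rewrite flE /f /=; move: (_ *m N) => M.
have [c ->] := split_span sp M; rewrite mulmx_sumr; apply: memv_suml => i _.
rewrite -scalemxAr memvZ //; have [l ->] := gen (vbasis {:A})`_i.
rewrite (split_sum sp) mulmx_sumr; apply: memv_suml => k _.
rewrite (split_M sp) mulmxA; have [e ->] := eig _ (subvsP (l k)).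
rewrite -scalemxAl memvZ //; apply: memv_span.
by apply: (map_f (fun j => Q *m phi (b j))); rewrite mem_enum.
Qed.

Lemma sym_part_congruent (K : fieldType) (m k : nat) (eps : K) (M : 'M[K]_m)
    (U : 'M[K]_(m, k)) :
  U^T *m sym_part eps M *m U = sym_part eps (U^T *m M *m U).
Proof.
rewrite /sym_part mulmxDr mulmxDl -scalemxAr -scalemxAl !trmx_mul trmxK.
by rewrite mulmxA.
Qed.

Lemma alternating2 (K : fieldType) (M : 'M[K]_2) :
  sym_part (-1) M = (M 0 1 - M 1 0) *: (delta_mx 0 1 - delta_mx 1 0).
Proof.
apply/matrixP=> i k; rewrite /sym_part !mxE.
have cases (x : 'I_2) : x = 0 \/ x = 1.
  by case: x => -[|[|//]] ?; [left|right]; apply: val_inj.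
by case: (cases i) => ->; case: (cases k) => -> /=; ring.
Qed.

(** A matrix of rank at most two, self-adjoint for an alternating form, compresses
    symmetrised elements to scalars because alternating matrices of order two are
    proportional. *)
Lemma compression_scalar (K : fieldType) (m : nat) (eps : K) (B Q S : 'M[K]_m) (M M1 : 'M[K]_m)
    (th : K) :
  B \in unitmx -> Q^T *m B = B *m Q -> Q *m Q = th *: Q -> th != 0 ->
  B *m S = sym_part eps M -> B = sym_part eps M1 ->
  (\rank Q <= 1)%N \/ (\rank Q <= 2)%N /\ eps = -1 ->
  exists k, Q *m S *m Q = k *: Q.
Proof.
move=> Bu QB QQ th0 BS B1 rk.
case: (posnP (\rank Q)) => [/eqP|rk_gt0].
  by rewrite mxrank_eq0 => /eqP->; exists 0; rewrite mul0mx mul0mx scaler0.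
have UV := mulmx_base Q; move: (col_base Q) (row_base Q) UV rk rk_gt0.
move: (\rank Q) => k U V UV rk k_gt0.
have EQ T : Q *m T *m Q = U *m (V *m T *m U) *m V by rewrite -UV !mulmxA.
have [k1|[k2 e1]] : k = 1%N \/ k = 2%N /\ eps = -1.
- case: rk => [h|[h e]]; first by left; lia.
  have [h1|h1] : k = 1%N \/ k = 2%N by lia.
    by left.
  by right.
- subst k; exists ((V *m S *m U) 0 0); rewrite EQ.
  by rewrite {1}[V *m S *m U]mx11_scalar mul_mx_scalar -scalemxAl UV.
subst k eps.
have Binj T T' : B *m T = B *m T' -> T = T'.
  by move/(congr1 (mulmx (invmx B))); rewrite !mulKmx.
have BQ T : B *m (Q *m T *m Q) = V^T *m (U^T *m (B *m T) *m U) *m V.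
  by rewrite -mulmxA mulmxA -QB -UV trmx_mul !mulmxA.
have BS' := BQ S; have B1' := BQ 1%:M.
rewrite BS sym_part_congruent alternating2 -scalemxAr -scalemxAl in BS'.
rewrite mulmx1 mulmx1 [in RHS]B1 sym_part_congruent alternating2 in B1'.
rewrite -scalemxAr -scalemxAl QQ in B1'.
move: (_ - _) BS' => c BS'; move: (_ - _) B1' => c0 B1'.
have [c00|c0n] := eqVneq c0 0.
  exists 0; rewrite scale0r; suff -> : Q = 0 by rewrite mulmx0.
  apply: (scalerI th0); rewrite scaler0; apply: Binj.
  by rewrite B1' c00 scale0r mulmx0.
exists (c / c0 * th); apply: Binj; rewrite BS' -scalerA -scalemxAr B1' scalerA.
by rewrite divfK.
Qed.

Section SplitCentralizer.

Variables (F : fieldType) (A : falgType F) (sigma : 'End(A)) (L : {vspace A}).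
Variables (g : 'I_3 -> 'End(A)) (a : 'I_3 -> A).
Hypothesis kd : klein_data sigma L g a.
Hypotheses (dimL : \dim L = 4%N) (one_symd : 1 \in symd sigma).
Hypothesis freeL : free_left_module L.

(** A basis of [A] over [L] identifies [A] with [L^r]. *)
Lemma free_module_rank : exists r (b : 'I_r -> A), (r * 4)%N = \dim {:A} /\
  forall x, exists l : {ffun 'I_r -> subvs_of L}, x = \sum_j vsval (l j) * b j.
Proof.
have [r [b bP]] := freeL; exists r, b; split; last first.
  by move=> x; have [l [lx _]] := bP x; exists l.
pose f (l : {ffun 'I_r -> subvs_of L}) := \sum_j vsval (l j) * b j.
have f_lin : linear f.
  move=> k l l'; rewrite /f scaler_sumr -big_split; apply: eq_bigr => j _ /=.
  by rewrite !ffunE linearD linearZ /= mulrDl -scalerAl.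
pose fl := linfun (HB.pack_for {linear {ffun 'I_r -> subvs_of L} -> A} f
  (GRing.isLinear.Build _ _ _ _ f f_lin)).
have flE l : fl l = f l by rewrite lfunE.
have <- : limg fl = fullv.
  apply/vspaceP=> x; rewrite memvf; have [l [-> _]] := bP x.
  by apply/memv_imgP; exists l; rewrite ?memvf ?flE.
rewrite limg_dim_eq ?dimvf; first by rewrite /dim /= card_ord /dim /= -dimL.
apply/eqP; rewrite -subv0; apply/subvP=> l.
rewrite memv_cap memvf memv_ker flE => /eqP E; rewrite memv0; apply/eqP.
have [l0 [_ uniq]] := bP 0; rewrite -(uniq l) ?E //; apply/esym/esym.
by apply: uniq; rewrite big1 // => j _; rewrite ffunE linear0 mul0r.
Qed.

(** A symmetrised element commuting with [L] acts as a scalar on each of the four joint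
    eigenspaces of two generators of [L], hence lies in the span of [L] over the
    splitting field. *)
Lemma split_symd_centralizer (K : fieldType) (iota : {rmorphism F -> K}) (m : nat)
    (phi : A -> 'M[K]_m) (B : 'M[K]_m) (eps : K) (r r' s s' : K) (i j : 'I_3) tr nr ts ns :
  i != j -> is_splitting iota phi -> B \in unitmx -> adjoint_over sigma phi B ->
  eps * eps = 1 -> B^T = eps *: B ->
  m = 4%N \/ m = 8%N /\ eps = -1 ->
  a i + conj_gen g a i = tr%:A -> a i * conj_gen g a i = nr%:A ->
  a j + conj_gen g a j = ts%:A -> a j * conj_gen g a j = ns%:A ->
  r + r' = iota tr -> r * r' = iota nr -> s + s' = iota ts -> s * s' = iota ns ->
  r != r' -> s != s' ->
  forall x, x \in symd sigma -> twisted L (gal g None) x -> x \in L.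
Proof.
move=> ij sp Bu adj eps2 Bs m48 tr1 nr1 ts1 ns1 tr2 nr2 ts2 ns2 rr ss x xS xC.
have phiA k : phi k%:A = (iota k)%:M by rewrite (split_Z sp) (split_1 sp) scale_scalar_mx mulr1.
have sq k t n p q : a k + conj_gen g a k = t%:A -> a k * conj_gen g a k = n%:A ->
    p + q = iota t -> p * q = iota n ->
    phi (a k) *m phi (a k) = (p + q) *: phi (a k) - (p * q)%:M.
  move=> E1 E2 -> ->; rewrite -(split_M sp) -phiA -(split_Z sp).
  have -> : t *: a k = a k * a k + n%:A by rewrite -E2 -mulrDr E1 -scalerAr mulr1.
  by rewrite (split_D sp) addrK.
pose X := phi (a i); pose Y := phi (a j).
have aC : a i * a j = a j * a i by apply: (kd_C kd); apply: (kd_aL kd).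
have XY : X *m Y = Y *m X by rewrite -!(split_M sp) aC.
have [R [b [R4 genA]]] := free_module_rank; rewrite (split_dim sp) in R4.
have factor (Z T : 'M[K]_m) (c : K) : Z *m T = T *m Z -> Z *m (T - c%:M) = (T - c%:M) *m Z.
  by move=> ZT; rewrite mulmxBr mulmxBl ZT scalar_mxC.
have key r0 r1 s0 s1 : r0 + r1 = iota tr -> r0 * r1 = iota nr ->
    s0 + s1 = iota ts -> s0 * s1 = iota ns -> r0 != r1 -> s0 != s1 ->
    exists k, phi x *m projector X Y r1 s1 = k *: projector X Y r1 s1.
  move=> h1 h2 h3 h4 r01 s01; pose Q := projector X Y r1 s1; rewrite -/Q.
  have X2 : X *m X = (r0 + r1) *: X - (r0 * r1)%:M by apply: (sq _ _ _ _ _ tr1 nr1).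
  have Y2 : Y *m Y = (s0 + s1) *: Y - (s0 * s1)%:M by apply: (sq _ _ _ _ _ ts1 ns1).
  have XQ : X *m Q = r0 *: Q by apply: projector_eigenl.
  have YQ : Y *m Q = s0 *: Q by rewrite /Q (projectorC _ _ XY); apply: projector_eigenl.
  have QC Z : Z *m X = X *m Z -> Z *m Y = Y *m Z -> Z *m Q = Q *m Z.
    move=> ZX ZY; rewrite /Q /projector mulmxA (factor _ _ _ ZX) -mulmxA.
    by rewrite (factor _ _ _ ZY) mulmxA.
  have rankQ : (\rank Q * m <= R)%N.
    apply: (split_rank sp genA) => l lL.
    have lC k : phi l *m phi (a k) = phi (a k) *m phi l.
      by rewrite -!(split_M sp) (kd_C kd lL (kd_aL kd k)).
    rewrite -(QC _ (lC i) (lC j)).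
    have [p [q [u [v ->]]]] := kd_decomp kd ij lL.
    exists (iota p + iota q * r0 + iota u * s0 + iota v * r0 * s0).
    rewrite !(split_D sp) phiA !(split_Z sp) (split_M sp) -/X -/Y !mulmxDl.
    by rewrite mul_scalar_mx -!scalemxAl -mulmxA XQ -scalemxAr YQ !scalerA !scalerDl.

  have QQ := projector_sq XY X2 Y2; rewrite -/Q in QQ.
  have th0 : (r0 - r1) * (s0 - s1) != 0 by rewrite mulf_neq0 ?subr_eq0.
  have QB : Q^T *m B = B *m Q.
    have fB k c : (phi (a k) - c%:M)^T *m B = B *m (phi (a k) - c%:M).
      rewrite linearB /= tr_scalar_mx mulmxBl mulmxBr scalar_mxC; congr (_ - _).
      by rewrite adj (kd_s kd (kd_aL kd k)).
    rewrite {1}/Q /projector trmx_mul -mulmxA fB mulmxA fB -mulmxA; congr (_ *m _).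
    by rewrite /Q (projectorC _ _ XY).
  have /symdP[y xy] := xS; have /symdP[z oz] := one_symd.
  have BS : B *m phi x = sym_part eps (B *m phi y).
    by rewrite xy (adjoint_symd sp adj eps2 Bs).
  have B1 : B = sym_part eps (B *m phi z).
    by rewrite -(adjoint_symd sp adj eps2 Bs) -oz (split_1 sp) mulmx1.
  have rk : (\rank Q <= 1)%N \/ (\rank Q <= 2)%N /\ eps = -1.
    case: m48 => [m4|[m8 e1]]; [left|right; split=> //].
      by move: (\rank Q) rankQ R4 => k; rewrite m4; lia.
    by move: (\rank Q) rankQ R4 => k; rewrite m8; lia.
  have [k kE] := compression_scalar Bu QB QQ th0 BS B1 rk.
  have SQ : phi x *m Q = Q *m phi x.
    have SC l : phi x *m phi (a l) = phi (a l) *m phi x.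
      by rewrite -!(split_M sp) (xC _ (kd_aL kd l)) /= id_lfunE.
    exact: QC (SC i) (SC j).
  exists (k / ((r0 - r1) * (s0 - s1))); apply: (scalerI th0).
  rewrite scalerA [_ * (k / _)]mulrC divfK // -kE -SQ -mulmxA QQ.
  by rewrite -scalemxAr.
pose spanL M := exists p q u v : K,
  M = p%:M + q *: X + u *: Y + v *: phi (a j * a i).
have spanD M N : spanL M -> spanL N -> spanL (M + N).
  case=> p [q [u [v ->]]] [p' [q' [u' [v' ->]]]].
  exists (p + p'), (q + q'), (u + u'), (v + v').
  by rewrite raddfD !scalerDl [LHS](AC (4*4) ((1*5)*(2*6)*(3*7)*(4*8))).
have spanP k r1 s1 : spanL (k *: projector X Y r1 s1).
  exists (k * (r1 * s1)), (- (k * s1)), (- (k * r1)), k.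
  rewrite projectorE -(split_M sp) -aC !scalerDr !scalerN !scalerA scale_scalar_mx.
  by rewrite !scaleNr [LHS](AC (1*1*1*1) ((4*2)*3*1)).
have [k1 E1] := key _ _ _ _ tr2 nr2 ts2 ns2 rr ss.
rewrite eq_sym in rr; rewrite addrC in tr2; rewrite mulrC in nr2.
have [k3 E3] := key _ _ _ _ tr2 nr2 ts2 ns2 rr ss.
rewrite eq_sym in ss; rewrite addrC in ts2; rewrite mulrC in ns2.
have [k4 E4] := key _ _ _ _ tr2 nr2 ts2 ns2 rr ss.
rewrite eq_sym in rr; rewrite addrC in tr2; rewrite mulrC in nr2.
have [k2 E2] := key _ _ _ _ tr2 nr2 ts2 ns2 rr ss.
have [p [q [u [v E]]]] : spanL (((r - r') * (s - s')) *: phi x).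
  rewrite -mul_mx_scalar -(projector_sum X Y) mulmxDr !mulmxBr E1 E2 E3 E4.
  by rewrite -!scaleNr; do 3! (apply: (spanD _ _ _ (spanP _ _ _))).
(* Otherwise [E] is a relation over [K] between elements independent over [F]. *)
case: (boolP (x \in L)) => // xL; exfalso.
have xfree : free [tuple x; 1; a i; a j; a j * a i].
  rewrite /= free_cons; apply/andP; split.
    apply: contra xL; apply/subvP/span_subvP => y; rewrite !inE.
    have aL := kd_aL kd.
    by case/or4P=> /eqP ->; rewrite ?(kd_1 kd) ?aL // (kd_M kd).
  suff : free [tuple 1; a i; a j; a j * a i] by [].
  apply/freeP=> c; rewrite !big_ord_recl big_ord0 addr0 /= !addrA => c0.
  have [h1 h2 h3 h4] := kd_indep kd ij c0.
  by case=> -[|[|[|[|//]]]] k; [rewrite -h1|rewrite -h2|rewrite -h3|rewrite -h4];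
    congr (c _); apply: val_inj.
pose c (l : 'I_5) := nth 0 [:: - ((r - r') * (s - s')); p; q; u; v] l.
have := split_free sp (c := c) xfree; rewrite !big_ord_recl big_ord0 addr0 /=.
rewrite /c /= scaleNr E (split_1 sp) scalemx1 -/X -/Y !addrA => /(_ _ ord0) /=.
have -> : - (p%:M + q *: X + u *: Y + v *: phi (a j * a i)) + p%:M + q *: X + u *: Y
    + v *: phi (a j * a i) = 0.
  by rewrite -!addrA addNr.
move/(_ (erefl _))/eqP; rewrite oppr_eq0 mulf_eq0 !subr_eq0 [s == _]eq_sym.
by rewrite (negPf rr) (negPf ss).
Qed.

End SplitCentralizer.

(** ** Involutions of the first kind *)

Lemma trace_nondegenerate (K : fieldType) (m : nat) (M : 'M[K]_m) :
  (forall X : 'M[K]_m, \tr (X *m M) = 0) -> M = 0.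
Proof.
move=> tr0; apply/matrixP=> i j; rewrite mxE -(tr0 (delta_mx j i)).
rewrite -(mul_delta_mx (0 : 'I_1)) -mulmxA mxtrace_mulC -mulmxA /mxtrace.
by rewrite big_ord1 mulmxA -rowE -colE !mxE.
Qed.

Section FirstKind.

Variables (F : fieldType) (A : falgType F) (sigma : 'End(A)) (L : {vspace A}).
Variables (g : 'I_3 -> 'End(A)) (a : 'I_3 -> A).
Hypothesis kd : klein_data sigma L g a.
Hypotheses (dimL : \dim L = 4%N) (one_symd : 1 \in symd sigma).
Hypothesis freeL : free_left_module L.
Hypotheses (hA : algebra_with_involution sigma) (Z1 : 'Z({:A})%VS = 1%VS).

Lemma central_independent i j (z : 'I_4 -> A) : i != j ->
  (forall n, z n \in 'Z({:A})%VS) ->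
  z 0 + a i * z 1 + a j * z 2%:R + a j * a i * z 3%:R = 0 -> forall n, z n = 0.
Proof.
move=> ij zZ; have zF n : exists c : F, z n = c%:A.
  by apply/vlineP; rewrite -Z1.
have [p Ep] := zF 0; have [q Eq] := zF 1.
have [u Eu] := zF 2%:R; have [v Ev] := zF 3%:R.
rewrite Ep Eq Eu Ev !mulr_algr => E; have [p0 q0 u0 v0] := kd_indep kd ij E.
suff : [/\ z 0 = 0, z 1 = 0, z 2%:R = 0 & z 3%:R = 0].
  case=> h0 h1 h2 h3 [[|[|[|[|//]]]] lt];
    [rewrite -h0|rewrite -h1|rewrite -h2|rewrite -h3]; congr (z _); exact: val_inj.
by rewrite Ep Eq Eu Ev p0 q0 u0 v0 scale0r.
Qed.

Section Split.

Variables (K : fieldType) (iota : {rmorphism F -> K}) (m : nat) (phi : A -> 'M[K]_m).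
Variables (B : 'M[K]_m) (eps : K) (d : bool).
Hypotheses (sp : is_splitting iota phi) (Bu : B \in unitmx).
Hypothesis adj : adjoint_over sigma phi B.
Hypotheses (eps2 : eps * eps = 1) (eps_d : if d then eps = -1 else 1 + eps != 0).
Hypotheses (Bs : B^T = eps *: B) (m48 : m = 4%N \/ m = 8%N /\ eps = -1).

(** Adjoining the eigenvalues of two generators of [L] preserves the splitting. *)
Lemma first_kind_centralizer x :
  x \in symd sigma -> twisted L (gal g None) x -> x \in L.
Proof.
have [t0 [n0 [e0 [tE0 nE0 dE0 e00]]]] := quad_rel kd 0.
have [t1 [n1 [e1 [tE1 nE1 dE1 e10]]]] := quad_rel kd 1.
have [K1 [j1 [r [r' [rs rp]]]]] := quadratic_splits (iota t0) (iota n0).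
have [K2 [j2 [s [s' [ss sp']]]]] := quadratic_splits (j1 (iota t1)) (j1 (iota n1)).
have sp2 := splitting_extension j2 (splitting_extension j1 sp).
have Bs2 : (map_mx j2 (map_mx j1 B))^T = j2 (j1 eps) *: map_mx j2 (map_mx j1 B).
  by rewrite !map_trmx Bs !map_mxZ.
have adj2 : adjoint_over sigma (fun x => map_mx j2 (map_mx j1 (phi x)))
    (map_mx j2 (map_mx j1 B)).
  by move=> y; rewrite !map_trmx -!map_mxM adj.
have ee : j2 (j1 eps) * j2 (j1 eps) = 1 by rewrite -!rmorphM eps2 !rmorph1.
have disc k t n e : a k + conj_gen g a k = t%:A -> a k * conj_gen g a k = n%:A ->
    gap g a k * gap g a k = e%:A -> e = t ^+ 2 - 4%:R * n.
  move=> E1 E2; have cE : conj_gen g a k = t%:A - a k by rewrite -E1 addrC addKr.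
  have gg : a k ^+ 2 = t *: a k - n%:A.
    by rewrite -E2 cE mulrBr mulr_algr opprB addrC subrK.
  rewrite /gap cE opprB addrA -mulr2n -scaler_nat (sq_disc gg) => E3.
  apply/eqP; rewrite eq_sym -subr_eq0; apply/negPn/negP => nz.
  case/eqP: (oner_neq0 A); apply: (scalerI nz).
  by rewrite scaler0 scalerBl E3 subrr.
have distinct (K' : fieldType) (f : {rmorphism F -> K'}) k t n e p q :
    a k + conj_gen g a k = t%:A -> a k * conj_gen g a k = n%:A ->
    gap g a k * gap g a k = e%:A -> e != 0 -> p + q = f t -> p * q = f n -> p != q.
  move=> E1 E2 E3 en0 pq1 pq2; apply: contra en0 => /eqP pq.
  rewrite -(fmorph_eq0 f) (disc _ _ _ _ E1 E2 E3) rmorphB /= rmorphXn /= [f (_ * n)]rmorphM rmorph_nat.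
  by rewrite -pq1 -pq2 pq; apply/eqP; ring.
have rs' : j2 r + j2 r' = j2 (j1 (iota t0)) by rewrite -rmorphD rs.
have rp' : j2 r * j2 r' = j2 (j1 (iota n0)) by rewrite -rmorphM rp.
apply: (split_symd_centralizer kd dimL one_symd freeL (i := 0) (j := 1) isT sp2
  _ adj2 ee Bs2 _ tE0 nE0 tE1 nE1 rs' rp' ss sp').
- by rewrite !map_unitmx.
- by case: m48 => [|[-> ->]]; [left|right]; rewrite // !rmorphN !rmorph1.
- exact: (distinct _ (j2 \o (j1 \o iota) : {rmorphism F -> K2}) _ _ _ _ _ _ tE0 nE0 dE0 e00 rs' rp').
- exact: (distinct _ (j2 \o (j1 \o iota) : {rmorphism F -> K2}) _ _ _ _ _ _ tE1 nE1 dE1 e10 ss sp').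
Qed.

Lemma first_kind_nondegenerate i x : twisted L (gal g (Some i)) x ->
  (forall b, twisted L (gal g (Some i)) b -> b * x + sigma (b * x) = 0) -> x = 0.
Proof.
move=> xt bx; have meet := involution_ideals_meet_center hA.
have [two0|two0] := eqVneq (2%:R : F) 0.
  exact: (nondegenerate_char2 kd one_symd meet central_independent two0 Z1 bx).
apply: (nondegenerate_trace kd (T := fun y => \tr (phi y)) _ _ _ _ _ xt bx).
- by rewrite -(rmorph_nat iota) fmorph_eq0.
- by move=> y z; rewrite (split_D sp) linearD.
- by move=> y z; rewrite !(split_M sp) mxtrace_mulC.
- move=> y; have -> : phi (sigma y) = invmx B *m ((phi y)^T *m B).
    by rewrite adj mulKmx.
  by rewrite mxtrace_mulC mulmxK // mxtrace_tr.
move=> y y0; apply: (split_inj sp); apply: trace_nondegenerate => X.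
have [c ->] := split_span sp X; rewrite mulmx_suml linear_sum big1 // => k _.
by rewrite -scalemxAl linearZ /= -(split_M sp) y0 mulr0.
Qed.

End Split.

(** The facts about [Symd] from which the three types are treated uniformly. *)
Definition symd_structure (k : nat) : Prop :=
  [/\ forall x, x \in symd sigma -> twisted L (gal g None) x -> x \in L,
      forall i x, twisted L (gal g (Some i)) x ->
        (forall b, twisted L (gal g (Some i)) b -> b * x + sigma (b * x) = 0) -> x = 0
    & \dim (symd sigma) = k].

Lemma orthogonal_conclusion : has_type sigma Orthogonal -> \dim {:A} = 16%N ->
  symd_structure 10.
Proof.
case=> _ [K [iota [m [phi [B [sp Bu [Bs Bd] adj]]]]]] dimA.
have m4 : m = 4%N by move: dimA; rewrite (split_dim sp); nia.
subst m; have two := diagonalisable_char sp Bu adj Bs Bd one_symd isT.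
have Bs1 : B^T = 1 *: B by rewrite scale1r.
have one2 : (1 : K) * 1 = 1 by rewrite mulr1.
have two' : (1 : K) + 1 != 0 by [].
split.
- exact: (first_kind_centralizer sp Bu adj one2 Bs1 (or_introl (erefl _))).
- exact: (first_kind_nondegenerate sp Bu adj).
by rewrite (symd_dim sp Bu adj (d := false) one2 two' Bs1) sym_space_dim ?count_upper4.
Qed.

Lemma symplectic_conclusion : has_type sigma Symplectic -> \dim {:A} = 64%N ->
  symd_structure 28.
Proof.
case=> _ [K [iota [m [phi [B [sp Bu Balt adj]]]]]] dimA.
have m8 : m = 8%N by move: dimA; rewrite (split_dim sp); nia.
subst m; have [_ Bs] := alternating_entries Balt.
have one2 : (-1 : K) * -1 = 1 by rewrite mulrNN mulr1.
split.
- exact: (first_kind_centralizer sp Bu adj one2 Bs (or_intror (conj (erefl _) (erefl _)))).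
- exact: (first_kind_nondegenerate sp Bu adj).
by rewrite (symd_dim sp Bu adj (d := true) one2 (erefl _) Bs) sym_space_dim ?count_strict_upper8.
Qed.

End FirstKind.

(** * Involutions of the second kind *)

Section LeftMultiples.

Variables (F : fieldType) (A : falgType F).

Definition left_multiples (x : A) (V : {vspace A}) : {vspace A} := (amull x @: V)%VS.

Lemma left_multiplesP x (V : {vspace A}) w :
  reflect (exists2 v, v \in V & w = x * v) (w \in left_multiples x V).
Proof.
by apply: (iffP memv_imgP) => -[v vV ->]; exists v; rewrite // lfunE.
Qed.

Lemma mem_left_multiples x (V : {vspace A}) v : v \in V -> x * v \in left_multiples x V.
Proof. by move=> vV; apply/left_multiplesP; exists v. Qed.

End LeftMultiples.

Section SecondKind.

Variables (F : fieldType) (A : falgType F) (sigma : 'End(A)) (L : {vspace A}).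
Variables (g : 'I_3 -> 'End(A)) (a : 'I_3 -> A).
Hypothesis kd : klein_data sigma L g a.
Hypotheses (dimL : \dim L = 4%N) (one_symd : 1 \in symd sigma).
Hypothesis freeL : free_left_module L.
Hypotheses (hA : algebra_with_involution sigma) (unit_type : has_type sigma Unitary).

Let sM := kd_sM kd.
Let sK := kd_sK kd.
Let LM := kd_M kd.
Let LC := kd_C kd.
Let s1 := kd_s1 kd.

Lemma central_symmetric z : z \in 'Z({:A})%VS -> sigma z = z -> exists k : F, z = k%:A.
Proof.
have [_ _ cent _] := hA => zZ sz; apply/vlineP; rewrite -cent memv_cap zZ /=.
exact/fixedSpaceP.
Qed.

Lemma center_sigma z : z \in 'Z({:A})%VS -> sigma z \in 'Z({:A})%VS.
Proof.
move/centerP => zC; apply/centerP => c; apply: (can_inj sK).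
by rewrite !sM sK zC.
Qed.

(** The square of [zeta - sigma zeta] is symmetric and central, hence a scalar; it is not
    zero because the centre is reduced. *)
Lemma center_gen : exists zeta : A, [/\ forall c, zeta * c = c * zeta,
  forall z, z \in 'Z({:A})%VS -> exists p q : F, z = p%:A + q *: zeta
  & exists n e : F, [/\ zeta * sigma zeta = n%:A, e != 0
    & (zeta - sigma zeta) * (zeta - sigma zeta) = e%:A] /\
    exists t : F, zeta + sigma zeta = t%:A].
Proof.
have [[etZ dimZ] [z zZ sz]] := unit_type; exists z.
have zC := centerP _ zZ; have szZ := center_sigma zZ; have szC := centerP _ szZ.
have dZ : \dim 'Z({:A})%VS = 2%N by rewrite -dimZ dim_subvs.
have zF : z \notin 1%VS.
  by apply/negP => /vlineP[k zk]; apply: sz; rewrite zk linearZ /= s1.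
have genZ w : w \in 'Z({:A})%VS -> exists p q : F, w = p%:A + q *: z.
  have sub : (1 + <[z]> <= 'Z({:A}))%VS.
    rewrite subv_add -!memvE zZ andbT; apply/centerP => c.
    by rewrite mulr1 mul1r.
  have dim2 : \dim (1 + <[z]>)%VS = 2%N.
    rewrite dimv_disjoint_sum ?dimv1 ?dim_vline; last first.
      apply/eqP; rewrite -subv0; apply/subvP=> w'; rewrite memv_cap memv0.
      case/andP=> w1 /vlineP [k wk]; move: w1; rewrite wk.
      have [->|k0] := eqVneq k 0; first by rewrite scale0r.
      by move/(memvZ k^-1); rewrite scalerA mulVf // scale1r (negPf zF).
    have z0 : z != 0 by apply: contraNneq zF => ->; rewrite mem0v.
    by rewrite z0.
  have -> : 'Z({:A})%VS = (1 + <[z]>)%VS.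
    by apply/esym/eqP; rewrite eqEdim sub dZ dim2.
  move/memv_addP=> [u uF [v vF ->]]; have /vlineP[p ->] := uF.
  by have /vlineP[q ->] := vF; exists p, q.
have MZ u v : u \in 'Z({:A})%VS -> v \in 'Z({:A})%VS -> u * v \in 'Z({:A})%VS.
  move=> /centerP uC /centerP vC; apply/centerP => c.
  by rewrite -mulrA vC mulrA uC mulrA.
have [n nE] : exists n : F, z * sigma z = n%:A.
  by apply: central_symmetric; rewrite ?MZ // sM sK.
have [t tE] : exists t : F, z + sigma z = t%:A.
  by apply: central_symmetric; rewrite ?memvD // linearD /= sK addrC.
have dZm : z - sigma z \in 'Z({:A})%VS by rewrite memvB.
have [e eE] : exists e : F, (z - sigma z) * (z - sigma z) = e%:A.
  apply: central_symmetric; rewrite ?MZ // sM linearB /= sK -opprB.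
  by rewrite mulrNN.
split=> //; exists n, e; split; last by exists t.
split=> //; apply/eqP => e0; case: sz; apply/esym/eqP; rewrite -subr_eq0.
have d0 : vsproj 'Z({:A})%AS (z - sigma z) = 0.
  apply: (etale_reduced etZ); apply: subvs_inj.
  by rewrite vsval_mul vsprojK // eE e0 scale0r linear0.
by rewrite -(vsprojK dZm) d0 linear0.
Qed.

Section CentralGenerator.

Variables (zeta : A) (n e t : F).
Hypothesis zC : forall c, zeta * c = c * zeta.
Hypothesis zGen : forall z, z \in 'Z({:A})%VS -> exists p q : F, z = p%:A + q *: zeta.
Hypotheses (zn : zeta * sigma zeta = n%:A) (zt : zeta + sigma zeta = t%:A).
Hypotheses (e0 : e != 0) (ze : (zeta - sigma zeta) * (zeta - sigma zeta) = e%:A).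
Local Notation del := (zeta - sigma zeta).

Lemma conj_zeta : sigma zeta = t%:A - zeta.
Proof. by rewrite -zt addrC addKr. Qed.

Lemma szC c : sigma zeta * c = c * sigma zeta.
Proof. by rewrite conj_zeta mulrBl mulrBr mulr_algl mulr_algr zC. Qed.

Lemma del_reg y : del * y = 0 -> y = 0.
Proof.
move=> dy; apply: (scalerI e0); rewrite scaler0 -[LHS]mulr_algl -ze -mulrA dy.
exact: mulr0.
Qed.

Lemma sigma_del : sigma del = - del.
Proof. by rewrite linearB /= sK opprB. Qed.

Lemma delC c : del * c = c * del.
Proof. by rewrite mulrBl mulrBr zC szC. Qed.

(** The two conjugate equations [p + zeta q = 0] and [p + sigma zeta q = 0] differ by a
    regular multiple of [q]. *)
Lemma symmetric_independent p q : sigma p = p -> sigma q = q -> p + zeta * q = 0 ->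
  p = 0 /\ q = 0.
Proof.
move=> sp sq E; have q0 : q = 0.
  apply: del_reg; have := congr1 sigma E; rewrite linearD /= sM sp sq linear0 -szC => E'.
  rewrite mulrBl; apply/eqP; rewrite subr_eq0; apply/eqP; apply: (addrI p).
  by rewrite E E'.
by split=> //; move: E; rewrite q0 mulr0 addr0.
Qed.

(** The centre contains an element of trace 1. *)
Lemma symmetric_symd x : sigma x = x -> x \in symd sigma.
Proof.
move=> sx; have [c [cC c1]] : exists c, (forall y, c * y = y * c) /\ c + sigma c = 1.
  have [t0|t0] := eqVneq t 0.
    have two : 2%:R != 0 :> F.
      apply: contraNneq e0 => two; have /eqP : e%:A = 0 :> A.
        rewrite -ze conj_zeta t0 scale0r sub0r opprK -mulr2n -scaler_nat two.
        by rewrite scale0r mul0r.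
      by rewrite scaler_eq0 oner_eq0 orbF.
    exists (2%:R^-1)%:A; split=> [y|]; first by rewrite mulr_algl mulr_algr.
    rewrite linearZ /= s1 -scalerDl -mulr2n -[_ *+ 2]mulr_natl divff //.
    by rewrite scale1r.
  exists (t^-1 *: zeta); split=> [y|]; first by rewrite -scalerAl -scalerAr zC.
  by rewrite linearZ /= -scalerDr zt scalerA mulVf // scale1r.
apply/symdP; exists (c * x); rewrite sM sx.
have scC : x * sigma c = sigma c * x by rewrite -{1}sx -sM cC sM sx.
by rewrite scC -mulrDl c1 mul1r.
Qed.

(** Multiplication by [zeta - sigma zeta] exchanges symmetric and skew elements. *)
Lemma second_kind_symd_dim : (\dim (symd sigma) * 2)%N = \dim {:A}.
Proof.
pose kr := lker (\1%VF + sigma).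
have krP x : (x \in kr) = (sigma x == - x).
  by rewrite memv_ker add_lfunE id_lfunE addrC addr_eq0.
have inj (V : {vspace A}) : \dim (left_multiples del V) = \dim V.
  apply: limg_dim_eq; apply/eqP; rewrite -subv0; apply/subvP=> x.
  rewrite memv_cap memv_ker memv0 => /andP[_]; rewrite lfunE /= => /eqP dx.
  by rewrite (del_reg dx).
have E : \dim kr = \dim (symd sigma).
  apply/eqP; rewrite eqn_leq -{1}(inj kr) -{2}(inj (symd sigma)).
  apply/andP; split; apply/dimvS/subvP=> _ /left_multiplesP[x xV ->].
    apply: symmetric_symd; move: xV; rewrite krP => /eqP sx.
    by rewrite sM sigma_del sx mulrNN delC.
  by rewrite krP sM sigma_del (symd_sigma kd xV) mulrN delC.
rewrite muln2 -addnn -{1}E -(limg_ker_dim (\1%VF + sigma) fullv).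
by rewrite capfv.
Qed.

Lemma second_kind_independent i j (z : 'I_4 -> A) : i != j ->
  (forall k, z k \in 'Z({:A})%VS) ->
  z 0 + a i * z 1 + a j * z 2%:R + a j * a i * z 3%:R = 0 -> forall k, z k = 0.
Proof.
move=> ij zZ E.
have [p0 [q0 E0]] := zGen (zZ 0); have [p1 [q1 E1]] := zGen (zZ 1).
have [p2 [q2 E2]] := zGen (zZ 2%:R); have [p3 [q3 E3]] := zGen (zZ 3%:R).
pose P := p0%:A + p1 *: a i + p2 *: a j + p3 *: (a j * a i).
pose Q := q0%:A + q1 *: a i + q2 *: a j + q3 *: (a j * a i).
have aL := kd_aL kd.
have inL (x0 x1 x2 x3 : F) : x0%:A + x1 *: a i + x2 *: a j + x3 *: (a j * a i) \in L.
  by rewrite !memvD // memvZ ?(kd_1 kd) ?LM.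
have PQ : P + zeta * Q = 0.
  rewrite -E E0 E1 E2 E3 /P /Q !mulrDr !mulr_algr -!scalerAr ![zeta * _]zC.
  by rewrite [LHS](AC (4*4) ((1*5)*(2*6)*(3*7)*(4*8))).
have [P0 Q0] := symmetric_independent (kd_s kd (inL _ _ _ _)) (kd_s kd (inL _ _ _ _)) PQ.
have [h0 h1 h2 h3] := kd_indep kd ij P0; have [k0 k1 k2 k3] := kd_indep kd ij Q0.
suff : [/\ z 0 = 0, z 1 = 0, z 2%:R = 0 & z 3%:R = 0].
  case=> l0 l1 l2 l3 [[|[|[|[|//]]]] lt];
    [rewrite -l0|rewrite -l1|rewrite -l2|rewrite -l3]; congr (z _); exact: val_inj.
rewrite E0 E1 E2 E3 h0 h1 h2 h3 k0 k1 k2 k3.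
by rewrite !scale0r addr0.
Qed.

(** ** The commutative algebra generated by [L] and the centre *)

Definition central_extension : {vspace A} := (L + left_multiples zeta L)%VS.
Local Notation R := central_extension.

Lemma RP x : reflect (exists p q, [/\ p \in L, q \in L & x = p + zeta * q]) (x \in R).
Proof.
apply: (iffP memv_addP) => [[p pL [_ /left_multiplesP[q qL ->] ->]]|[p [q [pL qL ->]]]].
  by exists p, q.
by exists p => //; exists (zeta * q); rewrite ?mem_left_multiples.
Qed.

Lemma L_R y : y \in L -> y \in R.
Proof. by move=> yL; apply/RP; exists y, 0; rewrite mem0v mulr0 addr0. Qed.

Lemma zeta_R y : y \in L -> zeta * y \in R.
Proof. by move=> yL; apply/RP; exists 0, y; rewrite mem0v add0r. Qed.

Lemma zeta_sq : zeta * zeta = t *: zeta - n%:A.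
Proof. by rewrite -zn conj_zeta mulrBr mulr_algr opprB addrC subrK. Qed.

Lemma R_mul x y : x \in R -> y \in R -> x * y \in R.
Proof.
move=> /RP[p [q [pL qL ->]]] /RP[p' [q' [pL' qL' ->]]].
rewrite mulrDl !mulrDr -!mulrA !memvD //; first by rewrite L_R ?LM.
- by rewrite mulrA -zC -mulrA zeta_R ?LM.
- by rewrite zeta_R ?LM.
rewrite [q * _]mulrA -zC !mulrA zeta_sq !mulrBl -!scalerAl mul1r -!mulrA.
by rewrite memvB // memvZ ?zeta_R ?L_R ?LM.
Qed.

Lemma R_C x y : x \in R -> (forall l, l \in L -> l * y = y * l) -> x * y = y * x.
Proof.
move=> /RP[p [q [pL qL ->]]] yC.
by rewrite mulrDl mulrDr (yC _ pL) -[zeta * q * y]mulrA (yC _ qL) !mulrA (zC y).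
Qed.

Lemma R_comm x y : x \in R -> y \in R -> x * y = y * x.
Proof.
move=> xR yR; apply: R_C => // l lL; apply/esym; apply: R_C => // l' lL'.
by rewrite LC.
Qed.

Lemma R_sigma x : x \in R -> sigma x \in R.
Proof.
move=> /RP[p [q [pL qL ->]]].
rewrite linearD /= sM (kd_s kd pL) (kd_s kd qL) -szC conj_zeta mulrBl mulr_algl.
by rewrite memvD ?memvB ?memvZ ?zeta_R ?L_R.
Qed.

Lemma R_sym x : x \in R -> sigma x = x -> x \in L.
Proof.
move=> /RP[p [q [pL qL ->]]]; rewrite linearD /= sM (kd_s kd pL) (kd_s kd qL) -szC.
move/addrI/eqP; rewrite eq_sym -subr_eq0 -mulrBl => /eqP/del_reg->.
by rewrite mulr0 addr0.
Qed.

(** If [x^2 = 0], the symmetric elements [x sigma x] and [x + sigma x] of [L] are nilpotent,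
    hence zero; so [x] is skew, and [(zeta - sigma zeta) x] is an element of [L] whose square is zero. *)
Lemma R_reduced x : x \in R -> x * x = 0 -> x = 0.
Proof.
move=> xR xx; have sxR := R_sigma xR.
have sxx : sigma x * sigma x = 0 by rewrite -sM xx linear0.
have NL : x * sigma x \in L by apply: R_sym; rewrite ?R_mul // sM sK.
have N0 : x * sigma x = 0.
  apply: (kd_red kd NL); rewrite {1}(R_comm xR sxR) -mulrA [x * (x * _)]mulrA xx.
  by rewrite mul0r mulr0.
have TL : x + sigma x \in L.
  by apply: R_sym; rewrite ?memvD // linearD /= sK addrC.
have T0 : x + sigma x = 0.
  apply: (kd_red kd TL); rewrite mulrDl !mulrDr xx sxx N0 (R_comm sxR xR) N0.
  by rewrite !addr0.
have sx : sigma x = - x by apply/eqP; rewrite -addr_eq0 addrC T0.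
apply: del_reg; apply: (kd_red kd).
  apply: R_sym; last by rewrite sM sx sigma_del mulrNN delC.
  have dR : del \in R.
    by rewrite memvB ?R_sigma // -[zeta]mulr1 zeta_R ?(kd_1 kd).
  exact: R_mul.
by rewrite -mulrA [x * _]mulrA -delC -!mulrA xx !mulr0.
Qed.

Lemma R_1 : 1 \in R.
Proof. exact: L_R (kd_1 kd). Qed.

(** ** Idempotents generating a field *)

Definition field_idempotent (f : A) : Prop :=
  [/\ f \in R, f * f = f, f != 0
    & forall w, w \in R -> f * w != 0 -> exists2 w', w' \in R & w' * (f * w) = f].

(** A nonzero element generating a minimal ideal is a unit times an idempotent. *)
Lemma exists_field_idempotent f : f \in R -> f * f = f -> f != 0 ->
  exists2 h, field_idempotent h & f * h = h.
Proof.
move=> fR ff f0; have [x [xR x0 fx]] : exists x, [/\ x \in R, x != 0 & f * x = x].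
  by exists f.
have [k] := ubnP (\dim (left_multiples x R)).
elim: k x xR x0 fx => // k IH x xR x0 fx; rewrite ltnS => xk.
case: (classic (exists w, [/\ w \in R, x * w != 0
    & (\dim (left_multiples (x * w)%R R) < \dim (left_multiples x R))%N])).
  case=> w [wR xw lt]; apply: (IH (x * w)) => //; rewrite ?R_mul //.
    by rewrite mulrA fx.
  exact: leq_trans lt xk.
move=> minx.
have same w : w \in R -> x * w != 0 -> left_multiples (x * w) R = left_multiples x R.
  move=> wR xw; apply/eqP; rewrite eqEdim; apply/andP; split.
    apply/subvP=> _ /left_multiplesP[u uR ->].
    by rewrite -mulrA mem_left_multiples ?R_mul.
  by rewrite leqNgt; apply/negP => lt; apply: minx; exists w.
have xx : x * x != 0 by apply: contraNneq x0 => /(R_reduced xR)->.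
have : x \in left_multiples (x * x) R.
  by rewrite (same x) // -{1}[x]mulr1 mem_left_multiples ?R_1.
case/left_multiplesP=> y yR xy; have hE : x = x * (x * y) by rewrite mulrA.
exists (x * y); last by rewrite mulrA fx.
split; first exact: R_mul.
- rewrite mulrA [x * y * x](_ : _ = x * (x * y)) -?hE //.
  by rewrite -mulrA (R_comm yR xR).
- by apply: contraNneq x0 => xy0; rewrite hE xy0 mulr0.
move=> w wR; rewrite -mulrA => xyw.
have : x * y \in left_multiples (x * (y * w)) R.
  by rewrite same ?mem_left_multiples ?R_mul.
case/left_multiplesP=> w' wR' E; exists w' => //.
by rewrite [LHS]R_comm ?R_mul.
Qed.

Section FieldIdempotent.

Variable f : A.
Hypothesis fld : field_idempotent f.

Let fR : f \in R. Proof. by case: fld. Qed.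
Let ff : f * f = f. Proof. by case: fld. Qed.
Let f_inv w : w \in R -> f * w != 0 -> exists2 w', w' \in R & w' * (f * w) = f.
Proof. by case: fld => _ _ _; apply. Qed.

(** The span of [s] over the field [f R]. *)
Fixpoint modspan (s : seq A) : {vspace A} :=
  if s is v :: s' then ((amulr v @: left_multiples f R) + modspan s')%VS else 0%VS.

Lemma modspan_ind (P : A -> Prop) s : P 0 -> (forall x y, P x -> P y -> P (x + y)) ->
  (forall w v, w \in R -> v \in s -> P (f * w * v)) -> forall x, x \in modspan s -> P x.
Proof.
move=> P0 PD; elim: s => [|v s IH] Pv x /=.
  by rewrite memv0 => /eqP->.
case/memv_addP=> y /memv_imgP[_ /left_multiplesP[w wR ->] ->] [z zs ->].
apply: PD; first by rewrite lfunE /=; apply: Pv; rewrite ?inE ?eqxx.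
by apply: IH => // w' v' wR' vs; apply: Pv; rewrite ?inE ?vs ?orbT.
Qed.

Lemma modspan_stable s w x : w \in R -> x \in modspan s -> w * x \in modspan s.
Proof.
move=> wR; elim: s x => [|v s IH] x /=.
  by rewrite !memv0 => /eqP->; rewrite mulr0.
case/memv_addP=> y /memv_imgP[_ /left_multiplesP[w' wR' ->] ->] [z zs ->].
rewrite lfunE /= mulrDr memv_add ?IH // !mulrA (R_comm wR fR) -[f * w * w']mulrA.
have := memv_img (amulr v) (mem_left_multiples f (R_mul wR wR')).
by rewrite lfunE.
Qed.

(** A generator outside the span of the others is independent of it, because nonzero
    elements of [f R] are invertible. *)
Lemma modspan_basis s : (forall v, v \in s -> f * v = v) ->
  exists u, [/\ forall v, v \in u -> f * v = v, (modspan s <= modspan u)%VS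
    & \dim (modspan u) = (size u * \dim (left_multiples f R))%N].
Proof.
elim: s => [|v s IH] fs; first by exists [::]; split; rewrite ?subvv ?dimv0.
have [v' vs|u [fu su dimu]] := IH; first by apply: fs; rewrite inE vs orbT.
have fv : f * v = v by apply: fs; rewrite inE eqxx.
have recover w : w \in R -> f * w != 0 -> exists2 w', w' \in R & w' * (f * w * v) = v.
  by move=> wR fw; have [w' wR' E] := f_inv wR fw; exists w'; rewrite // mulrA E.
have [vu|vu] := boolP (v \in modspan u).
  exists u; split=> //=; rewrite subv_add su andbT.
  apply/subvP=> _ /memv_imgP[_ /left_multiplesP[w wR ->] ->]; rewrite lfunE /=.
  by apply: modspan_stable; rewrite ?R_mul.
exists (v :: u); split=> /= [v'||].
- by rewrite inE => /predU1P[->|/fu].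
- by rewrite addvS.
rewrite dimv_disjoint_sum ?dimu ?mulSn; last first.
  apply/eqP; rewrite -subv0; apply/subvP=> x; rewrite memv_cap memv0.
  case/andP=> /memv_imgP[_ /left_multiplesP[w wR ->] ->]; rewrite lfunE /= => xu.
  have [->|fw] := eqVneq (f * w) 0; first by rewrite mul0r.
  have [w' wR' E] := recover _ wR fw.
  by move: (modspan_stable wR' xu); rewrite E (negPf vu).
congr (_ + _)%N; apply: limg_dim_eq; apply/eqP; rewrite -subv0; apply/subvP=> x.
rewrite memv_cap memv_ker memv0; case/andP=> /left_multiplesP[w wR ->].
rewrite lfunE /= => /eqP fwv; apply/eqP; apply/eqP/negPn/negP => fw.
have [w' wR' E] := recover _ wR fw.
by move: vu; rewrite -E fwv mulr0 mem0v.
Qed.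

Lemma full_modspan : exists u, [/\ forall v, v \in u -> f * v = v,
    (left_multiples f fullv <= modspan u)%VS
  & (size u * \dim (left_multiples f R) <= \dim (left_multiples f fullv))%N].
Proof.
have [v /mapP[b _ ->]|u [fu su dimu]] :=
    @modspan_basis [seq f * b | b <- vbasis {:A}]; first by rewrite mulrA ff.
exists u; split=> //.
  apply: subv_trans su; apply/subvP=> _ /left_multiplesP[b _ ->].
  rewrite (coord_vbasis (memvf b)) mulr_sumr; apply: memv_suml => i _.
  rewrite -scalerAr memvZ //.
  have : (vbasis {:A})`_i \in (vbasis {:A} : seq A) by rewrite mem_nth // size_tuple.
  move: (vbasis {:A})`_i => x; elim: (vbasis {:A} : seq A) => //= v s IH; rewrite inE => /predU1P[->|vs].
    apply: (subvP (addvSl _ _)); apply/memv_imgP; exists f; last by rewrite lfunE /= mulrA ff.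
    by rewrite -{1}[f]mulr1 mem_left_multiples ?R_1.
  by apply: (subvP (addvSr _ _)); apply: IH.
rewrite -dimu; apply/dimvS/subvP; apply: modspan_ind => [|x y xV yV|w v wR vu].
- exact: mem0v.
- exact: memvD.
by rewrite -mulrA mem_left_multiples ?memvf.
Qed.

Local Notation C := ('C(L))%VS.

Lemma CP x : reflect (forall l, l \in L -> l * x = x * l) (x \in C).
Proof. by apply: (iffP centvP) => h l lL; rewrite h. Qed.

(** [c (x) s |-> (b |-> c b s)] embeds [fC (x)_F Symd] into the endomorphisms of [fA]
    over the field [fR], which are determined on a basis. *)
Lemma corner_bound :
  (\dim (symd sigma) * \dim (left_multiples f C) * \dim (left_multiples f R) <=
   \dim (left_multiples f fullv) ^ 2)%N.
Proof.
have [u [fu full_u size_u]] := full_modspan.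
pose N := \dim (symd sigma); pose s (i : 'I_N) := (vbasis (symd sigma))`_i.
pose U := left_multiples f C; pose V := left_multiples f fullv.
pose ev (c : 'I_N -> A) b := \sum_i c i * b * s i.
pose psi (c : {ffun 'I_N -> subvs_of U}) : {ffun 'I_(size u) -> subvs_of V} :=
  [ffun l : 'I_(size u) => vsproj V (ev (fun i => vsval (c i)) u`_l)].
have psi_lin : linear psi.
  move=> k c c'; apply/ffunP=> l; rewrite !ffunE -linearP; congr (vsproj V _).
  rewrite /ev scaler_sumr -big_split; apply: eq_bigr => i _ /=.
  by rewrite !ffunE linearP /= !mulrDl -!scalerAl.
pose psil := linfun (HB.pack_for {linear {ffun 'I_N -> subvs_of U} -> {ffun 'I_(size u) -> subvs_of V}} psi
  (GRing.isLinear.Build _ _ _ _ psi psi_lin)).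
have psilE c : psil c = psi c by rewrite lfunE.
have cC (c : subvs_of U) : exists2 c', c' \in C & vsval c = f * c'.
  by apply/left_multiplesP; apply: subvsP.
have fC y : y \in C -> f * y = y * f by move=> /CP yC; apply: R_C.
have psi_inj c : psi c = 0 -> c = 0.
  move=> c0; have fc i : f * vsval (c i) = vsval (c i) /\ vsval (c i) * f = vsval (c i).
    have [c' cC' ->] := cC (c i); rewrite mulrA ff; split=> //.
    by rewrite -mulrA -(fC _ cC') mulrA ff.
  have ev_f b : f * ev (fun i => vsval (c i)) b = ev (fun i => vsval (c i)) b.
    by rewrite /ev mulr_sumr; apply: eq_bigr => i _; rewrite !mulrA (fc i).1.
  have ev0 v : v \in u -> ev (fun i => vsval (c i)) v = 0.
    move=> vu; have lt : (index v u < size u)%N by rewrite index_mem.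
    move/ffunP/(_ (Ordinal lt)): c0; rewrite !ffunE /= nth_index // => E.
    have inV : ev (fun i => vsval (c i)) v \in V by rewrite -ev_f mem_left_multiples ?memvf.
    by rewrite -(vsprojK inV) E linear0.
  have evall b : ev (fun i => vsval (c i)) b = 0.
    have -> : ev (fun i => vsval (c i)) b = ev (fun i => vsval (c i)) (f * b).
      by apply: eq_bigr => i _; rewrite mulrA (fc i).2.
    have := subvP full_u _ (mem_left_multiples f (memvf b)).
    move: (f * b); apply: modspan_ind => [|x y x0 y0|w v wR vu].
    - by rewrite /ev big1 // => i _; rewrite mulr0 mul0r.
    - rewrite -[0]addr0 -{1}x0 -y0 -big_split; apply: eq_bigr => i _ /=.
      by rewrite mulrDr mulrDl.
    rewrite -[RHS](mulr0 (f * w)) -(ev0 _ vu) mulr_sumr; apply: eq_bigr => i _.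
    have fwR : f * w \in R by exact: R_mul.
    have [c' /CP cC' Ec] := cC (c i); have cfw : f * w * vsval (c i) = vsval (c i) * (f * w).
      apply: R_C => // l lL; rewrite Ec mulrA -(R_comm fR (L_R lL)) -!mulrA.
      by rewrite cC' // mulrA.
    by rewrite !mulrA cfw !mulrA.
  have meet := involution_ideals_meet_center hA.
  have sc0 := @sandwich_independent _ _ N s (fun i => sigma (vsval (c i))) meet.
  apply/ffunP=> i; rewrite ffunE; apply: subvs_inj; rewrite linear0.
  apply: (can_inj sK); rewrite linear0; move: i; apply: sc0 => [z zZ rel|b].
    have [p pE] : exists p : 'I_N -> F, forall i, exists q, z i = (p i)%:A + q *: zeta.
      exact: fin_all_exists (fun i => zGen (zZ i)).
    have [q qE] : exists q : 'I_N -> F, forall i, z i = (p i)%:A + q i *: zeta.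
      exact: fin_all_exists pE.
    have /freeP bfree := basis_free (vbasisP (symd sigma)).
    have ssym (k : 'I_N -> F) : sigma (\sum_i k i *: s i) = \sum_i k i *: s i.
      rewrite linear_sum; apply: eq_bigr => i _; rewrite linearZ /=; congr (_ *: _).
      apply: (symd_sigma kd); apply: vbasis_mem; rewrite mem_nth // size_tuple //.
    have [p0 q0] : \sum_i p i *: s i = 0 /\ \sum_i q i *: s i = 0.
      apply: (symmetric_independent (ssym p) (ssym q)); rewrite -[RHS]rel mulr_sumr -big_split.
      apply: eq_bigr => i _ /=; rewrite qE mulrDr mulr_algr -!scalerAr.
      by rewrite (zC (s i)).
    by move=> i; rewrite qE (bfree _ p0) (bfree _ q0) !scale0r addr0.
  transitivity (sigma (ev (fun i => vsval (c i)) (sigma b))); last first.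
    by rewrite evall linear0.
  rewrite /ev linear_sum; apply: eq_bigr => i _ /=.
  rewrite !sM sK mulrA; congr (_ * _ * _); apply/esym/(symd_sigma kd)/vbasis_mem.
  by rewrite mem_nth // size_tuple.
have dim_le : (N * \dim U <= size u * \dim V)%N.
  have <- : \dim {: {ffun 'I_N -> subvs_of U}} = (N * \dim U)%N.
    by rewrite dimvf /dim /= card_ord /dim.
  have <- : \dim {: {ffun 'I_(size u) -> subvs_of V}} = (size u * \dim V)%N.
    by rewrite dimvf /dim /= card_ord /dim.
  rewrite -(limg_dim_eq (f := psil) (U := fullv)) ?dimvS ?subvf //.
  apply/eqP; rewrite -subv0; apply/subvP=> c; rewrite memv_cap memv_ker psilE memv0.
  by case/andP=> _ /eqP/psi_inj->.
apply: leq_trans (leq_mul dim_le (leqnn _)) _.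
by rewrite mulnAC expnS expn1 leq_mul.
Qed.

End FieldIdempotent.

Local Notation C := ('C(L))%VS.

(** [f A] is spanned over [f L] by a basis of [A] over [L]. *)
Lemma left_multiples_dim_L f : f \in L ->
  (\dim (left_multiples f fullv) <= \dim {:A} %/ 4 * \dim (left_multiples f L))%N.
Proof.
move=> fL; have [r [b [r4 gen]]] := free_module_rank dimL freeL.
have -> : (\dim {:A} %/ 4 = r)%N by rewrite -r4 mulnK.
apply: leq_trans (_ : \dim (\sum_(j < r) (amulr (b j) @: left_multiples f L))%VS <= _)%N.
  apply/dimvS/subvP=> _ /left_multiplesP[x _ ->]; have [l ->] := gen x.
  rewrite mulr_sumr; apply: memv_sumr => j _; apply/memv_imgP.
  by exists (f * vsval (l j)); rewrite ?lfunE /= ?mulrA ?mem_left_multiples ?subvsP.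
apply: leq_trans (dimv_leq_sum _ _ _) _.
rewrite -[X in (_ <= X * _)%N]card_ord -sum_nat_const; apply: leq_sum => j _.
by rewrite -(limg_ker_dim (amulr (b j)) (left_multiples f L)) leq_addl.
Qed.

Lemma left_multiples_dim_R f : f \in L ->
  (\dim (left_multiples f L) * 2 <= \dim (left_multiples f R))%N.
Proof.
move=> fL; set V := left_multiples f L.
have VL x : x \in V -> x \in L by case/left_multiplesP=> y yL ->; apply: LM.
have dimz : \dim (left_multiples zeta V) = \dim V.
  apply: limg_dim_eq; apply/eqP; rewrite -subv0; apply/subvP=> x.
  rewrite memv_cap memv_ker memv0 => /andP[xV]; rewrite lfunE /= => /eqP zx.
  have [] := @symmetric_independent 0 x (linear0 _) (kd_s kd (VL _ xV)).
    by rewrite add0r.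
  by move=> _ ->.
rewrite muln2 -addnn -{2}dimz -dimv_disjoint_sum.
  apply/dimvS; rewrite subv_add; apply/andP; split; apply/subvP.
    by move=> _ /left_multiplesP[y yL ->]; rewrite mem_left_multiples ?L_R.
  move=> _ /left_multiplesP[_ /left_multiplesP[y yL ->] ->].
  by rewrite mulrA zC -mulrA mem_left_multiples ?zeta_R.
apply/eqP; rewrite -subv0; apply/subvP=> x; rewrite memv_cap memv0.
case/andP=> xV /left_multiplesP[y yV xy].
have [x0 _] : x = 0 /\ - y = 0; last by rewrite x0.
apply: symmetric_independent.
- exact: (kd_s kd (VL _ xV)).
- by rewrite linearN /= (kd_s kd (VL _ yV)).
by rewrite mulrN -xy subrr.
Qed.

Lemma left_multiples_sigma f (V : {vspace A}) : f \in R ->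
  (forall v, v \in V -> sigma v \in V /\ forall l, l \in L -> l * v = v * l) ->
  \dim (left_multiples (sigma f) V) = \dim (left_multiples f V).
Proof.
move=> fR hV; have <- : (sigma @: left_multiples f V)%VS = left_multiples (sigma f) V.
  apply/vspaceP=> x; apply/memv_imgP/left_multiplesP.
    case=> _ /left_multiplesP[v vV ->] ->; have [svV vL] := hV v vV.
    by exists (sigma v); rewrite // -sM -(R_C fR vL).
  case=> v vV ->; have [svV vL] := hV v vV; have [_ svL] := hV _ svV.
  exists (f * sigma v); first exact: mem_left_multiples.
  by rewrite (R_C fR svL) sM sK.
apply: limg_dim_eq; apply/eqP; rewrite -subv0; apply/subvP=> x.
rewrite memv_cap memv_ker memv0 => /andP[_ /eqP sx]; apply/eqP.
by rewrite -[x]sK sx linear0.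
Qed.

Lemma R_L_comm x : x \in R -> forall l, l \in L -> l * x = x * l.
Proof. by move=> xR l lL; rewrite (R_comm (L_R lL) xR). Qed.

Lemma C_sigma x : x \in C -> sigma x \in C.
Proof.
move=> /CP xC; apply/CP => l lL; apply: (can_inj sK).
by rewrite !sM !sK (kd_s kd lL) xC.
Qed.

Lemma field_idempotent_sigma f : field_idempotent f -> field_idempotent (sigma f).
Proof.
case=> fR ff f0 finv; split; first exact: R_sigma.
- by rewrite -sM ff.
- by apply: contraNneq f0 => sf; rewrite -[f]sK sf linear0.
move=> w wR fw; have swR := R_sigma wR.
have [|w' wR' E] := finv (sigma w) swR.
  apply: contraNneq fw => fw; rewrite R_comm ?R_sigma //.
  by rewrite -[w]sK -sM fw linear0.
exists (sigma w'); first exact: R_sigma.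
rewrite -[RHS](congr1 sigma E) sM R_comm ?R_mul ?R_sigma //.
by congr (_ * _); rewrite sM sK R_comm ?R_sigma.
Qed.

Hypothesis dimA : \dim {:A} = 32%N.

(** A field idempotent [f] and its conjugate are equal or orthogonal; in both cases
    freeness over [L] bounds the dimension of [fA] or of its conjugate. *)
Lemma field_idempotent_half f : field_idempotent f ->
  (\dim (left_multiples f fullv) <= 4 * \dim (left_multiples f R))%N \/
  (\dim (left_multiples (sigma f) fullv) <= 4 * \dim (left_multiples f R))%N.
Proof.
move=> fld; have [fR ff f0 finv] := fld.
have [sfR sff sf0 sfinv] := field_idempotent_sigma fld.
have freeA h : h \in L ->
    (\dim (left_multiples h fullv) <= 4 * \dim (left_multiples h R))%N.
  move=> hL; have := left_multiples_dim_L hL; have := left_multiples_dim_R hL.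
  rewrite dimA (_ : 32 %/ 4 = 8)%N //.
  by move: (\dim (left_multiples h L)) (\dim _) (\dim _) => *; lia.
have [sf|nsf] := eqVneq (sigma f) f; first by left; apply: freeA; apply: R_sym.
have ort : f * sigma f = 0.
  apply/eqP/negPn/negP => fs; case/eqP: nsf.
  have [w wR E] := finv _ sfR fs.
  have fs' : sigma f * f != 0 by rewrite R_comm.
  have [w' wR' E'] := sfinv _ fR fs'.
  have h1 : f * sigma f = f by rewrite -{1}E -!mulrA sff E.
  have h2 : sigma f * f = sigma f by rewrite -{1}E' -!mulrA ff E'.
  by rewrite -h2 (R_comm sfR fR) h1.
have hL : f + sigma f \in L by apply: R_sym; rewrite ?memvD // linearD /= sK addrC.
have sort : sigma f * f = 0 by rewrite (R_comm sfR fR).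
have absorb x V : x \in left_multiples f V -> f * x = x.
  by case/left_multiplesP=> y _ ->; rewrite mulrA ff.
have disj (V : {vspace A}) : \dim (left_multiples f V + left_multiples (sigma f) V)%VS =
    (\dim (left_multiples f V) + \dim (left_multiples (sigma f) V))%N.
  apply: dimv_disjoint_sum; apply/eqP; rewrite -subv0; apply/subvP=> x.
  rewrite memv_cap memv0; case/andP=> /absorb fx /left_multiplesP[y _ xy].
  by rewrite -fx xy mulrA ort mul0r.
have lower : (\dim (left_multiples f fullv) + \dim (left_multiples (sigma f) fullv) <=
    \dim (left_multiples (f + sigma f)%R fullv))%N.
  rewrite -disj; apply/dimvS; rewrite subv_add; apply/andP; split; apply/subvP.
    move=> _ /left_multiplesP[y _ ->]; apply/left_multiplesP; exists (f * y); rewrite ?memvf //.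
    by rewrite mulrDl !mulrA ff sort mul0r addr0.
  move=> _ /left_multiplesP[y _ ->]; apply/left_multiplesP; exists (sigma f * y); rewrite ?memvf //.
  by rewrite mulrDl !mulrA sff ort mul0r add0r.
have upper : (\dim (left_multiples (f + sigma f)%R R) <=
    \dim (left_multiples f R) + \dim (left_multiples (sigma f) R))%N.
  rewrite -disj; apply/dimvS/subvP=> _ /left_multiplesP[y yR ->].
  by rewrite mulrDl memv_add ?mem_left_multiples.
have dimsR : \dim (left_multiples (sigma f) R) = \dim (left_multiples f R).
  by apply: left_multiples_sigma => // v vR; split; [apply: R_sigma | apply: R_L_comm].
rewrite dimsR in upper; have bound := freeA _ hL.
case: (leqP (\dim (left_multiples f fullv)) (4 * \dim (left_multiples f R))).
  by left.
by move=> lt; right; move: lower upper bound lt; lia.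
Qed.

(** By [corner_bound] for [f] or its conjugate, [16 dim (f C) dim (f R)] is at most
    [(4 dim (f R))^2], so [f C] is not larger than [f R]. *)
Lemma field_idempotent_centralizer f : field_idempotent f ->
  left_multiples f C = left_multiples f R.
Proof.
move=> fld; have [fR ff f0 _] := fld; apply/esym/eqP; rewrite eqEdim.
have -> : (left_multiples f R <= left_multiples f C)%VS.
  apply/subvP=> _ /left_multiplesP[y yR ->]; rewrite mem_left_multiples //.
  by apply/CP; apply: R_L_comm.
have sfld := field_idempotent_sigma fld.
have dimsR : \dim (left_multiples (sigma f) R) = \dim (left_multiples f R).
  apply: left_multiples_sigma => // v vR.
  by split; [apply: R_sigma | apply: R_L_comm].
have dimsC : \dim (left_multiples (sigma f) C) = \dim (left_multiples f C).
  apply: left_multiples_sigma => // v vC.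
  by split; [apply: C_sigma | apply/CP].
have d16 : \dim (symd sigma) = 16%N by have := second_kind_symd_dim; rewrite dimA; lia.
have pos : (0 < \dim (left_multiples f R))%N.
  rewrite lt0n dimv_eq0; apply: contraNneq f0 => fR0.
  by have := mem_left_multiples f R_1; rewrite fR0 memv0 mulr1.
have [] := field_idempotent_half fld => le4 /=.
  by have := corner_bound fld; rewrite d16; move: le4 pos; nia.
have := corner_bound sfld; rewrite d16 dimsR dimsC; move: le4 pos; nia.
Qed.

(** Split off field idempotents from 1 until nothing is left. *)
Lemma R_centralizer c : c \in C -> c \in R.
Proof.
move=> cC; rewrite -[c]mul1r.
suff corner f : f \in R -> f * f = f -> f * c \in R by apply: corner R_1 (mulr1 1).
have [k] := ubnP (\dim (left_multiples f R)).
elim: k f => // k IH f lt fR ff.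
have [->|f0] := eqVneq f 0; first by rewrite mul0r mem0v.
have [h hfld fh] := exists_field_idempotent fR ff f0.
have [hR hh h0 _] := hfld; rewrite -(subrK h f) mulrDl memvD //; last first.
  have := mem_left_multiples h cC; rewrite field_idempotent_centralizer //.
  by case/left_multiplesP=> y yR ->; apply: R_mul.
have hf : h * f = h by rewrite R_comm.
have gh : (f - h) * h = 0 by rewrite mulrBl fh hh subrr.
apply: IH; rewrite ?memvB //; last first.
  by rewrite mulrBr gh subr0 mulrBl ff hf.
have sub : (left_multiples (f - h) R <= left_multiples f R)%VS.
  apply/subvP=> _ /left_multiplesP[y yR ->].
  have -> : (f - h) * y = f * ((f - h) * y) by rewrite mulrA mulrBr ff fh.
  by rewrite mem_left_multiples ?R_mul ?memvB.
rewrite ltnS in lt; apply: leq_trans lt; rewrite ltn_neqAle (dimvS sub) andbT.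
apply: contra h0 => /eqP dimE; have /eqP E : left_multiples (f - h) R == left_multiples f R.
  by rewrite eqEdim sub dimE /=.
have := mem_left_multiples f hR; rewrite fh -E => /left_multiplesP[y yR hy].
by rewrite -hh {2}hy mulrA (R_comm hR) ?memvB // gh mul0r.
Qed.

Lemma second_kind_centralizer x :
  x \in symd sigma -> twisted L (gal g None) x -> x \in L.
Proof.
move=> xS xC; apply: R_sym (symd_sigma kd xS); apply: R_centralizer.
by apply/CP => l lL; rewrite (xC l lL) /= id_lfunE.
Qed.

End CentralGenerator.
Lemma unitary_conclusion : \dim {:A} = 32%N ->
  symd_structure sigma L g 16 /\ (forall i j (z : 'I_4 -> A), i != j ->
    (forall k, z k \in 'Z({:A})%VS) ->
    z 0 + a i * z 1 + a j * z 2%:R + a j * a i * z 3%:R = 0 -> forall k, z k = 0).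
Proof.
move=> dimA; have [zeta [zC zGen [n [e [[zn e0 ze] [t zt]]]]]] := center_gen.
have indep := second_kind_independent zC zGen zt e0 ze.
split=> //; split.
- exact: (second_kind_centralizer zC zGen zn zt e0 ze dimA).
- move=> i x _; apply: (nondegenerate_unitary kd (involution_ideals_meet_center hA) indep (z := zeta)).
    exact/centerP.
  exact: del_reg e0 ze.
by have := second_kind_symd_dim zC zt e0 ze; rewrite dimA; lia.
Qed.

End SecondKind.

(** * The dimension of an algebra of capacity four *)

Section Capacity.

Variables (F : fieldType) (A : falgType F) (sigma : 'End(A)).

Lemma split_center_dim : split_center A -> \dim 'Z({:A})%VS = 2%N.
Proof.
case=> f [g' bij]; pose h (z : subvs_of 'Z({:A})%AS) : (F^o * F^o)%type := (f z, g' z).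
have h_lin : linear h.
  by move=> k x y; rewrite /h !linearP.
pose hl := HB.pack_for {linear subvs_of 'Z({:A})%AS -> (F^o * F^o)%type} h
  (GRing.isLinear.Build _ _ _ _ h h_lin).
have hb : bijective hl by [].
by have := bij_lfun_dim hb; rewrite dim_subvs dim_prod !dimvf.
Qed.

(** In the split case [A] is the product of two copies of an algebra of dimension [d^2] and
    the centre has dimension 2, so the formula is the same. *)
Lemma degree_dim d : has_degree sigma d ->
  \dim {:A} = (d ^ 2 * \dim 'Z({:A}))%N.
Proof.
case=> [[spZ [A0 [_ [phi [bij _ _ _]] dim0]]]|[_ //]].
by rewrite (bij_lfun_dim bij) dim_prod dim0 split_center_dim // muln2 addnn.
Qed.

Lemma capacity_cases : has_capacity sigma 4 ->
  [\/ has_type sigma Orthogonal /\ \dim {:A} = 16%N,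
      has_type sigma Unitary /\ \dim {:A} = 32%N
    | has_type sigma Symplectic /\ \dim {:A} = 64%N].
Proof.
case=> [[[ty|ty] /degree_dim dimA]|[ty /degree_dim dimA]].
- by apply: Or31; split=> //; case: (ty) => Z1 _; rewrite dimA Z1 dimv1.
- apply: Or32; split=> //; case: (ty) => -[_ dimZ] _.
  by rewrite dim_subvs in dimZ; rewrite dimA dimZ.
by apply: Or33; split=> //; case: (ty) => Z1 _; rewrite dimA Z1 dimv1.
Qed.

End Capacity.

(** The types of [sigma] enter only through [symd_structure] and the independence of a
    basis of [L] over the centre. *)
Theorem theorem7p3 (F : fieldType) (A : falgType F) (sigma : 'End(A))
    (hA : algebra_with_involution sigma)
    (h1 : 1 \in symd sigma)
    (hcap : has_capacity sigma 4)
    (n : nat) (hn : \dim {:A} = (2 ^ (n + 3))%N)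
    (L : {aspace A}) (hL : neat sigma L) (hbiq : biquadratic (subvs_of L))
    (gamma : 'I_3 -> 'AEnd(subvs_of L)) (hG : galois_enumeration gamma) :
  (exists (V : vectType F) (pi : V -> F),
     pfister_invariant sigma n gamma pi /\
     forall (V' : vectType F) (pi' : V' -> F),
       pfister_invariant sigma n gamma pi' -> isometric pi' pi) /\
  (symd sigma = L + \sum_(i < 3) twisted_symd sigma (gamma i))%VS /\
  directv (L + \sum_(i < 3) twisted_symd sigma (gamma i)).
Proof.
have [sM sK _ _] := hA; have [L1 etL Ls freeL _] := hL.
have dimL : \dim L = 4%N by case: hbiq => _; rewrite dim_subvs.
have [a kd] := neat_klein_data sM sK L1 etL Ls hbiq hG.
have dimK i : \dim (fixedSpace_aspace (gamma i)) = 2%N.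
  by have [_ ginv _] := hG; have [_ _ [_ <-]] := ginv i; rewrite dim_subvs.
have [[concl indep] [dimS n3]] : (symd_structure sigma L (galois_lift gamma)
      (4 + 3 * 2 ^ n) /\ (forall i j (z : 'I_4 -> A), i != j ->
    (forall k, z k \in 'Z({:A})%VS) ->
    z 0 + a i * z 1 + a j * z 2%:R + a j * a i * z 3%:R = 0 -> forall k, z k = 0))
   /\ (\dim (symd sigma) = 4 + 3 * 2 ^ n /\ 0 < n <= 3)%N.
  have exp k : \dim {:A} = (2 ^ k)%N -> (n + 3)%N = k.
    by rewrite hn => /eqP; rewrite eqn_exp2l // => /eqP.
  case: (capacity_cases hcap) => -[ty dimA].
  - have n1 : n = 1%N by have := exp 4%N dimA; lia.
    have concl := orthogonal_conclusion kd dimL h1 freeL hA ty.1 ty dimA.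
    have := concl; case=> _ _ dimS.
    rewrite n1; split; split=> //.
    exact: central_independent kd ty.1.
  - have n2 : n = 2%N by have := exp 5%N dimA; lia.
    have [concl indep] := unitary_conclusion kd dimL h1 freeL hA ty dimA.
    have := concl; case=> _ _ dimS.
    by rewrite n2; split; split.
  have n3 : n = 3%N by have := exp 6%N dimA; lia.
  have concl := symplectic_conclusion kd dimL h1 freeL hA ty.1 ty dimA.
  have := concl; case=> _ _ dimS.
  rewrite n3; split; split=> //.
  exact: central_independent kd ty.1.
have [centr nondeg _] := concl.
split; last first.
  split; first exact: (symd_sum h1 kd centr).
  exact: (symd_directv kd).
have sP : forall i, exists s : 'Hom(subvs_of (fixedSpace_aspace (gamma i)), F^o),
    lker s = 1%VS /\ s (gen_lift gamma a i) = 1.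
  by move=> i; have [s s1 s2] := form_exists kd dimK i; exists s.
have [s sE] := fin_all_exists sP.
have meet := involution_ideals_meet_center hA.
have ndW i y : W sigma L (galois_lift gamma) i y ->
    (forall b, twisted L (gal (galois_lift gamma) (Some i)) b ->
     b * y + sigma (b * y) = 0) -> y = 0.
  by move=> yW; apply: nondeg; case: yW.
have Wn0 := W_neq0 kd meet indep.
have M := square_forms_invariant dimL h1 kd dimK centr ndW Wn0.
have M1 := M s (fun i => (sE i).1) (fun i => (sE i).2).
exact: M1 dimS n3.
Qed.
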